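(* Let $\Theta=\tilde p/p$ be a rational inner function on $\mathbb{D}^2$ of degree $(m,n)$, and let $\mathcal{K}_\Theta=\mathcal{S}_1\oplus\mathcal{S}_2$ be an orthogonal decomposition into closed subspaces with $\mathcal{S}_1$ invariant under $M_{z_1}$ and $\mathcal{S}_2$ invariant under $M_{z_2}$. Let $K_1,K_2$ be the reproducing kernels with $\mathcal{H}(K_1)=\mathcal{S}_1\ominus z_1\mathcal{S}_1$ and $\mathcal{H}(K_2)=\mathcal{S}_2\ominus z_2\mathcal{S}_2$. Let $E_\Theta=\{\tau\in\mathbb{T}:\exists\,\tau_1\in\mathbb{T}\text{ with }p(\tau_1,\tau)=0\}$. Then for every $\tau\in\mathbb{T}\setminus E_\Theta$, the slice function $\Theta_\tau:=\Theta(\cdot,\tau)$ is a Blaschke product of degree $m$, and the restriction map $\mathcal{J}_\tau:\mathcal{H}(K_2)\to\mathcal{K}_{\Theta_\tau}$, $\mathcal{J}_\tau f=f(\cdot,\tau)$, is well defined and unitary. Furthermore $\dim\mathcal{H}(K_2)=m$. The analogous statements hold for $\mathcal{H}(K_1)$: with $E'_\Theta=\{\tau\in\mathbb{T}:\exists\,\tau_2\in\mathbb{T}\text{ with }p(\tau,\tau_2)=0\}$, for every $\tau\in\mathbb{T}\setminus E'_\Theta$ the function $\Theta(\tau,\cdot)$ is a Blaschke product of degree $n$, the map $g\mapsto g(\tau,\cdot)$ is a unitary from $\mathcal{H}(K_1)$ onto the one-variable model space of $\Theta(\tau,\cdot)$, and $\dim\mathcal{H}(K_1)=n$.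
   Context: $\mathbb{D}$ is the open unit disk, $\mathbb{T}$ the unit circle, $H^2(\mathbb{D}^2)$ the Hardy space of the bidisk. A rational inner function on $\mathbb{D}^2$ is a rational function holomorphic on $\mathbb{D}^2$ with $|\Theta|=1$ a.e. on $\mathbb{T}^2$. Its degree $(m,n)$ is defined by writing $\Theta=q/p$ in lowest terms: $m$ (resp. $n$) is the highest power of $z_1$ (resp. $z_2$) appearing in $p$ or $q$. Such $\Theta$ can be written $\Theta=\tilde p/p$ with $p$ a polynomial with no zeros on $\mathbb{D}^2$, $\tilde p(z)=z_1^mz_2^n\overline{p(1/\bar z_1,1/\bar z_2)}$, and $p,\tilde p$ without common factors. The two-variable model space is $\mathcal{K}_\Theta=H^2(\mathbb{D}^2)\ominus\Theta H^2(\mathbb{D}^2)$; for a one-variable inner (Blaschke) function $B$, $\mathcal{K}_B=H^2(\mathbb{D})\ominus BH^2(\mathbb{D})$. $\mathcal{H}(K)$ denotes the reproducing kernel Hilbert space with kernel $K$. Elements of $\mathcal{H}(K_2)$ are rational functions of the form $q/p$ with $q$ a polynomial, so $f(\cdot,\tau)$ makes sense for $\tau\in\mathbb{T}\setminus E_\Theta$. *)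

(* Defs.v *)
(* Complex numbers are  R[i]  (mathcomp-real-closed
   complex.v) over an arbitrary  R : realType. *)
From mathcomp Require Import all_boot all_algebra.
From mathcomp Require Import all_classical all_reals all_analysis.
From mathcomp Require Import complex.
Set Implicit Arguments. Unset Strict Implicit. Unset Printing Implicit Defensive.
Import GRing.Theory Num.Theory.
Import numFieldNormedType.Exports.
Local Open Scope classical_set_scope.
Local Open Scope ring_scope.

Section Defs.
Variable R : realType.
Local Notation C := (R[i]).

(* ---------- points of the disk / circle ---------- *)
Definition inD (z : C) : bool := `|z| < 1.
Definition onT (z : C) : bool := `|z| == 1.

(* ---------- complex limits, via real and imaginary parts ---------- *)
Definition clim (u : nat -> C) : C :=
  Complex (limn (fun N => complex.Re (u N))) (limn (fun N => complex.Im (u N))).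

(* F r --> l as r --> 1^- (r real) *)
Definition radlim (F : R -> C) (l : C) : Prop :=
  (fun r => complex.Re (F r)) r @[r --> 1^'-] --> complex.Re l /\
  (fun r => complex.Im (F r)) r @[r --> 1^'-] --> complex.Im l.

Definition sqmod (z : C) : R := complex.Re z ^+ 2 + complex.Im z ^+ 2.

(* ---------- Hardy spaces, elements given by Taylor coefficients ---------- *)
Definition coef1 := nat -> C.
Definition coef2 := nat -> nat -> C.

Definition H2_1 (a : coef1) : Prop :=
  exists M : R, forall N, \sum_(i < N) sqmod (a i) <= M.
Definition H2_2 (a : coef2) : Prop :=
  exists M : R, forall N, \sum_(i < N) \sum_(j < N) sqmod (a i j) <= M.

Definition ip1 (a b : coef1) : C :=
  clim (fun N => \sum_(i < N) a i * (b i)^*).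
Definition ip2 (a b : coef2) : C :=
  clim (fun N => \sum_(i < N) \sum_(j < N) a i j * (b i j)^*).

(* value of the power series at a point of D, resp. D^2 *)
Definition eval1 (a : coef1) (z : C) : C :=
  clim (fun N => \sum_(i < N) a i * z ^+ i).
Definition eval2 (a : coef2) (z1 z2 : C) : C :=
  clim (fun N => \sum_(i < N) \sum_(j < N) a i j * z1 ^+ i * z2 ^+ j).

(* multiplication by z1, z2 on coefficients *)
Definition shift1 (f : coef2) : coef2 :=
  fun i j => if i is i'.+1 then f i' j else 0.
Definition shift2 (f : coef2) : coef2 :=
  fun i j => if j is j'.+1 then f i j' else 0.

(* closed (in the H^2 norm) linear subspace of H^2(D^2) *)
Definition closed_subspace2 (S : set coef2) : Prop :=
  [/\ (forall f, S f -> H2_2 f),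
      S (fun _ _ => 0),
      (forall f g, S f -> S g -> S (fun i j => f i j + g i j)),
      (forall (c : C) f, S f -> S (fun i j => c * f i j)) &
      (forall (u : nat -> coef2) f, (forall k, S (u k)) -> H2_2 f ->
         (fun k => complex.Re (ip2 (fun i j => u k i j - f i j)
                                   (fun i j => u k i j - f i j))) @ \oo --> 0 ->
         S f)].

(* ---------- bivariate polynomials: {poly {poly C}}, inner variable z1, outer z2 ---------- *)
Definition peval (p : {poly {poly C}}) (z1 z2 : C) : C := (p.[z2%:P]).[z1].

(* bidegree at most (m, n) *)
Definition bideg_le (m n : nat) (p : {poly {poly C}}) : Prop :=
  leq (size p) n.+1 /\ forall j, leq (size p`_j) m.+1.

(* reflection  ptilde(z) = z1^m z2^n conj(p(1/conj z1, 1/conj z2)) *)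
(* coefficient of z1^i z2^j *)
Definition pcoef (p : {poly {poly C}}) (i j : nat) : C := (p`_j)`_i.

Definition prefl (m n : nat) (p : {poly {poly C}}) : {poly {poly C}} :=
  \poly_(j < n.+1) \poly_(i < m.+1) (pcoef p (m - i) (n - j))^*.

(* p and q have no common (non-constant) factor in C[z1, z2] *)
Definition no_common_factor (p q : {poly {poly C}}) : Prop :=
  forall d a b : {poly {poly C}}, p = d * a -> q = d * b -> exists c : C, d = c%:P%:P.

Definition no_zeros_D2 (p : {poly {poly C}}) : Prop :=
  forall z1 z2, inD z1 -> inD z2 -> peval p z1 z2 != 0.

(* Theta = ptilde / p *)
Definition Theta (m n : nat) (p : {poly {poly C}}) (z1 z2 : C) : C :=
  peval (prefl m n p) z1 z2 / peval p z1 z2.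

(* two-variable model space  K_Theta = H^2 (-) Theta H^2 *)
Definition KTheta (m n : nat) (p : {poly {poly C}}) : set coef2 :=
  [set f | H2_2 f /\
     forall g h : coef2, H2_2 g -> H2_2 h ->
       (forall z1 z2, inD z1 -> inD z2 -> eval2 g z1 z2 = Theta m n p z1 z2 * eval2 h z1 z2) ->
       ip2 f g = 0].

(* one-variable model space  K_B = H^2 (-) B H^2 *)
Definition Kmodel1 (B : C -> C) : set coef1 :=
  [set b | H2_1 b /\
     forall g h : coef1, H2_1 g -> H2_1 h ->
       (forall z, inD z -> eval1 g z = B z * eval1 h z) ->
       ip1 b g = 0].

(* finite Blaschke product of degree d *)
Definition blaschke (B : C -> C) (d : nat) : Prop :=
  exists (c : C) (a : 'I_d -> C),
    [/\ `|c| = 1, (forall k, inD (a k)) &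
        forall z, inD z -> B z = c * \prod_(k < d) ((z - a k) / (1 - (a k)^* * z))].

(* orthogonal decomposition K = S1 (+) S2 *)
Definition orth_decomp (K S1 S2 : set coef2) : Prop :=
  [/\ S1 `<=` K, S2 `<=` K,
      (forall f g, S1 f -> S2 g -> ip2 f g = 0) &
      (forall h, K h -> exists f g, [/\ S1 f, S2 g & h = (fun i j => f i j + g i j)])].

(* S (-) z_k S *)
Definition wandering1 (S : set coef2) : set coef2 :=
  [set f | S f /\ forall g, S g -> ip2 f (shift1 g) = 0].
Definition wandering2 (S : set coef2) : set coef2 :=
  [set f | S f /\ forall g, S g -> ip2 f (shift2 g) = 0].

(* slice maps, as relations "J f = b" *)
(* J_tau f = f(., tau) : radial limit in the second variable *)
Definition slice2 (tau : C) (f : coef2) (b : coef1) : Prop :=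
  H2_1 b /\ forall z1, inD z1 ->
    radlim (fun r => eval2 f z1 (Complex r 0 * tau)) (eval1 b z1).
(* g |-> g(tau, .) : radial limit in the first variable *)
Definition slice1 (tau : C) (g : coef2) (b : coef1) : Prop :=
  H2_1 b /\ forall z2, inD z2 ->
    radlim (fun r => eval2 g (Complex r 0 * tau) z2) (eval1 b z2).

(* J is a well-defined map from H into K which is unitary onto K *)
Definition unitary_map (H : set coef2) (K : set coef1) (J : coef2 -> coef1 -> Prop) : Prop :=
  [/\ (forall f, H f -> exists b, K b /\ J f b),
      (forall f b b', H f -> J f b -> J f b' -> b = b'),
      (forall f g bf bg, H f -> H g -> J f bf -> J g bg -> ip1 bf bg = ip2 f g) &
      (forall b, K b -> exists f, H f /\ J f b)].

(* the (linear) subspace S has dimension d *)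
Definition dim_eq (S : set coef2) (d : nat) : Prop :=
  exists e : 'I_d -> coef2,
    [/\ (forall k, S (e k)),
        (forall c : 'I_d -> C,
           (fun i j => \sum_(k < d) c k * e k i j) = (fun _ _ => 0) -> forall k, c k = 0) &
        (forall f, S f -> exists c : 'I_d -> C, f = (fun i j => \sum_(k < d) c k * e k i j))].

End Defs.

(* Main.v *)
Require Import Defs.
From HB Require Import structures.
From mathcomp Require Import all_boot all_order all_algebra.
From mathcomp Require Import all_classical all_reals all_analysis.
From mathcomp Require Import complex polyXY ring lra zify.
Set Implicit Arguments. Unset Strict Implicit. Unset Printing Implicit Defensive.
Import Order.TTheory GRing.Theory Num.Theory.
Import numFieldNormedType.Exports.
Local Open Scope classical_set_scope.
Local Open Scope ring_scope.

(** Write [<.,.>] for the inner product of the Hardy space of the bidisk, [p~] for the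
    reflection of [p] and W2 for S2 (-) z2 S2.  Testing [f] in K_Theta against the multiples
    of [p~] shows that [p f] has no coefficients of bidegree >= (m, n).  Invariance of S2
    under z2 then gives deg_z1 (p f) < m for f in S2, and for f in W2 the backward z2-shift
    of f lies in S1, whence deg_z2 (p f) <= n.  So W2 consists of fractions q/p, and an
    orthonormal family of W2 has at most m elements, because more than m polynomials of
    z1-degree < m are linearly dependent over C[z2] while the z2-shifts of the family are
    orthonormal.

    Theta acts isometrically: the form <f,g> - <Theta f, Theta g> vanishes on the ideal
    generated by p and p~, which contains a nonzero polynomial in z2 alone.  Hence K_Theta
    contains its Szego-type kernels; splitting them along S1 and S2 gives the Agler identity
      p p^* - p~ p~^* = (1 - z1 w1^* ) sum q_k q_k^* + (1 - z2 w2^* ) sum r_l r_l^*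
    where (q_k / p) is an orthonormal basis of W2.  At z2 = w2 = tau it says that the slices
    of the basis form a Parseval frame of the m-dimensional model space of Theta(., tau).
    Hence there are at least m, so exactly m of them, and they are orthonormal.  The second
    half of the theorem follows by exchanging the two variables. *)

Local Notation Re := complex.Re.
Local Notation Im := complex.Im.
Local Notation normc := Normc.normc.
Local Notation "x %:C" := (real_complex _ x) (format "x %:C") : ring_scope.

(** * Formal power series *)

Definition fps (A : Type) := nat -> A.

HB.instance Definition _ (A : Type) := gen_eqMixin (fps A).
HB.instance Definition _ (A : Type) := gen_choiceMixin (fps A).

Section FpsRing.
Variable A : comNzRingType.
Implicit Types f g h : fps A.

Definition fps_add f g : fps A := fun n => f n + g n.
Definition fps_opp f : fps A := fun n => - f n.
Definition fps_mul f g : fps A := fun n => \sum_(i < n.+1) f i * g (n - i)%N.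
Definition fps_one : fps A := fun n => (n == 0)%:R.

Fact fps_addA : associative fps_add.
Proof. by move=> f g h; apply/funext => n; rewrite /fps_add addrA. Qed.
Fact fps_addC : commutative fps_add.
Proof. by move=> f g; apply/funext => n; rewrite /fps_add addrC. Qed.
Fact fps_add0 : left_id (fun _ => 0 : A) fps_add.
Proof. by move=> f; apply/funext => n; rewrite /fps_add add0r. Qed.
Fact fps_addN : left_inverse (fun _ => 0 : A) fps_opp fps_add.
Proof. by move=> f; apply/funext => n; rewrite /fps_add /fps_opp addNr. Qed.

HB.instance Definition _ := GRing.isZmodule.Build (fps A)
  fps_addA fps_addC fps_add0 fps_addN.

Lemma fps_mul_poly N f g n : (n < N)%N ->
  fps_mul f g n = (\poly_(i < N) f i * \poly_(i < N) g i)`_n.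
Proof.
move=> nN; rewrite coefM; apply: eq_bigr => i _; rewrite !coef_poly.
have iN : (i < N)%N by rewrite (leq_ltn_trans _ nN) // -ltnS.
by rewrite iN (leq_ltn_trans (leq_subr _ _) nN).
Qed.

Fact fps_mulC : commutative fps_mul.
Proof. by move=> f g; apply/funext => n; rewrite !(@fps_mul_poly n.+1) // mulrC. Qed.

Fact fps_mulA : associative fps_mul.
Proof.
have mul3E f g h n : fps_mul (fps_mul f g) h n =
    (\poly_(i < n.+1) f i * \poly_(i < n.+1) g i * \poly_(i < n.+1) h i)`_n.
  rewrite coefM; apply: eq_bigr => i _.
  by rewrite (@fps_mul_poly n.+1) ?ltn_ord // !coef_poly ltnS leq_subr.
move=> f g h; apply/funext => n; rewrite mul3E fps_mulC mul3E.
by congr (_`_n); rewrite mulrC mulrA.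
Qed.

Fact fps_mul1 : left_id fps_one fps_mul.
Proof.
move=> f; apply/funext => n; rewrite /fps_mul big_ord_recl /= mul1r subn0.
by rewrite big1 ?addr0 // => i _; rewrite mul0r.
Qed.

Fact fps_mulD : left_distributive fps_mul fps_add.
Proof.
move=> f g h; apply/funext => n; rewrite /fps_mul /fps_add -big_split /=.
by apply: eq_bigr => i _; rewrite mulrDl.
Qed.

Fact fps_one_neq0 : fps_one != 0.
Proof. by apply/eqP => /(congr1 (@^~ 0%N)) /eqP; rewrite /fps_one oner_eq0. Qed.

HB.instance Definition _ := GRing.Zmodule_isComNzRing.Build (fps A)
  fps_mulA fps_mulC fps_mul1 fps_mulD fps_one_neq0.

Lemma fpsB f g n : (f - g) n = f n - g n. Proof. by []. Qed.
Lemma fps1 n : (1 : fps A) n = (n == 0)%:R. Proof. by []. Qed.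
Lemma fpsM f g n : (f * g) n = \sum_(i < n.+1) f i * g (n - i)%N. Proof. by []. Qed.
Lemma fps_sum (I : Type) (s : seq I) (P : pred I) (F : I -> fps A) n :
  (\sum_(i <- s | P i) F i) n = \sum_(i <- s | P i) F i n.
Proof. by elim/big_rec2: _ => //= i y1 y2 _ <-. Qed.

Definition fpsX : fps A := fun n => (n == 1)%:R.
Definition fpsC (a : A) : fps A := fun n => if n is 0 then a else 0.

Lemma fpsXM f n : (fpsX * f) n = if n is n'.+1 then f n' else 0.
Proof.
rewrite fpsM; case: n => [|n]; first by rewrite big_ord1 mul0r.
rewrite big_ord_recl mul0r add0r big_ord_recl mul1r big1 => [|i _].
  by rewrite addr0 /bump /= subSS subn0.
by rewrite mul0r.
Qed.

Lemma fpsXnM k f n : (fpsX ^+ k * f) n = if (k <= n)%N then f (n - k)%N else 0.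
Proof.
elim: k f n => [|k IH] f n; first by rewrite mul1r subn0.
rewrite exprS -mulrA fpsXM; case: n => [|n] //; exact: IH.
Qed.

Lemma fpsCM a f n : (fpsC a * f) n = a * f n.
Proof.
rewrite fpsM big_ord_recl subn0 big1 ?addr0 // => i _; exact: mul0r.
Qed.

Fact fpsC_is_additive : zmod_morphism fpsC.
Proof. by move=> a b; apply/funext => -[|n]; rewrite fpsB //= subrr. Qed.
HB.instance Definition _ := GRing.isZmodMorphism.Build A (fps A) fpsC fpsC_is_additive.
Fact fpsC_is_multiplicative : monoid_morphism fpsC.
Proof.
split; first by apply/funext => -[|n].
by move=> a b; apply/funext => -[|n]; rewrite fpsCM //= mulr0.
Qed.
HB.instance Definition _ :=
  GRing.isMonoidMorphism.Build A (fps A) fpsC fpsC_is_multiplicative.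

Lemma fps_exp_coef0 g k n : g 0%N = 0 -> (n < k)%N -> (g ^+ k) n = 0.
Proof.
move=> g0; elim: k n => // k IH n; rewrite ltnS exprS fpsM => nk.
rewrite big1 // => -[[|i] i_lt] _ /=; first by rewrite g0 mul0r.
by rewrite IH ?mulr0 //; lia.
Qed.

(* With y a = 1 - g and g(0) = 0, the inverse of a is y (1 + g + g^2 + ...), where only finitely
   many powers contribute to each coefficient. *)
Lemma fps_inv_exists (a : fps A) (y : A) : a 0%N * y = 1 -> exists b, a * b = 1.
Proof.
move=> ay; pose g := 1 - fpsC y * a; pose s N := \sum_(k < N) g ^+ k.
have g0 : g 0%N = 0 by rewrite /g fpsB fpsCM mulrC ay subrr.
have s_stable i n : (i <= n)%N -> s n.+1 i = s i.+1 i.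
  move=> le_in; rewrite /s !fps_sum [RHS](big_ord_widen n.+1 (fun k => (g ^+ k) i)) //.
  rewrite [RHS]big_mkcond.
  by apply: eq_bigr => k _; case: ltnP => // /(fps_exp_coef0 g0).
exists (fpsC y * (fun n => s n.+1 n)); rewrite mulrCA mulrA.
have -> : fpsC y * a = 1 - g by rewrite subKr.
apply/funext => n; have -> : ((1 - g) * (fun k => s k.+1 k)) n = ((1 - g) * s n.+1) n.
  by rewrite !fpsM; apply: eq_bigr => i _; rewrite [s n.+1 _]s_stable ?leq_subr.
by rewrite -opprB mulNr -subrX1 opprB fpsB fps_exp_coef0 ?subr0.
Qed.

End FpsRing.

(** * Complex numbers and limits *)

Section ComplexNumbers.
Variable R : realType.
Local Notation C := (R[i]).
Implicit Types (z w : C) (x : R).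

Lemma complex_ext z w : Re z = Re w -> Im z = Im w -> z = w.
Proof. by case: z w => [a b] [c d] /= -> ->. Qed.

Lemma Re_mul z w : Re (z * w) = Re z * Re w - Im z * Im w.
Proof. by case: z w => [a b] [c d]. Qed.
Lemma Im_mul z w : Im (z * w) = Re z * Im w + Im z * Re w.
Proof. by case: z w => [a b] [c d]. Qed.
Lemma Re_conj z : Re z^* = Re z. Proof. by case: z. Qed.
Lemma Im_conj z : Im z^* = - Im z. Proof. by case: z. Qed.
Lemma conj_real_complex x : (x%:C)^* = x%:C. Proof. exact: conjc_real. Qed.

Lemma normc_ge0 z : 0 <= normc z.
Proof. by have := normr_ge0 z; rewrite lecE => /andP[]. Qed.
Lemma normcX z n : normc (z ^+ n) = normc z ^+ n.
Proof. by elim: n => [|n IH]; rewrite ?Normc.normc1 // !exprS Normc.normcM IH. Qed.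
Lemma normc_conj z : normc z^* = normc z.
Proof. by case: z => a b; rewrite /= sqrrN. Qed.
Lemma normc_eq0 z : (normc z == 0) = (z == 0).
Proof. by apply/eqP/eqP => [/Normc.eq0_normc|->]; rewrite ?Normc.normc0. Qed.
Lemma normc_gt0 z : (0 < normc z) = (z != 0).
Proof. by rewrite lt_neqAle normc_ge0 andbT eq_sym normc_eq0. Qed.
Lemma normc_real x : 0 <= x -> normc x%:C = x.
Proof. by move=> x0; rewrite /= expr0n addr0 sqrtr_sqr ger0_norm. Qed.
Lemma normc_prod (I : Type) (s : seq I) (P : pred I) (F : I -> C) :
  normc (\prod_(i <- s | P i) F i) = \prod_(i <- s | P i) normc (F i).
Proof.
by elim/big_rec2: _ => [|i y1 y2 _ <-]; rewrite ?Normc.normc1 ?Normc.normcM.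
Qed.
Lemma normcB_ge z w : normc z - normc w <= normc (z - w).
Proof. by rewrite lerBlDr -{1}(subrK w z) le_normcD. Qed.

Lemma sqmodE z : sqmod z = normc z ^+ 2.
Proof. by case: z => a b; rewrite /= sqr_sqrtr // addr_ge0 // sqr_ge0. Qed.
Lemma sqmod_ge0 z : 0 <= sqmod z. Proof. by rewrite sqmodE sqr_ge0. Qed.
Lemma sqmod0 : sqmod (0 : C) = 0. Proof. by rewrite sqmodE Normc.normc0 expr0n. Qed.
Lemma sqmodN z : sqmod (- z) = sqmod z. Proof. by rewrite !sqmodE normcN. Qed.
Lemma sqmodM z w : sqmod (z * w) = sqmod z * sqmod w.
Proof. by rewrite !sqmodE Normc.normcM exprMn. Qed.
Lemma sqmod_eq0 z : (sqmod z == 0) = (z == 0).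
Proof. by rewrite sqmodE sqrf_eq0 normc_eq0. Qed.
Lemma mulr_conj z : z * z^* = (sqmod z)%:C.
Proof. by rewrite -normCK -add_Re2_Im2. Qed.

Lemma sqmodD_le z w (t : R) : 0 < t ->
  sqmod (z + w) <= (1 + t) * sqmod z + (1 + t^-1) * sqmod w.
Proof.
move=> t0; case: z w => [a b] [c d]; rewrite /sqmod /= -subr_ge0.
have -> : (1 + t) * (a ^+ 2 + b ^+ 2) + (1 + t^-1) * (c ^+ 2 + d ^+ 2) -
    ((a + c) ^+ 2 + (b + d) ^+ 2) = ((t * a - c) ^+ 2 + (t * b - d) ^+ 2) / t.
  by field; rewrite gt_eqF.
by rewrite divr_ge0 ?addr_ge0 ?sqr_ge0 // ltW.
Qed.

Lemma sqmod_small z (K : R) : (forall e : R, 0 < e -> sqmod z <= K * e) -> z = 0.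
Proof.
move=> small; apply/eqP; rewrite -sqmod_eq0 eq_le sqmod_ge0 andbT.
apply/ler_addgt0Pr => y y0; rewrite add0r; have K0 : 0 < `|K| + 1 by rewrite ltr_wpDl.
apply: le_trans (small _ (divr_gt0 y0 K0)) _.
by rewrite mulrCA ler_piMr ?(ltW y0) // ler_pdivrMr // mul1r ler_wpDr // ler_norm.
Qed.

Lemma inDE z : inD z = (normc z < 1).
Proof. by rewrite /inD ltcE eqxx. Qed.
Lemma inD0 : inD (0 : C). Proof. by rewrite inDE Normc.normc0. Qed.
Lemma onTE z : onT z = (normc z == 1).
Proof. by rewrite /onT eq_complex /= eqxx andbT. Qed.
Lemma onT_mulr_conj z : onT z -> z * z^* = 1.
Proof. by rewrite onTE mulr_conj sqmodE => /eqP ->; rewrite expr1n. Qed.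
Lemma onT_expB z i k : onT z -> (i <= k)%N -> z ^+ (k - i) = z ^+ k * z^* ^+ i.
Proof.
move=> zT le_ik; rewrite -{2}(subnK le_ik) exprD -mulrA -exprMn onT_mulr_conj //.
by rewrite expr1n mulr1.
Qed.
Lemma onT_neq0 z : onT z -> z != 0.
Proof. by rewrite onTE -normc_gt0 => /eqP ->. Qed.

End ComplexNumbers.

Section ComplexConvergence.
Variable R : realType.
Local Notation C := (R[i]).

Definition ccvg (T : Type) (F : set_system T) (u : T -> C) (l : C) :=
  Re (u t) @[t --> F] --> Re l /\ Im (u t) @[t --> F] --> Im l.

Context {T : Type} {F : set_system T} {FF : ProperFilter F}.
Implicit Types u v : T -> C.

Lemma ccvg_cst l : ccvg F (fun=> l) l.
Proof. by split; exact: cvg_cst. Qed.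

Lemma ccvgD u v a b : ccvg F u a -> ccvg F v b -> ccvg F (fun t => u t + v t) (a + b).
Proof.
move=> [ur ui] [vr vi]; split.
  under eq_cvg do rewrite raddfD; rewrite raddfD; exact: cvgD.
under eq_cvg do rewrite raddfD; rewrite raddfD; exact: cvgD.
Qed.

Lemma ccvgN u a : ccvg F u a -> ccvg F (fun t => - u t) (- a).
Proof.
move=> [ur ui]; split.
  under eq_cvg do rewrite raddfN; rewrite raddfN; exact: cvgN.
under eq_cvg do rewrite raddfN; rewrite raddfN; exact: cvgN.
Qed.

Lemma ccvgB u v a b : ccvg F u a -> ccvg F v b -> ccvg F (fun t => u t - v t) (a - b).
Proof. by move=> ua vb; apply: ccvgD => //; exact: ccvgN. Qed.

Lemma ccvgM u v a b : ccvg F u a -> ccvg F v b -> ccvg F (fun t => u t * v t) (a * b).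
Proof.
move=> [ur ui] [vr vi]; split.
  under eq_cvg do rewrite Re_mul; rewrite Re_mul; apply: cvgB; exact: cvgM.
under eq_cvg do rewrite Im_mul; rewrite Im_mul; apply: cvgD; exact: cvgM.
Qed.

Lemma ccvg_conj u a : ccvg F u a -> ccvg F (fun t => (u t)^*) a^*.
Proof.
move=> [ur ui]; split; first by under eq_cvg do rewrite Re_conj; rewrite Re_conj.
under eq_cvg do rewrite Im_conj; rewrite Im_conj; exact: cvgN.
Qed.

Lemma ccvg_real (x : T -> R) (l : R) : x t @[t --> F] --> l ->
  ccvg F (fun t => (x t)%:C) l%:C.
Proof. by move=> xl; split => //=; exact: cvg_cst. Qed.

Lemma ccvg_sum (I : Type) (s : seq I) (P : pred I) (u : I -> T -> C) (a : I -> C) :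
  (forall i, P i -> ccvg F (u i) (a i)) ->
  ccvg F (fun t => \sum_(i <- s | P i) u i t) (\sum_(i <- s | P i) a i).
Proof.
move=> ua; elim: s => [|i s IH].
  by under eq_fun do rewrite big_nil; rewrite big_nil; exact: ccvg_cst.
under eq_fun do rewrite big_cons; rewrite big_cons; case: ifP => Pi //.
by apply: ccvgD IH; exact: ua.
Qed.

Lemma ccvgX u a n : ccvg F u a -> ccvg F (fun t => u t ^+ n) (a ^+ n).
Proof.
move=> ua; elim: n => [|n IH]; first exact: ccvg_cst.
by under eq_fun do rewrite exprS; rewrite exprS; exact: ccvgM.
Qed.

Lemma ccvg_unique u a b : ccvg F u a -> ccvg F u b -> a = b.
Proof.
by move=> [ar ai] [br bi]; apply: complex_ext; [exact: cvg_unique ar br|exact: cvg_unique ai bi].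
Qed.

Lemma ccvg_near u v a : (\forall t \near F, u t = v t) -> ccvg F u a -> ccvg F v a.
Proof.
move=> uv [ur ui]; split.
  by apply: cvg_trans ur; apply: near_eq_cvg; near=> t; congr Re; near: t.
by apply: cvg_trans ui; apply: near_eq_cvg; near=> t; congr Im; near: t.
Unshelve. all: by end_near. Qed.

Lemma cvg_sqmod u a : ccvg F u a -> sqmod (u t) @[t --> F] --> sqmod a.
Proof.
by move=> [ur ui]; apply: cvgD; under eq_cvg do rewrite expr2; rewrite expr2; exact: cvgM.
Qed.

Lemma ccvgV u a : a != 0 -> ccvg F u a -> ccvg F (fun t => (u t)^-1) a^-1.
Proof.
move=> a0 ua; have invE (z : C) : z^-1 = z^* * (sqmod z)^-1%:C.
  have [->|z0] := eqVneq z 0; first by rewrite invr0 conjC0 mul0r.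
  apply: (mulfI z0); rewrite divff // mulrA mulr_conj -rmorphM divff //.
  by rewrite sqmod_eq0.
under eq_fun do rewrite invE; rewrite invE.
apply: ccvgM; first exact: ccvg_conj.
by apply: ccvg_real; apply: cvgV; [rewrite sqmod_eq0|exact: cvg_sqmod].
Qed.

End ComplexConvergence.

Section RadialLimits.
Variable R : realType.

Lemma near_radial : \forall r \near (1 : R)^'-, 0 < r < 1.
Proof.
by near=> r; apply/andP; split; near: r; [exact: nbhs_left_gt|exact: nbhs_left_lt].
Unshelve. all: by end_near. Qed.

Lemma ccvg_radial : ccvg ((1 : R)^'- : set_system R) (fun r => r%:C) 1.
Proof. by apply: (ccvg_real (x := id)); apply: cvg_within. Qed.

Lemma inD_radial (r : R) (tau : R[i]) : onT tau -> 0 < r < 1 -> inD (r%:C * tau).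
Proof.
by rewrite onTE inDE Normc.normcM => /eqP -> /andP[r0 r1]; rewrite normc_real ?mulr1 // ltW.
Qed.

End RadialLimits.

(** * The Hardy space of the bidisk *)

Section DoubleSeries.
Variable A : comNzRingType.
Local Notation fps2 := (fps (fps A)).
Implicit Types f g : fps2.

Definition fps2C (a : A) : fps2 := fpsC (fpsC a).
Definition X1 : fps2 := fpsX (fps A).
Definition X2 : fps2 := fpsC (fpsX A).
Definition monom (k l : nat) : fps2 := X1 ^+ k * X2 ^+ l.
Definition swap f : fps2 := fun i j => f j i.
Definition bshift1 f : fps2 := fun i j => f i.+1 j.
Definition bshift2 f : fps2 := fun i j => f i j.+1.

Lemma fps2_ext f g : (forall i j, f i j = g i j) -> f = g.
Proof. by move=> eq_fg; apply/funext => i; apply/funext => j. Qed.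
Lemma fps2D f g i j : (f + g) i j = f i j + g i j. Proof. by []. Qed.
Lemma fps2N f i j : (- f) i j = - f i j. Proof. by []. Qed.
Lemma fps2B f g i j : (f - g) i j = f i j - g i j. Proof. by []. Qed.
Lemma fps20 i j : (0 : fps2) i j = 0. Proof. by []. Qed.
Lemma fps21 i j : (1 : fps2) i j = ((i == 0) && (j == 0))%:R.
Proof. by rewrite fps1; case: i. Qed.
Lemma fps2M f g i j : (f * g) i j =
  \sum_(a < i.+1) \sum_(b < j.+1) f a b * g (i - a)%N (j - b)%N.
Proof. by rewrite fpsM fps_sum; apply: eq_bigr => a _; rewrite fpsM. Qed.
Lemma fps2_sum (I : Type) (s : seq I) (P : pred I) (F : I -> fps2) i j :
  (\sum_(k <- s | P k) F k) i j = \sum_(k <- s | P k) F k i j.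
Proof. by rewrite !fps_sum. Qed.

Lemma fps2CM a f i j : (fps2C a * f) i j = a * f i j.
Proof. by rewrite !fpsCM. Qed.
Lemma X1M f i j : (X1 * f) i j = if i is i'.+1 then f i' j else 0.
Proof. by rewrite fpsXM; case: i. Qed.
Lemma X2M f i j : (X2 * f) i j = if j is j'.+1 then f i j' else 0.
Proof. by rewrite fpsCM fpsXM. Qed.
Lemma fps2CN a : fps2C (- a) = - fps2C a. Proof. by rewrite /fps2C !rmorphN. Qed.
Lemma fps2C1 : fps2C 1 = 1. Proof. by rewrite /fps2C !rmorph1. Qed.

Lemma swapK f : swap (swap f) = f. Proof. by []. Qed.
Lemma swapX1M f : X1 * f = swap (X2 * swap f).
Proof. by apply: fps2_ext => i j; rewrite X1M /swap X2M. Qed.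

Lemma monom0M f : monom 0 0 * f = f. Proof. by rewrite /monom !mul1r. Qed.
Lemma monomS1M k l f : monom k.+1 l * f = X1 * (monom k l * f).
Proof. by rewrite /monom exprS !mulrA. Qed.
Lemma monomS2M k l f : monom k l.+1 * f = X2 * (monom k l * f).
Proof. by rewrite /monom exprS !mulrA [X2 * X1 ^+ k]mulrC. Qed.
Lemma monomD i j k l : monom (i + k) (j + l) = monom i j * monom k l.
Proof. by rewrite /monom !exprD mulrACA. Qed.

Lemma monomM a b f i j : (monom a b * f) i j =
  if (a <= i)%N && (b <= j)%N then f (i - a)%N (j - b)%N else 0.
Proof.
rewrite /monom -mulrA fpsXnM; case: leqP => //= _.
by rewrite /X2 -rmorphXn fpsCM fpsXnM.
Qed.

Lemma monomE a b i j : monom a b i j = ((i == a) && (j == b))%:R.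
Proof.
rewrite -[monom a b]mulr1 monomM fps21 !subn_eq0 [i == a]eqn_leq [j == b]eqn_leq.
by case: (leqP a i); case: (leqP b j); rewrite /= ?andbT ?andbF.
Qed.

End DoubleSeries.
Arguments X1 {A}.
Arguments X2 {A}.
Arguments monom {A}.

(* [fps (fps R[i])] is convertible to [coef2 R], the outer index being the exponent of z1.
   Restating the notions at this type makes [*] the Cauchy product, not the pointwise one. *)
Definition H2 (R : realType) (f : fps (fps R[i])) : Prop := H2_2 f.
HB.lock Definition ip (R : realType) (f g : fps (fps R[i])) : R[i] := ip2 f g.
HB.lock Definition ev (R : realType) (f : fps (fps R[i])) (w1 w2 : R[i]) : R[i] :=
  eval2 f w1 w2.
Definition sqnormN {R : realType} (N : nat) (f : fps (fps R[i])) : R :=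
  \sum_(i < N) \sum_(j < N) sqmod (f i j).
HB.lock Definition sqnorm (R : realType) (f : fps (fps R[i])) : R :=
  limn (fun N => sqnormN N f).

Section HardyBidisk.
Variable R : realType.
Local Notation C := (R[i]).
Local Notation fps2 := (fps (fps C)).
Implicit Types f g h : fps2.

Lemma ipE f g : ip f g = ip2 f g. Proof. by rewrite unlock. Qed.
Lemma evE f w1 w2 : ev f w1 w2 = eval2 f w1 w2. Proof. by rewrite unlock. Qed.
Lemma sqnormE f : sqnorm f = limn (fun N => sqnormN N f). Proof. by rewrite unlock. Qed.

Definition ipN (N : nat) f g : C := \sum_(i < N) \sum_(j < N) f i j * (g i j)^*.

Definition restr2_0 f : fps2 := fun i j => if j is 0 then f i 0 else 0.

Definition szego (w1 w2 : C) : fps2 := fun i j => (w1 ^+ i * w2 ^+ j)^*.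

Lemma ip_swap f g : ip (swap f) (swap g) = ip f g.
Proof. by rewrite !ipE; congr (clim _); apply/funext => N; rewrite exchange_big. Qed.

Lemma ev_ip f w1 w2 : ev f w1 w2 = ip f (szego w1 w2).
Proof.
rewrite evE ipE; congr (clim _); apply/funext => N; apply: eq_bigr => i _; apply: eq_bigr => j _.
by rewrite /szego conjCK mulrA.
Qed.

Lemma ev_swap f w1 w2 : ev (swap f) w1 w2 = ev f w2 w1.
Proof.
rewrite !evE; congr (clim _); apply/funext => N; rewrite exchange_big.
by apply: eq_bigr => i _; apply: eq_bigr => j _; rewrite /swap mulrAC.
Qed.

Lemma ev_restr2_0 f w1 w2 w : ev (restr2_0 f) w1 w2 = ev (restr2_0 f) w1 w.
Proof.
rewrite !evE; congr (clim _); apply/funext => N; apply: eq_bigr => i _.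
by apply: eq_bigr => -[[|j] ?] _ /=; rewrite ?mul0r.
Qed.

Lemma shift1E f : shift1 f = X1 * f.
Proof. by apply: fps2_ext => i j; rewrite X1M. Qed.
Lemma shift2E f : shift2 f = X2 * f.
Proof. by apply: fps2_ext => i j; rewrite X2M. Qed.

Lemma ipN_sqnormN N f : ipN N f f = (sqnormN N f)%:C.
Proof.
rewrite rmorph_sum; apply: eq_bigr => i _.
by rewrite rmorph_sum; apply: eq_bigr => j _; rewrite mulr_conj.
Qed.

Lemma sqnormN_ge0 N f : 0 <= sqnormN N f.
Proof. by do 2!(apply: sumr_ge0 => ? _); exact: sqmod_ge0. Qed.

Lemma sqnormN_mono f : nondecreasing_seq (sqnormN^~ f).
Proof.
apply/nondecreasing_seqP => N; rewrite /sqnormN big_ord_recr /= ler_wpDr //.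
  by apply: sumr_ge0 => j _; exact: sqmod_ge0.
by apply: ler_sum => i _; rewrite big_ord_recr /= lerDl sqmod_ge0.
Qed.

Lemma sqnormN_cvg f : H2 f -> sqnormN^~ f @ \oo --> sqnorm f.
Proof.
move=> [M le_M]; rewrite sqnormE; apply: nondecreasing_is_cvgn; first exact: sqnormN_mono.
by exists M => _ [N _ <-]; exact: le_M.
Qed.

Lemma sqnormN_le_sqnorm f N : H2 f -> sqnormN N f <= sqnorm f.
Proof.
move=> f_H2; rewrite sqnormE; apply: nondecreasing_cvgn_le; first exact: sqnormN_mono.
by apply/cvg_ex; exists (sqnorm f); exact: sqnormN_cvg.
Qed.

Lemma H2_sqnorm_le f M : (forall N, sqnormN N f <= M) -> H2 f /\ sqnorm f <= M.
Proof.
move=> le_M; have f_H2 : H2 f by exists M.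
split=> //; rewrite sqnormE; apply: limr_le; last by near=> N; exact: le_M.
by apply/cvg_ex; exists (sqnorm f); exact: sqnormN_cvg.
Unshelve. all: by end_near. Qed.

Lemma sqnorm_ge0 f : H2 f -> 0 <= sqnorm f.
Proof. by move=> f_H2; apply: le_trans (sqnormN_le_sqnorm 0 f_H2); exact: sqnormN_ge0. Qed.

Lemma sqmod_le_sqnorm f i j : H2 f -> sqmod (f i j) <= sqnorm f.
Proof.
move=> f_H2; apply: le_trans (sqnormN_le_sqnorm (maxn i j).+1 f_H2).
have lt_i : (i < (maxn i j).+1)%N by rewrite ltnS leq_maxl.
have lt_j : (j < (maxn i j).+1)%N by rewrite ltnS leq_maxr.
rewrite /sqnormN (bigD1 (Ordinal lt_i)) //= (bigD1 (Ordinal lt_j)) //= -addrA lerDl.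
apply: addr_ge0; first by apply: sumr_ge0 => ? _; exact: sqmod_ge0.
by do 2!(apply: sumr_ge0 => ? _); exact: sqmod_ge0.
Qed.

Lemma sqnorm_eq0 f : H2 f -> sqnorm f = 0 -> f = 0.
Proof.
move=> f_H2 f0; apply: fps2_ext => i j; apply/eqP.
by rewrite -sqmod_eq0 eq_le sqmod_ge0 andbT -f0 sqmod_le_sqnorm.
Qed.

Lemma H2_0 : H2 (0 : fps2).
Proof. by exists 0 => N; rewrite big1 // => i _; rewrite big1 // => j _; exact: sqmod0. Qed.

Lemma H2D f g : H2 f -> H2 g -> H2 (f + g).
Proof.
move=> f_H2 g_H2; exists ((1 + 1) * sqnorm f + (1 + 1^-1) * sqnorm g) => N.
apply: le_trans (_ : (1 + 1) * sqnormN N f + (1 + 1^-1) * sqnormN N g <= _).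
  rewrite /sqnormN !mulr_sumr -big_split; apply: ler_sum => i _ /=.
  by rewrite !mulr_sumr -big_split; apply: ler_sum => j _; exact: sqmodD_le.
by apply: lerD; rewrite ler_pM2l ?sqnormN_le_sqnorm ?invr1 ?addr_gt0.
Qed.

Lemma H2Z a f : H2 f -> H2 (fps2C a * f).
Proof.
move=> f_H2; exists (sqmod a * sqnorm f) => N.
apply: le_trans (_ : sqmod a * sqnormN N f <= _).
  rewrite /sqnormN mulr_sumr; apply: ler_sum => i _; rewrite mulr_sumr.
  by apply: ler_sum => j _; rewrite fps2CM sqmodM.
by rewrite ler_wpM2l ?sqmod_ge0 ?sqnormN_le_sqnorm.
Qed.

Lemma H2N f : H2 f -> H2 (- f).
Proof. by move=> f_H2; rewrite -mulN1r -fps2C1 -fps2CN; exact: H2Z. Qed.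

Lemma H2B f g : H2 f -> H2 g -> H2 (f - g).
Proof. by move=> f_H2 g_H2; apply: H2D => //; exact: H2N. Qed.

Lemma H2_sum (I : Type) (s : seq I) (P : pred I) (F : I -> fps2) :
  (forall i, P i -> H2 (F i)) -> H2 (\sum_(i <- s | P i) F i).
Proof. by move=> F_H2; elim/big_ind: _ => //; [exact: H2_0 | exact: H2D]. Qed.

Lemma sqnormN_swap N f : sqnormN N (swap f) = sqnormN N f.
Proof. exact: exchange_big. Qed.

Lemma H2_swap f : H2 f -> H2 (swap f).
Proof. by move=> [M le_M]; exists M => N; rewrite [leLHS]sqnormN_swap; exact: le_M. Qed.

Lemma sqnormN_X2M f N : sqnormN N f <= sqnormN N.+1 (X2 * f) <= sqnormN N.+1 f.
Proof.
have rowE i : \sum_(j < N.+1) sqmod ((X2 * f) i j) = \sum_(j < N) sqmod (f i j).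
  by rewrite big_ord_recl X2M sqmod0 add0r; apply: eq_bigr => j _; rewrite X2M.
rewrite /sqnormN; under [X in _ <= X <= _]eq_bigr do rewrite rowE.
apply/andP; split.
  by rewrite [leRHS]big_ord_recr /= lerDl sumr_ge0 // => j _; exact: sqmod_ge0.
by apply: ler_sum => i _; rewrite big_ord_recr /= lerDl sqmod_ge0.
Qed.

Lemma H2_sqnorm_X2M f : H2 f -> H2 (X2 * f) /\ sqnorm (X2 * f) = sqnorm f.
Proof.
move=> f_H2; have [|Xf_H2 le_f] := @H2_sqnorm_le (X2 * f) (sqnorm f).
  move=> -[|N]; first by rewrite /sqnormN big_ord0 sqnorm_ge0.
  by have /andP[_ /le_trans->] := sqnormN_X2M f N; rewrite ?sqnormN_le_sqnorm.
split=> //; apply/eqP; rewrite eq_le le_f /=.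
apply: (proj2 (H2_sqnorm_le _)) => N; have /andP[le_X _] := sqnormN_X2M f N.
by apply: le_trans le_X _; exact: sqnormN_le_sqnorm.
Qed.

Lemma H2_X2M f : H2 f -> H2 (X2 * f). Proof. by case/H2_sqnorm_X2M. Qed.
Lemma sqnorm_X2M f : H2 f -> sqnorm (X2 * f) = sqnorm f.
Proof. by case/H2_sqnorm_X2M. Qed.

Lemma H2_X1M f : H2 f -> H2 (X1 * f).
Proof. by move=> f_H2; rewrite swapX1M; apply/H2_swap/H2_X2M/H2_swap. Qed.

Lemma H2_bshift2 f : H2 f -> H2 (bshift2 f).
Proof.
move=> [M le_M]; exists M => N; apply: le_trans (le_M N.+1).
rewrite [leRHS]big_ord_recr /=; apply: ler_wpDr.
  by apply: sumr_ge0 => j _; exact: sqmod_ge0.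
by apply: ler_sum => i _; rewrite [leRHS]big_ord_recl lerDr sqmod_ge0.
Qed.

Lemma H2_bshift1 f : H2 f -> H2 (bshift1 f).
Proof. by move=> /H2_swap/H2_bshift2/H2_swap. Qed.

Lemma H2_monomM k l f : H2 f -> H2 (monom k l * f).
Proof.
move=> f_H2; elim: k => [|k IH]; last by rewrite monomS1M; exact: H2_X1M.
elim: l => [|l IH]; first by rewrite monom0M.
by rewrite monomS2M; exact: H2_X2M.
Qed.

Lemma H2_one : H2 (1 : fps2).
Proof.
exists 1 => -[|N]; first by rewrite big_ord0.
rewrite big_ord_recl big_ord_recl fps21 sqmodE Normc.normc1 expr1n.
rewrite big1 => [|j _]; last by rewrite fps21 sqmod0.
rewrite big1 ?addr0 // => i _; rewrite big1 // => j _.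
by rewrite fps21 sqmod0.
Qed.

Lemma H2_monom k l : H2 (monom k l : fps2).
Proof. by rewrite -[monom k l]mulr1; apply: H2_monomM; exact: H2_one. Qed.

Lemma ipN_polarization N f g : ipN N f g =
  Complex ((sqnormN N (f + g) - sqnormN N (f - g)) / 4)
    ((sqnormN N (f + fps2C 'i * g) - sqnormN N (f - fps2C 'i * g)) / 4).
Proof.
have [Re_i Im_i] : Re ('i : C) = 0 /\ Im ('i : C) = 1 by rewrite -complexiE.
apply: complex_ext => /=; rewrite /sqnormN /ipN [LHS]raddf_sum -sumrB mulr_suml;
  apply: eq_bigr => i _; rewrite [LHS]raddf_sum -sumrB mulr_suml;
  apply: eq_bigr => j _; rewrite ?fps2D ?fps2N ?fps2CM;
  case: (f i j) (g i j) => [a b] [c d];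
  by rewrite /sqmod !(Re_mul, Im_mul, raddfD, raddfN, Re_conj, Im_conj, Re_i, Im_i) /=; field.
Qed.

Lemma ip_polarization f g : H2 f -> H2 g -> ip f g =
    Complex ((sqnorm (f + g) - sqnorm (f - g)) / 4)
      ((sqnorm (f + fps2C 'i * g) - sqnorm (f - fps2C 'i * g)) / 4) /\
  ccvg \oo (fun N => ipN N f g) (ip f g).
Proof.
move=> f_H2 g_H2; set l := Complex _ _.
have l_lim : ccvg \oo (fun N => ipN N f g) l.
  have ig_H2 := H2Z 'i g_H2.
  split; under eq_cvg do rewrite ipN_polarization /=; apply: cvgMl; apply: cvgB;
    apply: sqnormN_cvg; by [exact: H2D|exact: H2B].
suff -> : ip f g = l by [].
by case: l_lim => Re_lim Im_lim; rewrite ipE; apply: complex_ext; exact/cvg_lim.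
Qed.

Lemma ipN_cvg f g : H2 f -> H2 g -> ccvg \oo (fun N => ipN N f g) (ip f g).
Proof. by move=> f_H2 /(ip_polarization f_H2)[]. Qed.

Lemma ip_lim f g l : H2 f -> H2 g -> ccvg \oo (fun N => ipN N f g) l -> ip f g = l.
Proof. by move=> f_H2 g_H2; apply: ccvg_unique; exact: ipN_cvg. Qed.

Lemma ipC f g : H2 f -> H2 g -> ip g f = (ip f g)^*.
Proof.
move=> f_H2 g_H2; apply: ip_lim => //.
have -> : (fun N => ipN N g f) = fun N => (ipN N f g)^*.
  apply/funext => N; rewrite rmorph_sum; apply: eq_bigr => i _.
  by rewrite rmorph_sum; apply: eq_bigr => j _; rewrite rmorphM /= conjCK mulrC.
by apply: ccvg_conj; exact: ipN_cvg.
Qed.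

Lemma ipDl f g h : H2 f -> H2 g -> H2 h -> ip (f + g) h = ip f h + ip g h.
Proof.
move=> f_H2 g_H2 h_H2; apply: ip_lim => //; first exact: H2D.
have -> : (fun N => ipN N (f + g) h) = fun N => ipN N f h + ipN N g h.
  apply/funext => N; rewrite /ipN -big_split; apply: eq_bigr => i _ /=.
  by rewrite -big_split; apply: eq_bigr => j _ /=; rewrite mulrDl.
by apply: ccvgD; exact: ipN_cvg.
Qed.

Lemma ipZl a f h : H2 f -> H2 h -> ip (fps2C a * f) h = a * ip f h.
Proof.
move=> f_H2 h_H2; apply: ip_lim => //; first exact: H2Z.
have -> : (fun N => ipN N (fps2C a * f) h) = fun N => a * ipN N f h.
  apply/funext => N; rewrite /ipN mulr_sumr; apply: eq_bigr => i _ /=.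
  by rewrite mulr_sumr; apply: eq_bigr => j _ /=; rewrite fps2CM mulrA.
by apply: ccvgM; [exact: ccvg_cst|exact: ipN_cvg].
Qed.

Lemma ipNl f h : H2 f -> H2 h -> ip (- f) h = - ip f h.
Proof. by move=> f_H2 h_H2; rewrite -mulN1r -fps2C1 -fps2CN ipZl // mulN1r. Qed.

Lemma ipBl f g h : H2 f -> H2 g -> H2 h -> ip (f - g) h = ip f h - ip g h.
Proof. by move=> f_H2 g_H2 h_H2; rewrite ipDl ?ipNl //; exact: H2N. Qed.

Lemma ip0l h : H2 h -> ip (0 : fps2) h = 0.
Proof. by move=> h_H2; have := ipZl 0 H2_0 h_H2; rewrite mulr0 mul0r. Qed.

Lemma ip_suml (I : Type) (s : seq I) (P : pred I) (F : I -> fps2) h :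
  (forall i, P i -> H2 (F i)) -> H2 h ->
  ip (\sum_(i <- s | P i) F i) h = \sum_(i <- s | P i) ip (F i) h.
Proof.
move=> F_H2 h_H2; elim: s => [|i s IH]; first by rewrite !big_nil ip0l.
by rewrite !big_cons; case: ifP => Pi //; rewrite ipDl ?IH //; [exact: F_H2|exact: H2_sum].
Qed.

Lemma ipDr f g h : H2 f -> H2 g -> H2 h -> ip h (f + g) = ip h f + ip h g.
Proof. by move=> *; rewrite ipC ?ipDl ?rmorphD /= -?ipC //; exact: H2D. Qed.

Lemma ipZr a f h : H2 f -> H2 h -> ip h (fps2C a * f) = a^* * ip h f.
Proof. by move=> *; rewrite ipC ?ipZl ?rmorphM /= -?ipC //; exact: H2Z. Qed.

Lemma ipBr f g h : H2 f -> H2 g -> H2 h -> ip h (f - g) = ip h f - ip h g.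
Proof. by move=> *; rewrite ipC ?ipBl ?rmorphB /= -?ipC //; exact: H2B. Qed.

Lemma ip0r h : H2 h -> ip h (0 : fps2) = 0.
Proof. by move=> h_H2; rewrite ipC ?ip0l ?conjC0 //; exact: H2_0. Qed.

Lemma ip_sumr (I : Type) (s : seq I) (P : pred I) (F : I -> fps2) h :
  (forall i, P i -> H2 (F i)) -> H2 h ->
  ip h (\sum_(i <- s | P i) F i) = \sum_(i <- s | P i) ip h (F i).
Proof.
move=> F_H2 h_H2; rewrite ipC ?ip_suml ?rmorph_sum //=; last exact: H2_sum.
by apply: eq_bigr => i Pi; rewrite -ipC //; exact: F_H2.
Qed.

Lemma ip_sqnorm f : H2 f -> ip f f = (sqnorm f)%:C.
Proof.
move=> f_H2; apply: ip_lim => //; under eq_fun do rewrite ipN_sqnormN.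
by apply: ccvg_real; exact: sqnormN_cvg.
Qed.

Lemma sqnorm_ip f g : H2 f -> H2 g -> ip f f = ip g g -> sqnorm f = sqnorm g.
Proof. by move=> f_H2 g_H2; rewrite !ip_sqnorm // => /complexI. Qed.

Lemma ip_eq0 f : H2 f -> ip f f = 0 -> f = 0.
Proof. by move=> f_H2; rewrite ip_sqnorm // => -[] /sqnorm_eq0; exact. Qed.

Lemma ip_X2M f g : H2 f -> H2 g -> ip (X2 * f) (X2 * g) = ip f g.
Proof.
move=> f_H2 g_H2; have ig_H2 := H2Z 'i g_H2.
rewrite (proj1 (ip_polarization (H2_X2M f_H2) (H2_X2M g_H2))).
rewrite (proj1 (ip_polarization f_H2 g_H2)) (mulrCA (fps2C _)) -!mulrDr -!mulrBr.
by rewrite !sqnorm_X2M //; by [exact: H2B|exact: H2D].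
Qed.

Lemma ip_X1M f g : H2 f -> H2 g -> ip (X1 * f) (X1 * g) = ip f g.
Proof.
move=> f_H2 g_H2; rewrite (swapX1M f) (swapX1M g) ip_swap.
by rewrite ip_X2M; [exact: ip_swap|exact: H2_swap..].
Qed.

Lemma ip_monomM k l f g : H2 f -> H2 g -> ip (monom k l * f) (monom k l * g) = ip f g.
Proof.
move=> f_H2 g_H2; elim: k => [|k IH]; last by rewrite !monomS1M ip_X1M //; exact: H2_monomM.
elim: l => [|l IH]; first by rewrite !monom0M.
by rewrite !monomS2M ip_X2M //; exact: H2_monomM.
Qed.

Lemma cauchy_schwarz f g : H2 f -> H2 g -> sqmod (ip f g) <= sqnorm f * sqnorm g.
Proof.
move=> f_H2 g_H2; have [g0|g0] := eqVneq (sqnorm g) 0.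
  by rewrite g0 mulr0 (sqnorm_eq0 g_H2 g0) ip0r // sqmod0.
have g_gt0 : 0 < sqnorm g by rewrite lt_neqAle eq_sym g0 sqnorm_ge0.
pose t := (sqnorm g)^-1%:C * ip f g.
have tg_H2 := H2Z t g_H2; have d_H2 := H2B f_H2 tg_H2.
suff dE : sqnorm (f - fps2C t * g) = sqnorm f - sqmod (ip f g) / sqnorm g.
  by have := sqnorm_ge0 d_H2; rewrite dE subr_ge0 ler_pdivrMr.
apply: complexI; rewrite -ip_sqnorm // ipBl // !ipBr // !ipZl // !ipZr // (ipC f_H2 g_H2).
rewrite !ip_sqnorm // [RHS]rmorphB [X in _ = _ - X]rmorphM /= -mulr_conj /t.
rewrite rmorphM /= conj_real_complex.
have gV : (sqnorm g)^-1%:C * (sqnorm g)%:C = 1 :> C by rewrite -rmorphM mulVf.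
ring: gV.
Qed.

End HardyBidisk.

(** * Evaluation on the bidisk *)

Section Evaluation.
Variable R : realType.
Local Notation C := (R[i]).
Local Notation fps2 := (fps (fps C)).
Implicit Types (f g h : fps2) (a w : C).

Lemma fps2_split f : f = restr2_0 f + X2 * bshift2 f.
Proof. by apply: fps2_ext => i [|j]; rewrite fps2D X2M ?addr0 ?add0r. Qed.

Lemma H2_restr2_0 f : H2 f -> H2 (restr2_0 f).
Proof.
move=> f_H2; have -> : restr2_0 f = f - X2 * bshift2 f by rewrite {2}(fps2_split f) addrK.
by apply: H2B => //; apply/H2_X2M/H2_bshift2.
Qed.

Lemma ip_disjoint f g : H2 f -> H2 g -> (forall i j, f i j = 0 \/ g i j = 0) -> ip f g = 0.
Proof.
move=> f_H2 g_H2 disj; apply: ip_lim => //.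
rewrite (_ : (fun N => ipN N f g) = fun=> 0); first exact: ccvg_cst.
apply/funext => N; rewrite /ipN big1 // => i _; rewrite big1 // => j _.
by case: (disj i j) => ->; rewrite ?conjC0 ?mulr0 ?mul0r.
Qed.

Lemma ip_bshift2 f g : H2 f -> H2 g -> ip f (X2 * g) = ip (bshift2 f) g.
Proof.
move=> f_H2 g_H2; have f0_H2 := H2_restr2_0 f_H2; have Lf_H2 := H2_bshift2 f_H2.
have Xg_H2 := H2_X2M g_H2.
rewrite {1}(fps2_split f) ipDl ?ip_X2M //; last exact: H2_X2M.
rewrite [ip (restr2_0 f) _]ip_disjoint ?add0r // => i [|j]; last by left.
by right; rewrite X2M.
Qed.

Lemma ip_bshift1 f g : H2 f -> H2 g -> ip f (X1 * g) = ip (bshift1 f) g.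
Proof.
move=> f_H2 g_H2; rewrite swapX1M -(swapK f) ip_swap ip_bshift2; [|exact: H2_swap..].
by rewrite -[LHS]ip_swap.
Qed.

Lemma ip_monomr f k l : H2 f -> ip f (monom k l) = f k l.
Proof.
rewrite -[monom k l]mulr1; have one_H2 := H2_one R.
elim: k f => [|k IH] f f_H2; last first.
  by rewrite monomS1M ip_bshift1 ?IH //; [exact: H2_bshift1|exact: H2_monomM].
elim: l f f_H2 => [|l IH] f f_H2; last first.
  by rewrite monomS2M ip_bshift2 ?IH //; [exact: H2_bshift2|exact: H2_monomM].
rewrite monom0M; apply: ip_lim => //.
apply: ccvg_near (ccvg_cst _); exists 1%N => // -[|N] // _.
rewrite /ipN big_ord_recl big_ord_recl /= fps21 /= conjC1 mulr1.
rewrite [X in _ + X + _]big1 => [|i _]; last by rewrite fps21 conjC0 mulr0.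
rewrite [X in _ + X]big1 ?addr0 // => i _; rewrite big1 // => j _.
by rewrite fps21 conjC0 mulr0.
Qed.

Lemma ip_monoml f k l : H2 f -> ip (monom k l) f = (f k l)^*.
Proof. by move=> f_H2; rewrite ipC ?ip_monomr //; exact: H2_monom. Qed.

Lemma sqnorm_one : sqnorm (1 : fps2) = 1.
Proof.
have one_H2 := H2_one R; apply: complexI; rewrite -ip_sqnorm //.
by rewrite -{2}[1](monom0M 1) mulr1 ip_monomr.
Qed.

Lemma sum_geometric_le (x : R) N : 0 <= x < 1 -> \sum_(i < N) x ^+ i <= (1 - x)^-1.
Proof.
move=> /andP[x0 x1]; have x1' : 0 < 1 - x by rewrite subr_gt0.
rewrite -(ler_pM2l x1') divff ?gt_eqF //.
by rewrite -opprB mulNr -subrX1 opprB gerBl exprn_ge0.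
Qed.

Lemma H2_geometric f (A x y : R) : 0 <= x < 1 -> 0 <= y < 1 -> 0 <= A ->
  (forall i j, normc (f i j) <= A * (x ^+ i * y ^+ j)) ->
  H2 f /\ sqnorm f <= A ^+ 2 * ((1 - x ^+ 2)^-1 * (1 - y ^+ 2)^-1).
Proof.
move=> x01 y01 A0 le_f.
have sqr01 (t : R) : 0 <= t < 1 -> 0 <= t ^+ 2 < 1.
  by move=> /andP[t0 t1]; rewrite sqr_ge0 expr_lt1.
apply: H2_sqnorm_le => N.
apply: le_trans (_ : A ^+ 2 * ((\sum_(i < N) (x ^+ 2) ^+ i) * (\sum_(j < N) (y ^+ 2) ^+ j)) <= _).
  rewrite mulr_suml mulr_sumr; apply: ler_sum => i _; rewrite !mulr_sumr.
  apply: ler_sum => j _; rewrite sqmodE [_ ^+ 2 ^+ i]exprAC [_ ^+ 2 ^+ j]exprAC -!exprMn.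
  by rewrite ler_sqr ?nnegrE ?normc_ge0 // (le_trans (normc_ge0 _) (le_f _ _)).
apply: ler_wpM2l; first exact: sqr_ge0.
by apply: ler_pM; rewrite ?sum_geometric_le ?sqr01 //; apply: sumr_ge0 => i _;
  rewrite exprn_ge0 // sqr_ge0.
Qed.

Lemma H2_sqnorm_szego w1 w2 : inD w1 -> inD w2 -> H2 (szego w1 w2) /\
  sqnorm (szego w1 w2) <= (1 - normc w1 ^+ 2)^-1 * (1 - normc w2 ^+ 2)^-1.
Proof.
rewrite !inDE => w1D w2D; have := @H2_geometric (szego w1 w2) 1 (normc w1) (normc w2).
rewrite expr1n mul1r !normc_ge0 w1D w2D ler01; apply=> // i j.
by rewrite /szego normc_conj Normc.normcM !normcX mul1r.
Qed.

Lemma H2_szego w1 w2 : inD w1 -> inD w2 -> H2 (szego w1 w2).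
Proof. by move=> w1D /(H2_sqnorm_szego w1D)[]. Qed.

Section AtPoint.
Variables w1 w2 : C.
Hypotheses (w1D : inD w1) (w2D : inD w2).
Let szego_H2 : H2 (szego w1 w2). Proof. exact: H2_szego. Qed.

Lemma evD f g : H2 f -> H2 g -> ev (f + g) w1 w2 = ev f w1 w2 + ev g w1 w2.
Proof. by move=> *; rewrite !ev_ip ipDl. Qed.

Lemma evB f g : H2 f -> H2 g -> ev (f - g) w1 w2 = ev f w1 w2 - ev g w1 w2.
Proof. by move=> *; rewrite !ev_ip ipBl. Qed.

Lemma evZ (a : C) f : H2 f -> ev (fps2C a * f) w1 w2 = a * ev f w1 w2.
Proof. by move=> *; rewrite !ev_ip ipZl. Qed.

Lemma ev_sum (I : Type) (s : seq I) (P : pred I) (F : I -> fps2) :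
  (forall i, P i -> H2 (F i)) ->
  ev (\sum_(i <- s | P i) F i) w1 w2 = \sum_(i <- s | P i) ev (F i) w1 w2.
Proof. by move=> F_H2; rewrite ev_ip ip_suml //; apply: eq_bigr => i _; rewrite ev_ip. Qed.

Lemma ev_X2M f : H2 f -> ev (X2 * f) w1 w2 = w2 * ev f w1 w2.
Proof.
move=> f_H2; have Lszego : bshift2 (szego w1 w2) = fps2C w2^* * szego w1 w2.
  by apply: fps2_ext => i j; rewrite fps2CM /bshift2 /szego exprS mulrCA rmorphM.
rewrite !ev_ip ipC //; last exact: H2_X2M.
by rewrite ip_bshift2 // Lszego ipZl // rmorphM /= conjCK -ipC.
Qed.

Lemma ev_one : ev (1 : fps2) w1 w2 = 1.
Proof. by rewrite ev_ip -[1](monom0M 1) mulr1 ip_monoml // /szego !expr0 mulr1 conjCK. Qed.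

Lemma sqmod_ev_le f : H2 f ->
  sqmod (ev f w1 w2) <= sqnorm f * ((1 - normc w1 ^+ 2)^-1 * (1 - normc w2 ^+ 2)^-1).
Proof.
move=> f_H2; rewrite ev_ip; apply: le_trans (cauchy_schwarz f_H2 szego_H2) _.
by apply: ler_wpM2l; [exact: sqnorm_ge0|case: (H2_sqnorm_szego w1D w2D)].
Qed.

End AtPoint.

Lemma ev_X1M f w1 w2 : inD w1 -> inD w2 -> H2 f -> ev (X1 * f) w1 w2 = w1 * ev f w1 w2.
Proof.
by move=> w1D w2D f_H2; rewrite swapX1M ev_swap (ev_X2M w2D w1D (H2_swap f_H2)) ev_swap.
Qed.

Lemma ev_monomM k l f w1 w2 : inD w1 -> inD w2 -> H2 f ->
  ev (monom k l * f) w1 w2 = w1 ^+ k * w2 ^+ l * ev f w1 w2.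
Proof.
move=> w1D w2D f_H2; elim: k => [|k IH].
  elim: l => [|l IH]; first by rewrite monom0M !mul1r.
  by rewrite monomS2M ev_X2M ?IH ?exprS; [ring|..|exact: H2_monomM].
by rewrite monomS1M ev_X1M ?IH ?exprS; [ring|..|exact: H2_monomM].
Qed.

Lemma ev_split f w1 w2 : inD w1 -> inD w2 -> H2 f ->
  ev f w1 w2 = ev f w1 0 + w2 * ev (bshift2 f) w1 w2.
Proof.
move=> w1D w2D f_H2; have Lf_H2 := H2_bshift2 f_H2; have f0_H2 := H2_restr2_0 f_H2.
have XLf_H2 := H2_X2M Lf_H2; have zD := inD0 R.
rewrite {1 2}(fps2_split f) !evD // !ev_X2M // [0 * _]mul0r [_ + 0]addr0; congr (_ + _).
exact: ev_restr2_0.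
Qed.

(* Away from w2 = 0 divide by w2; at w2 = 0 use that bshift2 f is bounded near (w1, 0). *)
Lemma ev_bshift2_eq0 f : H2 f -> (forall w1 w2, inD w1 -> inD w2 -> ev f w1 w2 = 0) ->
  forall w1 w2, inD w1 -> inD w2 -> ev (bshift2 f) w1 w2 = 0.
Proof.
move=> f_H2 f0 w1 w2 w1D; have Lf_H2 := H2_bshift2 f_H2; have LLf_H2 := H2_bshift2 Lf_H2.
have off0 w : inD w -> w != 0 -> ev (bshift2 f) w1 w = 0.
  move=> wD w0; have /esym/eqP := ev_split w1D wD f_H2.
  by rewrite !f0 ?inD0 // add0r mulf_eq0 (negPf w0) => /eqP.
have [-> _|w20 w2D] := eqVneq w2 0; last exact: off0.
apply: (@sqmod_small _ _ (sqnorm (bshift2 (bshift2 f)) *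
  ((1 - normc w1 ^+ 2)^-1 * (1 - 2^-1 ^+ 2)^-1))) => e e0.
pose t := Num.min 2^-1 e; have t0 : 0 < t by rewrite lt_min invr_gt0 ltr0n.
have [t_half t_e] : t <= 2^-1 /\ t <= e by rewrite !ge_min !lexx orbT.
have norm_t := normc_real (ltW t0).
have tD : inD t%:C by rewrite inDE norm_t; lra.
have /esym/eqP := ev_split w1D tD Lf_H2.
rewrite (off0 _ tD) -?normc_gt0 ?norm_t // addr_eq0 => /eqP ->.
rewrite sqmodN sqmodM sqmodE norm_t mulrC; apply: ler_pM; rewrite ?sqmod_ge0 ?sqr_ge0 //.
  apply: le_trans (sqmod_ev_le w1D tD LLf_H2) _; apply: ler_wpM2l; first exact: sqnorm_ge0.
  have w1V : 0 <= (1 - normc w1 ^+ 2)^-1.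
    by rewrite invr_ge0 subr_ge0 expr_le1 ?normc_ge0 // ltW // -inDE.
  apply: ler_wpM2l => //; rewrite norm_t lef_pV2 ?posrE; nra.
by apply: le_trans t_e; rewrite expr2 ger_pMl //; lra.
Qed.

Lemma ev_bshift1_eq0 f : H2 f -> (forall w1 w2, inD w1 -> inD w2 -> ev f w1 w2 = 0) ->
  forall w1 w2, inD w1 -> inD w2 -> ev (bshift1 f) w1 w2 = 0.
Proof.
move=> f_H2 f0 w1 w2 w1D w2D; rewrite -[bshift1 f]swapK ev_swap.
by apply: (ev_bshift2_eq0 (H2_swap f_H2)) => // v1 v2 v1D v2D; rewrite ev_swap f0.
Qed.

Lemma ev_eq0 f : H2 f -> (forall w1 w2, inD w1 -> inD w2 -> ev f w1 w2 = 0) -> f = 0.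
Proof.
move=> f_H2 f0; apply: fps2_ext => i j; have zD := inD0 R.
elim: i f f_H2 f0 => [|i IH] f f_H2 f0; last first.
  exact: (IH (bshift1 f) (H2_bshift1 f_H2) (ev_bshift1_eq0 f_H2 f0)).
elim: j f f_H2 f0 => [|j IH] f f_H2 f0; last first.
  exact: (IH (bshift2 f) (H2_bshift2 f_H2) (ev_bshift2_eq0 f_H2 f0)).
transitivity (ev f 0 0); last exact: f0.
rewrite ev_ip -ip_monomr //; congr (ip f _).
apply: fps2_ext => i j; rewrite monomE /szego !expr0n -natrM mulnb.
exact/esym/conjC_nat.
Qed.

Lemma ev_inj f g : H2 f -> H2 g ->
  (forall w1 w2, inD w1 -> inD w2 -> ev f w1 w2 = ev g w1 w2) -> f = g.
Proof.
move=> f_H2 g_H2 ev_fg; apply: subr0_eq; apply: ev_eq0; first exact: H2B.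
by move=> w1 w2 w1D w2D; rewrite evB // ev_fg // subrr.
Qed.

Lemma ev_szego (w1 w2 z1 z2 : C) : inD w1 -> inD w2 -> inD z1 -> inD z2 ->
  (1 - z1 * w1^*) * (1 - z2 * w2^*) * ev (szego w1 w2) z1 z2 = 1.
Proof.
move=> w1D w2D z1D z2D; have k_H2 := H2_szego w1D w2D.
pose k1 : fps2 := szego w1 w2 - fps2C w1^* * (X1 * szego w1 w2).
have Xk_H2 := H2Z w1^* (H2_X1M k_H2); have k1_H2 : H2 k1 by exact: H2B.
have k1E i j : k1 i j = if i is 0 then (w2 ^+ j)^* else 0.
  rewrite /k1 fps2B fps2CM X1M /szego; case: i => [|i]; first by rewrite mulr0 subr0 mul1r.
  by rewrite -rmorphM /= mulrA -exprS subrr.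
have oneE : 1 = k1 - fps2C w2^* * (X2 * k1).
  apply: fps2_ext => i j; rewrite fps2B fps2CM X2M fps21 k1E.
  case: i j => [|i] [|j] /=; rewrite ?k1E ?mulr0 ?subr0 ?expr0 ?conjC1 //.
  by rewrite -rmorphM -exprS subrr.
rewrite -[RHS](ev_one z1D z2D) oneE evB ?evZ ?ev_X2M //; last exact/H2Z/H2_X2M.
  by rewrite evB ?evZ ?ev_X1M //; [ring|exact: H2_X1M].
exact: H2_X2M.
Qed.

End Evaluation.

(** * Polynomial multipliers and reflection *)

Section PolynomialSeries.
Variable A : comNzRingType.

Definition fps_poly (P : {poly A}) : fps A := fun i => P`_i.
Definition fps2_poly (p : {poly {poly A}}) : fps (fps A) := fun i j => p`_j`_i.

Fact fps_poly_is_additive : zmod_morphism fps_poly.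
Proof. by move=> P Q; apply/funext => i; rewrite fpsB /fps_poly coefB. Qed.
HB.instance Definition _ := GRing.isZmodMorphism.Build _ _ fps_poly fps_poly_is_additive.
Fact fps_poly_is_multiplicative : monoid_morphism fps_poly.
Proof.
split; first by apply/funext => i; rewrite /fps_poly coef1.
by move=> P Q; apply/funext => i; rewrite /fps_poly coefM.
Qed.
HB.instance Definition _ :=
  GRing.isMonoidMorphism.Build _ _ fps_poly fps_poly_is_multiplicative.

Fact fps2_poly_is_additive : zmod_morphism fps2_poly.
Proof. by move=> p q; apply: fps2_ext => i j; rewrite fps2B /fps2_poly !coefB. Qed.
HB.instance Definition _ := GRing.isZmodMorphism.Build _ _ fps2_poly fps2_poly_is_additive.
Fact fps2_poly_is_multiplicative : monoid_morphism fps2_poly.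
Proof.
split.
  apply: fps2_ext => i j; rewrite fps21 /fps2_poly coef1.
  by case: j => [|j] /=; rewrite ?coef1 ?coef0 ?andbT ?andbF.
move=> p q; apply: fps2_ext => i j; rewrite /fps2_poly coefM coef_sum fps2M exchange_big.
by apply: eq_bigr => b _; rewrite coefM.
Qed.
HB.instance Definition _ :=
  GRing.isMonoidMorphism.Build _ _ fps2_poly fps2_poly_is_multiplicative.

Lemma fps_polyC a : fps_poly a%:P = fpsC a.
Proof. by apply/funext => -[|i]; rewrite /fps_poly coefC. Qed.
Lemma fps_polyX : fps_poly 'X = fpsX A.
Proof. by apply/funext => i; rewrite /fps_poly coefX. Qed.

Lemma fps2_polyE (p : {poly {poly A}}) i j : fps2_poly p i j = p`_j`_i.
Proof. by []. Qed.
Lemma fps2_polyC a : fps2_poly a%:P%:P = fps2C a.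
Proof. by apply: fps2_ext => -[|i] [|j]; rewrite /fps2_poly coefC ?coefC ?coef0. Qed.
Lemma fps2_poly_monom k l : fps2_poly (('X^k)%:P * 'X^l) = monom k l.
Proof.
apply: fps2_ext => i j; rewrite monomE /fps2_poly coefMXn coefC.
case: (ltngtP j l) => [_|lt_lj|->]; rewrite ?andbF ?coef0 ?subnn ?andbT ?coefXn //.
by rewrite subn_eq0 leqNgt lt_lj coef0.
Qed.
Lemma fps2_polyXn k : fps2_poly 'X^k = monom 0 k.
Proof. by rewrite -fps2_poly_monom expr0 polyC1 mul1r. Qed.

End PolynomialSeries.

Local Notation "P %:S" := (fps_poly P) (at level 2, format "P %:S").
Local Notation "p %:S2" := (fps2_poly p) (at level 2, format "p %:S2").

Section BivariatePolynomials.
Variable R : realType.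
Local Notation C := (R[i]).
Implicit Types (p q : {poly {poly C}}) (f : nat -> nat -> C) (w : C).

Definition bipoly (m n : nat) f : {poly {poly C}} :=
  \poly_(j < n.+1) \poly_(i < m.+1) f i j.

Lemma pcoef_bipoly m n f i j :
  pcoef (bipoly m n f) i j = if (i <= m)%N && (j <= n)%N then f i j else 0.
Proof.
rewrite /pcoef coef_poly !ltnS andbC.
by case: (leqP j n) => _ /=; rewrite ?coef0 // coef_poly ltnS.
Qed.

Lemma bideg_bipoly m n f : bideg_le m n (bipoly m n f).
Proof.
split=> [|j]; first exact: size_poly.
by rewrite coef_poly; case: ifP => _; rewrite ?size_poly0 // size_poly.
Qed.

Lemma pcoef_ext p q : (forall i j, pcoef p i j = pcoef q i j) -> p = q.
Proof. by move=> eq_pq; apply/polyP => j; apply/polyP => i; exact: eq_pq. Qed.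

Lemma pcoef_bideg m n p i j : bideg_le m n p -> ((m < i) || (n < j))%N -> pcoef p i j = 0.
Proof.
move=> [szp szpj] /orP[lt_mi|lt_nj]; rewrite /pcoef.
  by rewrite nth_default // (leq_trans (szpj j)).
by rewrite (nth_default 0 (leq_trans szp lt_nj)) coef0.
Qed.

Lemma bipoly_pcoef m n p : bideg_le m n p -> bipoly m n (pcoef p) = p.
Proof.
move=> bd; apply: pcoef_ext => i j; rewrite pcoef_bipoly; case: ifPn => //.
by rewrite negb_and -!ltnNge => /(pcoef_bideg bd) ->.
Qed.

Lemma bideg_exists p : exists m n, bideg_le m n p.
Proof.
exists (\max_(j < size p) size (p`_j)%R), (size p); split => // j.
case: (ltnP j (size p)) => lt_j; last by rewrite nth_default // size_poly0.
by apply: leqW; rewrite (leq_bigmax (Ordinal lt_j)).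
Qed.

Lemma bideg_leM m n m' n' p q :
  bideg_le m n p -> bideg_le m' n' q -> bideg_le (m + m') (n + n') (p * q).
Proof.
move=> [szp szpj] [szq szqj]; split=> [|j].
  by apply: leq_trans (size_polyMleq _ _) _; lia.
rewrite coefM (leq_trans (size_sum _ _ _)) //; apply/bigmax_leqP => i _.
apply: leq_trans (size_polyMleq _ _) _.
by have := szpj i; have := szqj (j - i)%N; lia.
Qed.

Lemma peval_sum m n p w1 w2 : bideg_le m n p ->
  peval p w1 w2 = \sum_(t : 'I_m.+1 * 'I_n.+1) pcoef p t.1 t.2 * (w1 ^+ t.1 * w2 ^+ t.2).
Proof.
move=> [szp szpj]; rewrite /peval (horner_coef_wide _ szp) horner_sum.
rewrite -(pair_big xpredT xpredT (fun (i : 'I_m.+1) (j : 'I_n.+1) =>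
  pcoef p i j * (w1 ^+ i * w2 ^+ j))) exchange_big; apply: eq_bigr => j _.
rewrite -polyC_exp hornerM hornerC (horner_coef_wide _ (szpj j)) mulr_suml.
by apply: eq_bigr => i _; rewrite mulrA.
Qed.

Lemma pevalD p q w1 w2 : peval (p + q) w1 w2 = peval p w1 w2 + peval q w1 w2.
Proof. by rewrite /peval !hornerD. Qed.
Lemma pevalM p q w1 w2 : peval (p * q) w1 w2 = peval p w1 w2 * peval q w1 w2.
Proof. by rewrite /peval !hornerM. Qed.

Lemma pcoef_prefl m n p i j : (i <= m)%N -> (j <= n)%N ->
  pcoef (prefl m n p) i j = (pcoef p (m - i) (n - j))^*.
Proof. by move=> le_im le_jn; rewrite [LHS]pcoef_bipoly le_im le_jn. Qed.

Lemma bideg_prefl m n p : bideg_le m n (prefl m n p). Proof. exact: bideg_bipoly. Qed.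

Definition rev_pair m n (t : 'I_m.+1 * 'I_n.+1) := (rev_ord t.1, rev_ord t.2).
Lemma rev_pair_inj m n : injective (@rev_pair m n).
Proof. by apply: can_inj (@rev_pair m n) _ => -[i j]; rewrite /rev_pair !rev_ordK. Qed.

Lemma peval_prefl_onT m n p w1 w2 : bideg_le m n p -> onT w1 -> onT w2 ->
  peval (prefl m n p) w1 w2 = w1 ^+ m * w2 ^+ n * (peval p w1 w2)^*.
Proof.
move=> bd w1T w2T.
rewrite (peval_sum _ _ (bideg_prefl m n p)) (peval_sum _ _ bd) rmorph_sum mulr_sumr.
rewrite (reindex_inj (@rev_pair_inj m n)); apply: eq_bigr => -[i j] _ /=.
rewrite !subSS pcoef_prefl ?leq_subr // !subKn ?leq_ord // !onT_expB ?leq_ord //.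
by rewrite !rmorphM !rmorphXn /=; ring.
Qed.

End BivariatePolynomials.

Section PolynomialMultipliers.
Variable R : realType.
Local Notation C := (R[i]).
Local Notation fps2 := (fps (fps C)).
Implicit Types (f F G K : fps2) (p q : {poly {poly C}}) (w : C).

Lemma fps2_poly_sum m n p : bideg_le m n p ->
  p%:S2 = \sum_(t : 'I_m.+1 * 'I_n.+1) fps2C (pcoef p t.1 t.2) * monom t.1 t.2.
Proof.
move=> bd; apply: fps2_ext => i j; rewrite fps2_sum fps2_polyE -/(pcoef p i j).
under eq_bigr do rewrite fps2CM monomE.
have [/andP[le_im le_jn]|] := boolP ((i <= m) && (j <= n))%N; last first.
  rewrite negb_and -!ltnNge => out; rewrite (pcoef_bideg bd) // big1 // => -[k l] _ /=.
  case: eqP => [ik|]; case: eqP => [jl|]; rewrite ?mulr0 //.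
  by move: out; rewrite ik jl !ltnNge !leq_ord.
rewrite (bigD1 (Ordinal (le_im : (i < m.+1)%N), Ordinal (le_jn : (j < n.+1)%N))) //= !eqxx mulr1.
rewrite big1 ?addr0 // => -[k l]; rewrite xpair_eqE -!val_eqE /= ![_ == i]eq_sym ![_ == j]eq_sym.
by move=> /negPf ->; rewrite mulr0.
Qed.

Lemma fps2_prefl m n p i j : (prefl m n p)%:S2 i j =
  if (i <= m)%N && (j <= n)%N then (pcoef p (m - i) (n - j))^* else 0.
Proof. exact: pcoef_bipoly. Qed.

Lemma H2_polyM p f : H2 f -> H2 (p%:S2 * f).
Proof.
move=> f_H2; have [m [n bd]] := bideg_exists p; rewrite (fps2_poly_sum bd) mulr_suml.
by apply: H2_sum => t _; rewrite -mulrA; apply/H2Z/H2_monomM.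
Qed.

Lemma H2_poly p : H2 p%:S2.
Proof. by rewrite -[p%:S2]mulr1; apply: H2_polyM; exact: H2_one. Qed.

Lemma ev_polyM p f w1 w2 : inD w1 -> inD w2 -> H2 f ->
  ev (p%:S2 * f) w1 w2 = peval p w1 w2 * ev f w1 w2.
Proof.
move=> w1D w2D f_H2; have [m [n bd]] := bideg_exists p.
rewrite (fps2_poly_sum bd) (peval_sum _ _ bd) !mulr_suml ev_sum // => [|t _].
  by apply: eq_bigr => t _; rewrite -mulrA evZ ?ev_monomM ?mulrA //; exact: H2_monomM.
by rewrite -mulrA; apply/H2Z/H2_monomM.
Qed.

Lemma ev_poly p w1 w2 : inD w1 -> inD w2 -> ev p%:S2 w1 w2 = peval p w1 w2.
Proof.
move=> w1D w2D; rewrite -[p%:S2]mulr1 ev_polyM //; last exact: H2_one.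
by rewrite ev_one ?mulr1.
Qed.

Lemma ip_polyMl m n p F G : bideg_le m n p -> H2 F -> H2 G -> ip (p%:S2 * F) G =
  \sum_(t : 'I_m.+1 * 'I_n.+1) pcoef p t.1 t.2 * ip (monom t.1 t.2 * F) G.
Proof.
move=> bd F_H2 G_H2; rewrite (fps2_poly_sum bd) mulr_suml ip_suml // => [|t _].
  by apply: eq_bigr => t _; rewrite -mulrA ipZl //; exact: H2_monomM.
by rewrite -mulrA; apply/H2Z/H2_monomM.
Qed.

Lemma ip_polyl m n p G : bideg_le m n p -> H2 G ->
  ip p%:S2 G = \sum_(t : 'I_m.+1 * 'I_n.+1) pcoef p t.1 t.2 * (G t.1 t.2)^*.
Proof.
move=> bd G_H2; rewrite -[p%:S2]mulr1 (ip_polyMl bd (H2_one R) G_H2).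
by apply: eq_bigr => t _; rewrite mulr1 ip_monoml.
Qed.

(* On the torus the reflection of p is z1^m z2^n times the conjugate of p. *)
Lemma ip_preflMl m n p F K : bideg_le m n p -> H2 F -> H2 K ->
  ip ((prefl m n p)%:S2 * F) K = ip (monom m n * F) (p%:S2 * K).
Proof.
move=> bd F_H2 K_H2; have XF_H2 := H2_monomM m n F_H2.
rewrite (ip_polyMl (bideg_prefl m n p)) // (ipC (H2_polyM p K_H2) XF_H2) (ip_polyMl bd) //.
rewrite rmorph_sum (reindex_inj (@rev_pair_inj m n)); apply: eq_bigr => -[i j] _ /=.
rewrite rmorphM /= -ipC //; last exact: H2_monomM.
rewrite !subSS pcoef_prefl ?leq_subr // !subKn ?leq_ord //; congr (_ * _).
have -> : monom m n * F = monom i j * (monom (m - i) (n - j) * F).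
  by rewrite mulrA -monomD !subnKC ?leq_ord.
by rewrite ip_monomM //; exact: H2_monomM.
Qed.

Lemma ip_preflM m n p F K : bideg_le m n p -> H2 F -> H2 K ->
  ip ((prefl m n p)%:S2 * F) ((prefl m n p)%:S2 * K) = ip (p%:S2 * F) (p%:S2 * K).
Proof.
move=> bd F_H2 K_H2; have [pF_H2 pK_H2] := (H2_polyM p F_H2, H2_polyM p K_H2).
have rK_H2 := H2_polyM (prefl m n p) K_H2; have XF_H2 := H2_monomM m n F_H2.
rewrite ip_preflMl // mulrCA (ipC (H2_polyM _ pK_H2) XF_H2) ip_preflMl //.
by rewrite [p%:S2 * (_ * F)]mulrCA ip_monomM // -ipC.
Qed.

End PolynomialMultipliers.

Section Truncation.
Variable R : realType.
Local Notation C := (R[i]).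
Local Notation fps2 := (fps (fps C)).
Implicit Types (f g F G : fps2).

Definition trunc N f : {poly {poly C}} := bipoly N N f.

Lemma trunc_coef N f i j : (trunc N f)%:S2 i j = if (i <= N)%N && (j <= N)%N then f i j else 0.
Proof. exact: pcoef_bipoly. Qed.

Lemma fps2M_truncr N f g i j : (i <= N)%N -> (j <= N)%N ->
  (g * (trunc N f)%:S2) i j = (g * f) i j.
Proof.
move=> le_iN le_jN; rewrite !fps2M; apply: eq_bigr => k _; apply: eq_bigr => l _.
by rewrite trunc_coef !(leq_trans (leq_subr _ _)).
Qed.

Lemma ip_truncl N f g : H2 g ->
  ip (trunc N f)%:S2 g = \sum_(t : 'I_N.+1 * 'I_N.+1) f t.1 t.2 * (g t.1 t.2)^*.
Proof.
move=> g_H2; rewrite (ip_polyl (bideg_bipoly N N f) g_H2); apply: eq_bigr => t _.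
by rewrite pcoef_bipoly !leq_ord.
Qed.

Lemma ip_trunc_self N f : H2 f -> ip (trunc N f)%:S2 f = (sqnormN N.+1 f)%:C.
Proof.
move=> f_H2; rewrite ip_truncl // /sqnormN.
rewrite (pair_big xpredT xpredT (fun i j : 'I_N.+1 => sqmod (f i j))) rmorph_sum.
by apply: eq_bigr => t _; rewrite mulr_conj.
Qed.

Lemma sqnorm_trunc N f : H2 f -> sqnorm (trunc N f)%:S2 = sqnormN N.+1 f.
Proof.
move=> f_H2; have T_H2 := H2_poly (trunc N f); apply: complexI.
rewrite -ip_sqnorm // -ip_trunc_self // !ip_truncl //.
by apply: eq_bigr => t _; rewrite trunc_coef !leq_ord.
Qed.

Lemma sqnorm_sub_trunc N f : H2 f ->
  sqnorm (f - (trunc N f)%:S2) = sqnorm f - sqnormN N.+1 f.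
Proof.
move=> f_H2; have T_H2 := H2_poly (trunc N f); have d_H2 := H2B f_H2 T_H2.
apply: complexI; rewrite -ip_sqnorm // ipBl // !ipBr // (ipC T_H2 f_H2) ip_trunc_self //.
by rewrite conj_real_complex !ip_sqnorm // sqnorm_trunc // subrr subr0 [RHS]rmorphB.
Qed.

Lemma sqnorm_trunc_le N f : H2 f -> sqnorm (trunc N f)%:S2 <= sqnorm f.
Proof. by move=> f_H2; rewrite sqnorm_trunc ?sqnormN_le_sqnorm. Qed.

Lemma trunc_approx f (e : R) : H2 f -> 0 < e ->
  exists N, sqnorm (f - (trunc N f)%:S2) <= e.
Proof.
move=> f_H2 e0; have /cvgrPdist_le/(_ e e0)[N _ close] := sqnormN_cvg f_H2.
exists N; rewrite sqnorm_sub_trunc //; apply: le_trans (ler_norm _) _.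
by apply: close => /=; exact: leqnSn.
Qed.

Lemma monom_decay F G (e : R) : H2 F -> H2 G -> 0 < e ->
  exists k0, forall k, (k0 <= k)%N -> sqmod (ip (monom 0 k * F) G) <= sqnorm F * e.
Proof.
move=> F_H2 G_H2 e0; have [N close] := trunc_approx G_H2 e0; exists N.+1 => k lt_Nk.
have T_H2 := H2_poly (trunc N G); have X_H2 := H2_monomM 0 k F_H2.
have -> : ip (monom 0 k * F) G = ip (monom 0 k * F) (G - (trunc N G)%:S2).
  rewrite ipBr // [X in _ - X](_ : _ = 0) ?subr0 // ipC // ip_truncl // big1 ?conjC0 // => t _.
  by rewrite monomM /= [(k <= _)%N]leqNgt (leq_trans (ltn_ord t.2) lt_Nk) conjC0 mulr0.
apply: le_trans (cauchy_schwarz X_H2 (H2B G_H2 T_H2)) _.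
have -> : sqnorm (monom 0 k * F) = sqnorm F by apply: sqnorm_ip => //; exact: ip_monomM.
by apply: ler_wpM2l; [exact: sqnorm_ge0|exact: close].
Qed.

End Truncation.

(** * Bezout relations for coprime bivariate polynomials *)

Section Bezout.
Variable F : closedFieldType.
Local Notation A := {poly F}.
Implicit Types (p q g a : {poly A}) (k : A) (x : F).

Definition biprimitive g := forall x, map_poly (horner_eval x) g != 0.
Definition bicoprime p q :=
  forall d a b, p = d * a -> q = d * b -> exists c : F, d = c%:P%:P.

Lemma map_horner_eq0 g x : map_poly (horner_eval x) g = 0 ->
  exists g1, g = ('X - x%:P) *: g1.
Proof.
move=> g0; exists (map_poly (fun c => c %/ ('X - x%:P)) g); apply/polyP => i.
rewrite coefZ coef_map_id0 ?div0p // mulrC divpK // dvdp_XsubCl.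
have := congr1 (fun h : A => h`_i) g0.
by rewrite coef_map /= coef0 /horner_eval => /eqP.
Qed.

Lemma biprimitive_part g : g != 0 ->
  exists (h : A) (g0 : {poly A}), g = h *: g0 /\ biprimitive g0.
Proof.
have [N] := ubnP (size (lead_coef g)); elim: N g => // N IH g; rewrite ltnS => szg g0.
have [g_prim|] := pselect (biprimitive g); first by exists 1, g; rewrite scale1r.
move=> /existsNP[x /negP/negPn/eqP/map_horner_eq0[g1 gE]].
have g1_neq0 : g1 != 0 by apply: contraNneq g0 => g1E; rewrite gE g1E scaler0.
have szg1 : (size (lead_coef g1) < N)%N.
  apply: leq_trans szg; rewrite gE lead_coefZ size_mul ?polyXsubC_eq0 ?lead_coef_eq0 //.
  by rewrite size_XsubC.
have [h [g2 [g1E g2_prim]]] := IH g1 szg1 g1_neq0.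
by exists (('X - x%:P) * h), g2; rewrite gE g1E scalerA.
Qed.

(* Gauss' lemma, one linear factor of the scalar at a time. *)
Lemma biprimitive_dvd k p a g : biprimitive g -> k != 0 -> k *: p = a * g ->
  exists a', p = g * a'.
Proof.
move=> g_prim; have [N] := ubnP (size k); elim: N k a => // N IH k a; rewrite ltnS => szk k0 kpE.
have [/size_poly1P[c c0 kE]|sz1] := boolP (size k == 1)%N.
  exists (c^-1%:P *: a).
  by rewrite -scalerAr mulrC -kpE scalerA kE -polyCM mulVf // scale1r.
have [x /factor_theorem[k1 kE]] := closed_rootP _ sz1.
have k1_neq0 : k1 != 0 by apply: contraNneq k0 => k1E; rewrite kE k1E mul0r.
have : map_poly (horner_eval x) a * map_poly (horner_eval x) g = 0.
  rewrite -rmorphM /= -kpE; apply/polyP => i; rewrite coef_map coefZ coef0 /= /horner_eval.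
  by rewrite hornerM kE hornerM hornerXsubC subrr mulr0 mul0r.
move=> /eqP; rewrite mulf_eq0 (negPf (g_prim x)) orbF => /eqP/map_horner_eq0[a1 aE].
apply: (IH k1 a1) => //.
  by apply: leq_trans szk; rewrite kE size_mul ?polyXsubC_eq0 // size_XsubC addn2.
have Xx0 : 'X - x%:P != 0 :> A by rewrite polyXsubC_eq0.
have /eqP : ('X - x%:P) *: (k1 *: p - a1 * g) = 0.
  by rewrite scalerBr scalerA mulrC -kE kpE aE -scalerAl subrr.
by rewrite -mul_polyC mulf_eq0 polyC_eq0 (negPf Xx0) subr_eq0 => /eqP.
Qed.

Lemma resultant_neq0 p q : p != 0 -> bicoprime p q -> resultant p q != 0.
Proof.
move=> p0 pq; rewrite resultant_eq0 -leqNgt; set g := Pdiv.Idomain.gcdp p q.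
have g0 : g != 0 by rewrite Pdiv.Idomain.gcdp_eq0 negb_and p0.
have [h [g1 [gE g1_prim]]] := biprimitive_part g0.
have g1_dvd s : Pdiv.Idomain.dvdp g s -> exists a, s = g1 * a.
  move=> /Pdiv.Idomain.dvdpP[[k a] /= k0 ksE].
  by apply: (biprimitive_dvd (a := h *: a) g1_prim k0); rewrite ksE gE -scalerAl -scalerAr.
have [a pE] := g1_dvd p (Pdiv.Idomain.dvdp_gcdl p q).
have [b qE] := g1_dvd q (Pdiv.Idomain.dvdp_gcdr p q).
have [c g1E] := pq _ _ _ pE qE.
by apply: leq_trans (size_polyC_leq1 (h * c%:P)); rewrite gE g1E -mul_polyC -polyCM.
Qed.

Lemma bezout_bicoprime p q : p != 0 -> bicoprime p q ->
  exists (u v : {poly A}) (r : A), r != 0 /\ u * p + v * q = r%:P.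
Proof.
move=> p0 pq; have const (s : {poly A}) : s != 0 -> (size s <= 1)%N -> s`_0 != 0 /\ s = (s`_0)%:P.
  by move=> s0 /size1_polyC sE; split=> //; apply: contraNneq s0 => s00; rewrite sE s00.
have [szp|szp] := leqP (size p) 1.
  by have [r0 pE] := const p p0 szp; exists 1, 0, p`_0; rewrite mul1r mul0r addr0 -pE.
have q0 : q != 0.
  apply/eqP => q0; have [||c pE] := pq p 1 0; rewrite ?mulr1 ?mulr0 //.
  by move: szp; rewrite pE ltnNge size_polyC_leq1.
have [szq|szq] := leqP (size q) 1.
  by have [r0 qE] := const q q0 szq; exists 0, 1, q`_0; rewrite mul1r mul0r add0r.
have [[u v] /= _ uvE] := resultant_in_ideal szp szq.
by exists u, v, (resultant p q); split; [exact: resultant_neq0|].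
Qed.

End Bezout.

Section BezoutSwap.
Variable R : realType.
Local Notation C := (R[i]).
Implicit Types p q : {poly {poly C}}.

Lemma no_common_factor_swap p q : no_common_factor p q ->
  no_common_factor (swapXY p) (swapXY q).
Proof.
move=> pq d a b pE qE; have [||c dE] := pq (swapXY d) (swapXY a) (swapXY b).
- by rewrite -(swapXYK p) pE rmorphM.
- by rewrite -(swapXYK q) qE rmorphM.
by exists c; rewrite -(swapXYK d) dE swapXY_polyC map_polyC.
Qed.

Lemma bezout_z2 p q : p != 0 -> no_common_factor p q ->
  exists (u v : {poly {poly C}}) (r : {poly C}),
    r != 0 /\ u * p + v * q = map_poly polyC r.
Proof.
rewrite -swapXY_eq0 => p0 /no_common_factor_swap pq.
have [u [v [r [r0 uvE]]]] := bezout_bicoprime p0 pq.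
exists (swapXY u), (swapXY v), r; split => //.
by rewrite -swapXY_polyC -uvE rmorphD !rmorphM /= !swapXYK.
Qed.

End BezoutSwap.

(** * Coefficients of the inverse of a zero-free polynomial *)

Lemma closed_field_roots (F : closedFieldType) (P : {poly F}) : exists rs : seq F,
  P = lead_coef P *: \prod_(a <- rs) ('X - a%:P) /\ {in rs, forall a, P.[a] = 0}.
Proof.
have [rs PE] := closed_field_poly_normal P; exists rs; split=> // a a_rs.
by rewrite PE hornerZ; have := root_prod_XsubC rs a; rewrite a_rs => /rootP ->; rewrite mulr0.
Qed.

Section OneVariableDivision.
Variable R : realType.
Local Notation C := (R[i]).
Implicit Types (P : {poly C}) (a z : C) (k u : fps C) (b M : R).

Lemma fps_XsubCM a k i :
  (('X - a%:P)%:S * k) i = (if i is i'.+1 then k i' else 0) - a * k i.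
Proof. by rewrite rmorphB /= fps_polyC fps_polyX mulrBl fpsB fpsXM fpsCM. Qed.

(* If h = (z - a) k then a k_i = k_(i-1) - h_i, and multiplication by z does not increase
   the norm. *)
Lemma XsubC_lower_bound a k N : 1 < normc a ->
  (normc a - 1) ^+ 2 * (\sum_(i < N) sqmod (k i)) <=
  \sum_(i < N) sqmod ((('X - a%:P)%:S * k) i).
Proof.
move=> a1; set h := _ * k; set y := normc a in a1 *.
set S := \sum_(i < N) sqmod (k i); set H := \sum_(i < N) sqmod (h i).
have y1 : 0 < y - 1 by rewrite subr_gt0.
pose zk i := if i is i'.+1 then k i' else 0.
have term i : y ^+ 2 * sqmod (k i) <= y * sqmod (zk i) + y / (y - 1) * sqmod (h i).
  rewrite {1}/y -sqmodE -sqmodM.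
  have -> : a * k i = zk i + - h i by rewrite /h fps_XsubCM -/(zk i) subKr.
  apply: le_trans (sqmodD_le _ _ y1) _; rewrite sqmodN [1 + (y - 1)]addrC subrK.
  by rewrite (_ : 1 + _ = y / (y - 1)) //; field; rewrite gt_eqF.
have zk_le : \sum_(i < N) sqmod (zk i) <= S.
  rewrite /S; case: (N) => [|n]; first by rewrite !big_ord0.
  by rewrite big_ord_recl sqmod0 add0r big_ord_recr lerDl sqmod_ge0.
have : y ^+ 2 * S <= y * S + y / (y - 1) * H.
  apply: le_trans (_ : \sum_(i < N) (y * sqmod (zk i) + y / (y - 1) * sqmod (h i)) <= _).
    by rewrite mulr_sumr; apply: ler_sum => i _; exact: term.
  by rewrite big_split -!mulr_sumr lerD2r ler_pM2l //; lra.
rewrite -lerBlDl (_ : _ - _ = y / (y - 1) * ((y - 1) ^+ 2 * S)); last first.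
  by field; rewrite gt_eqF.
by rewrite ler_pM2l // divr_gt0 //; lra.
Qed.

Lemma prod_XsubC_lower_bound (rs : seq C) k N : {in rs, forall a, 1 < normc a} ->
  (\prod_(a <- rs) (normc a - 1)) ^+ 2 * (\sum_(i < N) sqmod (k i)) <=
  \sum_(i < N) sqmod (((\prod_(a <- rs) ('X - a%:P))%:S * k) i).
Proof.
elim: rs k => [|a rs IH] k rs1; first by rewrite !big_nil expr1n mul1r rmorph1 mul1r.
rewrite !big_cons rmorphM /= -mulrA exprMn -mulrA.
apply: le_trans (XsubC_lower_bound _ _ (rs1 _ (mem_head _ _))).
by rewrite ler_wpM2l ?sqr_ge0 // IH // => x x_rs; apply: rs1; rewrite in_cons x_rs orbT.
Qed.

Lemma prod_XsubC_coef0_le (rs : seq C) b d : 0 <= b < 1 ->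
  {in rs, forall a, 1 <= b * normc a} -> (size rs <= d)%N ->
  normc (\prod_(a <- rs) ('X - a%:P))`_0 * (1 - b) ^+ d <= \prod_(a <- rs) (normc a - 1).
Proof.
move=> /andP[b0 b1] rs_ge szrs; rewrite -horner_coef0 horner_prod normc_prod.
apply: le_trans (_ : \prod_(a <- rs) (normc a * (1 - b)) <= _); last first.
  rewrite !big_seq; apply: ler_prod => a /rs_ge le1; rewrite mulr_ge0 ?normc_ge0 //=; last by lra.
  by rewrite mulrBr mulr1 lerD2l lerN2 mulrC.
rewrite big_split /= big_const_seq count_predT iter_mulr_1.
rewrite (eq_bigr (fun a => normc a)) => [|a _]; last by rewrite hornerXsubC sub0r normcN.
apply: ler_wpM2l; first by apply: prodr_ge0 => a _; exact: normc_ge0.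
by apply: ler_wiXn2l => //; lra.
Qed.

Lemma inverse_coef_le P b u d i : 0 <= b < 1 -> (size P <= d.+1)%N ->
  (forall z, P.[z] = 0 -> 1 <= b * normc z) -> P%:S * u = 1 ->
  normc P`_0 * (1 - b) ^+ d * normc (u i) <= 1.
Proof.
move=> b01 szP Pz Pu; have [rs [PE Prs]] := closed_field_roots P.
have c0 : lead_coef P != 0.
  rewrite lead_coef_eq0; apply/eqP => P0; move/eqP: Pu.
  by rewrite P0 rmorph0 mul0r eq_sym oner_eq0.
move: (lead_coef P) c0 PE => c c0 PE; set Q := \prod_(a <- rs) _ in PE.
have rs_ge : {in rs, forall a, 1 <= b * normc a} by move=> a /Prs/Pz.
have rs1 : {in rs, forall a, 1 < normc a}.
  by move=> a /rs_ge; have /andP[b0 b1] := b01; have := normc_ge0 a; nra.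
have szrs : (size rs <= d)%N by move: szP; rewrite PE size_scale // size_prod_XsubC ltnS.
pose D := \prod_(a <- rs) (normc a - 1).
have D0 : 0 <= D by rewrite /D big_seq prodr_ge0 // => a /rs1 a1; rewrite subr_ge0 ltW.
have Qu : Q%:S * u = fpsC c^-1.
  rewrite -[RHS]mulr1 -Pu PE -mul_polyC rmorphM /= fps_polyC -[(_ * u)]mulrA [RHS]mulrA.
  by rewrite -rmorphM mulVf // rmorph1 mul1r.
apply: le_trans (_ : normc c * D * normc (u i) <= _).
  rewrite ler_wpM2r ?normc_ge0 // PE coefZ Normc.normcM -mulrA.
  by rewrite ler_wpM2l ?normc_ge0 // prod_XsubC_coef0_le.
rewrite -(@expr_le1 _ 2) ?mulr_ge0 ?normc_ge0 // !exprMn -!sqmodE -mulrA.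
apply: le_trans (_ : sqmod c * (D ^+ 2 * \sum_(j < i.+1) sqmod (u j)) <= _).
  rewrite !ler_wpM2l ?sqr_ge0 ?sqmod_ge0 // big_ord_recr lerDr.
  by apply: sumr_ge0 => j _; exact: sqmod_ge0.
apply: le_trans (ler_wpM2l (sqmod_ge0 _) (prod_XsubC_lower_bound _ _ rs1)) _.
rewrite Qu big_ord_recl big1 => [|j _]; last exact: sqmod0.
by rewrite addr0 -sqmodM divff // sqmodE Normc.normc1 expr1n.
Qed.

Lemma even_odd_le_sup P M : (forall z, normc z = 1 -> normc P.[z] <= M) ->
  forall z, normc z = 1 -> normc (even_poly P).[z ^+ 2] <= M /\ normc (odd_poly P).[z ^+ 2] <= M.
Proof.
move=> le_M z z1; set E := _.[_]; set O := (odd_poly P).[_].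
have P_z : P.[z] = E + O * z.
  by rewrite -{1}(poly_even_odd P) hornerD hornerM !horner_comp hornerXn hornerX.
have P_Nz : P.[- z] = E - O * z.
  by rewrite -{1}(poly_even_odd P) hornerD hornerM !horner_comp hornerXn hornerX sqrrN mulrN.
have normc2 : normc (2^-1 : C) = 2^-1.
  by rewrite Normc.normcV (_ : (2 : C) = 2%:C) ?normc_real // rmorph_nat.
have le_P := le_M z z1; have le_PN : normc P.[- z] <= M by apply: le_M; rewrite normcN.
split.
  have -> : E = 2^-1 * (P.[z] + P.[- z]) by rewrite P_z P_Nz; field.
  by rewrite Normc.normcM normc2; have := le_normcD P.[z] P.[- z]; lra.
have -> : normc O = normc (2^-1 * (P.[z] - P.[- z])).
  by rewrite -[LHS]mulr1 -z1 -Normc.normcM P_z P_Nz; congr normc; field.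
rewrite Normc.normcM normc2; have := le_normcD P.[z] (- P.[- z]); rewrite normcN; lra.
Qed.

Lemma coef_le_sup P M : (forall z, normc z = 1 -> normc P.[z] <= M) ->
  forall i, normc P`_i <= M.
Proof.
have [N] := ubnP (size P); elim: N P => // N IH P; rewrite ltnS => szP le_M i.
have [sz1|sz1] := leqP (size P) 1.
  have := le_M 1 (Normc.normc1 R); rewrite [in P.[1]](size1_polyC sz1) hornerC => le0.
  case: i => [//|i]; rewrite nth_default ?Normc.normc0 ?(leq_trans sz1) //.
  exact: le_trans (normc_ge0 _) le0.
have sqrt_onT w : normc w = 1 -> exists2 z, normc z = 1 :> R & z ^+ 2 = w.
  move=> w1; exists (sqrtc w); last exact: sqr_sqrtc.
  by apply/eqP; rewrite -(@eqrXn2 _ 2) ?normc_ge0 // -normcX sqr_sqrtc w1 expr1n.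
have half := even_odd_le_sup le_M; have szE := odd_double_half (size P).
rewrite -(odd_double_half i); case: (odd i) => /=.
  rewrite add1n -coef_odd_poly; apply: IH => [|w /sqrt_onT[z z1 <-]].
    by apply: leq_trans szP; apply: leq_ltn_trans (size_odd_poly P) _; lia.
  by case: (half z z1).
rewrite add0n -coef_even_poly; apply: IH => [|w /sqrt_onT[z z1 <-]].
  apply: leq_trans szP; apply: leq_ltn_trans (size_even_poly P) _.
  by rewrite uphalf_half; lia.
by case: (half z z1).
Qed.

End OneVariableDivision.

Section ComplexLines.
Variable R : realType.
Local Notation C := (R[i]).
Local Notation fps2 := (fps (fps C)).
Variables x1 x2 : C.
Implicit Types (f g : fps2) (q : {poly {poly C}}).

(* Restriction to the line s |-> (x1 s, x2 s). *)
Definition pline q : {poly C} := (map_poly (comp_poly (x1 *: 'X)) q).[x2 *: 'X].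
Definition line f : fps C := fun k => \sum_(i < k.+1) f i (k - i)%N * (x1 ^+ i * x2 ^+ (k - i)).

Lemma horner_pline q s : (pline q).[s] = peval q (x1 * s) (x2 * s).
Proof.
rewrite /pline /peval (@horner_coef_wide _ (size q) (map_poly _ q)) ?size_poly //.
rewrite horner_sum (horner_coef q) horner_sum.
apply: eq_bigr => j _; rewrite coef_map /= -polyC_exp !hornerM hornerC horner_comp !hornerZ hornerX.
by rewrite horner_exp hornerZ hornerX.
Qed.

Lemma coef_pline q k :
  (pline q)`_k = \sum_(i < k.+1) pcoef q i (k - i) * (x1 ^+ i * x2 ^+ (k - i)).
Proof.
have coef_compX (P : {poly C}) i : (P \Po (x1 *: 'X))`_i = P`_i * x1 ^+ i.
  pose F (j : 'I_(size P)) := if (j : nat) == i then P`_i * x1 ^+ i else 0.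
  rewrite comp_polyE coef_sum (eq_bigr F) => [|j _].
    rewrite -big_mkcond; case: (ltnP i (size P)) => [lt_i|le_i].
      by rewrite (big_pred1 (Ordinal lt_i)).
    rewrite nth_default // mul0r big1 //.
  by rewrite /F exprZn scalerA coefZ coefXn eq_sym; case: eqP => [->|]; rewrite ?mulr1 ?mulr0.
rewrite /pline (@horner_coef_wide _ (k.+1 + size q) (map_poly _ q)); last first.
  exact: leq_trans (size_poly _ _) (leq_addl _ _).
rewrite coef_sum big_split_ord /= addrC big1 ?add0r => [|j _]; last first.
  by rewrite exprZn -scalerAr coefZ coefMXn ltnS leq_addr mulr0.
rewrite (reindex_inj rev_ord_inj); apply: eq_bigr => i _ /=.
rewrite subSS exprZn -scalerAr coefZ coefMXn ltnNge leq_subr /= subKn ?leq_ord //.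
by rewrite coef_map /= coef_compX mulrC mulrA.
Qed.

Lemma plineM : {morph pline : p q / p * q}.
Proof. by move=> p q; rewrite /pline rmorphM hornerM. Qed.

Lemma size_pline m n q : bideg_le m n q -> (size (pline q) <= (m + n).+1)%N.
Proof.
move=> bd; apply/leq_sizeP => k lt_k; rewrite coef_pline big1 // => i _.
by rewrite (pcoef_bideg bd) ?mul0r //; apply/orP; lia.
Qed.

Lemma line_poly q : line q%:S2 = (pline q)%:S.
Proof. by apply/funext => k; rewrite /fps_poly coef_pline. Qed.

Lemma line_trunc f k l : (l <= k)%N -> line f l = (pline (trunc k f))`_l.
Proof.
move=> le_lk; rewrite coef_pline; apply: eq_bigr => i _.
by rewrite pcoef_bipoly (leq_trans (leq_ord i)) // (leq_trans (leq_subr _ _)).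
Qed.

Lemma lineM f g : line (f * g) = line f * line g.
Proof.
apply/funext => k; have -> : (line f * line g) k = (pline (trunc k f * trunc k g))`_k.
  rewrite plineM coefM fpsM; apply: eq_bigr => i _.
  by rewrite -!line_trunc ?leq_subr ?leq_ord.
rewrite coef_pline; apply: eq_bigr => i _; congr (_ * _).
have [le_ik le_kik] := (leq_ord i, leq_subr i k).
rewrite -(fps2M_truncr g f le_ik le_kik) mulrC -(fps2M_truncr f _ le_ik le_kik) mulrC.
by rewrite -rmorphM.
Qed.

Lemma line1 : line 1 = 1.
Proof. by rewrite -[1 in LHS](rmorph1 (@fps2_poly C)) line_poly /pline rmorph1 hornerC rmorph1. Qed.

End ComplexLines.

(* On the line s |-> (b s, b z s) with |z| = 1 the polynomial p is zero-free for |s| < 1/b, and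
   the coefficient of s^k in 1/p is the polynomial b^k \sum_j c_(k-j,j) z^j. *)
Lemma inverse_coef_bound (R : realType) m n (p : {poly {poly R[i]}}) (c : fps (fps R[i])) (b : R) :
  bideg_le m n p -> no_zeros_D2 p -> p%:S2 * c = 1 -> 0 < b < 1 ->
  exists A : R, 0 <= A /\ forall i j, normc (c i j) * b ^+ (i + j) <= A.
Proof.
move=> bd p_nz pc /andP[b0 b1]; have p00 : peval p 0 0 != 0 by rewrite p_nz ?inD0.
have B0 : 0 < normc (peval p 0 0) * (1 - b) ^+ (m + n).
  by rewrite mulr_gt0 ?normc_gt0 ?exprn_gt0 ?subr_gt0.
exists (normc (peval p 0 0) * (1 - b) ^+ (m + n))^-1; split=> [|i j].
  by rewrite invr_ge0 ltW.
set k := (i + j)%N; pose q : {poly R[i]} := \poly_(l < k.+1) ((b ^+ k)%:C * c (k - l)%N l).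
have -> : normc (c i j) * b ^+ k = normc q`_j.
  rewrite coef_poly ltnS leq_addl /k addnK Normc.normcM normc_real ?exprn_ge0 ?(ltW b0) //.
  by rewrite mulrC.
apply: coef_le_sup => z z1; have norm_b := normc_real (ltW b0).
have -> : q.[z] = line b%:C (b%:C * z) c k.
  rewrite horner_poly (reindex_inj rev_ord_inj); apply: eq_bigr => l _ /=.
  rewrite subSS subKn ?leq_ord // exprMn rmorphXn -{1}(subnKC (leq_ord l)) exprD; ring.
have p_line0 : (pline b%:C (b%:C * z) p)`_0 = peval p 0 0.
  by rewrite -horner_coef0 horner_pline !mulr0.
rewrite -[leRHS]mulr1 ler_pdivlMl // -p_line0.
apply: inverse_coef_le; first by rewrite (ltW b0).
- exact: size_pline.
- move=> s; rewrite horner_pline => ps0; rewrite leNgt; apply/negP => s_lt.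
  have := p_nz (b%:C * s) (b%:C * z * s); rewrite ps0 eqxx !inDE !Normc.normcM z1 norm_b mulr1.
  by move=> /(_ s_lt s_lt).
by rewrite -line_poly -lineM pc line1.
Qed.

(** * Multiplication by the inner function is isometric *)

Section CoefficientwiseLimits.
Variable R : realType.
Local Notation C := (R[i]).
Local Notation fps2 := (fps (fps C)).
Context {T : Type} {F : set_system T} {FF : ProperFilter F}.
Implicit Types (u v : T -> fps2) (f g : fps2).

Definition coef_cvg u f := forall i j, ccvg F (fun t => u t i j) (f i j).

Lemma coef_cvgM u v f g : coef_cvg u f -> coef_cvg v g -> coef_cvg (fun t => u t * v t) (f * g).
Proof.
move=> uf vg i j; rewrite fps2M; under eq_fun do rewrite fps2M.
by do 2!apply: ccvg_sum => ? _; apply: ccvgM.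
Qed.

Lemma cvg_sqnormN u f N : coef_cvg u f -> sqnormN N (u t) @[t --> F] --> sqnormN N f.
Proof.
move=> uf; have sqnormN_Re h : sqnormN N h = Re (ipN N h h) by rewrite ipN_sqnormN.
rewrite sqnormN_Re; under eq_fun do rewrite sqnormN_Re.
suff: ccvg F (fun t => ipN N (u t) (u t)) (ipN N f f) by case.
by do 2!apply: ccvg_sum => ? _; apply: ccvgM; [|apply: ccvg_conj].
Qed.

Lemma H2_coef_cvg u f (M : R) : coef_cvg u f ->
  (\forall t \near F, H2 (u t) /\ sqnorm (u t) <= M) -> H2 f /\ sqnorm f <= M.
Proof.
move=> uf u_le; apply: H2_sqnorm_le => N; have lim_N := cvg_sqnormN (N := N) uf.
rewrite -(cvg_lim _ lim_N) //; apply: limr_le; first by apply/cvg_ex; exists (sqnormN N f).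
near=> t; have [u_H2 le_M] : H2 (u t) /\ sqnorm (u t) <= M by near: t.
by apply: le_trans le_M; exact: sqnormN_le_sqnorm.
Unshelve. all: by end_near. Qed.

Lemma ccvg_ip_poly m n (q : T -> {poly {poly C}}) q0 v g :
  (forall t, bideg_le m n (q t)) -> bideg_le m n q0 ->
  (\forall t \near F, H2 (v t)) -> H2 g ->
  coef_cvg (fun t => (q t)%:S2) q0%:S2 -> coef_cvg v g ->
  ccvg F (fun t => ip (q t)%:S2 (v t)) (ip q0%:S2 g).
Proof.
move=> bdq bdq0 v_H2 g_H2 q_cvg v_cvg; rewrite (ip_polyl bdq0 g_H2).
apply: (@ccvg_near _ _ _ _ (fun t => \sum_(s : 'I_m.+1 * 'I_n.+1)
  pcoef (q t) s.1 s.2 * (v t s.1 s.2)^*)).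
  near=> t; have v_H2t : H2 (v t) by near: t.
  by rewrite (ip_polyl (bdq t)).
apply: ccvg_sum => s _; apply: ccvgM; first exact: q_cvg.
by apply: ccvg_conj; exact: v_cvg.
Unshelve. all: by end_near. Qed.

End CoefficientwiseLimits.

Definition rational_inner (R : realType) (m n : nat) (p : {poly {poly R[i]}}) :=
  [/\ bideg_le m n p, no_zeros_D2 p & no_common_factor p (prefl m n p)].

Section InnerIsometry.
Variable R : realType.
Local Notation C := (R[i]).
Local Notation fps2 := (fps (fps C)).
Local Notation radial := ((1 : R)^'- : set_system R).
Implicit Types (f g F G K : fps2) (a b q : {poly {poly C}}) (x : C).

Definition dilate x f : fps2 := fun i j => f i j * x ^+ (i + j).
Definition pdilate m n x q := bipoly m n (fun i j => pcoef q i j * x ^+ (i + j)).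

Lemma dilateM x f g : dilate x (f * g) = dilate x f * dilate x g.
Proof.
apply: fps2_ext => i j; rewrite fps2M /dilate fps2M mulr_suml; apply: eq_bigr => k _.
rewrite mulr_suml; apply: eq_bigr => l _; rewrite mulrACA -exprD; congr (_ * _ ^+ _).
by have := leq_ord k; have := leq_ord l; lia.
Qed.

Lemma dilate1 x : dilate x 1 = 1.
Proof. by apply: fps2_ext => -[|i] [|j]; rewrite /dilate fps21 ?mul0r ?mulr1. Qed.

Lemma pcoef_pdilate m n x q i j : bideg_le m n q ->
  pcoef (pdilate m n x q) i j = dilate x q%:S2 i j.
Proof.
move=> bd; rewrite pcoef_bipoly /dilate fps2_polyE -/(pcoef q i j); case: ifPn => //.
by rewrite negb_and -!ltnNge => /(pcoef_bideg bd) ->; rewrite mul0r.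
Qed.

Lemma dilate_poly m n x q : bideg_le m n q -> dilate x q%:S2 = (pdilate m n x q)%:S2.
Proof. by move=> bd; apply: fps2_ext => i j; rewrite -(pcoef_pdilate _ _ _ bd). Qed.

Lemma coef_cvg_dilate f : coef_cvg (F := radial) (fun r => dilate r%:C f) f.
Proof.
move=> i j; suff : ccvg radial (fun r => dilate r%:C f i j) (f i j * 1 ^+ (i + j)).
  by rewrite expr1n mulr1.
by apply: ccvgM; [exact: ccvg_cst|apply: ccvgX; exact: ccvg_radial].
Qed.

Lemma no_zeros_D2_coef0 q : no_zeros_D2 q -> q`_0`_0 != 0.
Proof. by move=> q_nz; have := q_nz 0 0; rewrite inD0 /peval polyC0 !horner_coef0; apply. Qed.

Lemma no_zeros_D2_neq0 q : no_zeros_D2 q -> q != 0.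
Proof. by move=> /no_zeros_D2_coef0; apply: contraNneq => ->; rewrite !coef0. Qed.

Lemma fps2_poly_inverse q : no_zeros_D2 q -> exists c : fps2, q%:S2 * c = 1.
Proof.
move=> /no_zeros_D2_coef0 q00; have [y qy] : exists y : fps C, q%:S2 0%N * y = 1.
  by apply: (@fps_inv_exists _ _ (q`_0`_0)^-1); exact: mulfV.
exact: fps_inv_exists qy.
Qed.

Variables (m n : nat) (p : {poly {poly C}}).
Hypothesis p_inner : rational_inner m n p.
Let bd : bideg_le m n p. Proof. by case: p_inner. Qed.
Let p_nz : no_zeros_D2 p. Proof. by case: p_inner. Qed.

Variable c : fps2.
Hypothesis pc : p%:S2 * c = 1.

Definition theta : fps2 := (prefl m n p)%:S2 * c.

Lemma poly_theta : p%:S2 * theta = (prefl m n p)%:S2.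
Proof. by rewrite /theta mulrCA pc mulr1. Qed.

Let pr r := pdilate m n r%:C p.
Let theta_r r := (prefl m n (pr r))%:S2 * dilate r%:C c.

Lemma pdilate_inverse r : (pr r)%:S2 * dilate r%:C c = 1.
Proof. by rewrite -(dilate_poly _ bd) -dilateM pc dilate1. Qed.

Lemma H2_dilate_inverse (r : R) : 0 < r < 1 -> H2 (dilate r%:C c).
Proof.
move=> /andP[r0 r1]; pose b := (1 + r) / 2.
have b0 : 0 < b by rewrite /b; lra.
have b01 : 0 < b < 1 by rewrite b0 /b; lra.
have [A [A0 le_A]] := inverse_coef_bound bd p_nz pc b01.
have rb : 0 <= r / b < 1.
  by rewrite divr_ge0 ?(ltW r0) ?(ltW b0) // ltr_pdivrMr // mul1r /b; lra.
apply: (proj1 (H2_geometric rb rb A0 _)) => i j.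
rewrite /dilate Normc.normcM normcX normc_real ?(ltW r0) // -exprD expr_div_n mulrA.
by rewrite ler_pdivlMr ?exprn_gt0 // mulrAC ler_wpM2r ?exprn_ge0 ?(ltW r0).
Qed.

Lemma H2_sqnorm_theta_r (r : R) : 0 < r < 1 -> H2 (theta_r r) /\ sqnorm (theta_r r) <= 1.
Proof.
move=> /H2_dilate_inverse c_H2; have theta_H2 : H2 (theta_r r) by exact: H2_polyM.
split => //; rewrite -sqnorm_one le_eqVlt; apply/orP; left; apply/eqP/sqnorm_ip => //.
  exact: H2_one.
by rewrite /theta_r ip_preflM ?pdilate_inverse //; exact: bideg_bipoly.
Qed.

Lemma coef_cvg_prefl : coef_cvg (F := radial) (fun r => (prefl m n (pr r))%:S2) (prefl m n p)%:S2.
Proof.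
move=> i j; rewrite fps2_prefl; under eq_fun do rewrite fps2_prefl.
case: ifP => _; last exact: ccvg_cst.
by apply: ccvg_conj; under eq_fun do rewrite (pcoef_pdilate _ _ _ bd); exact: coef_cvg_dilate.
Qed.

Lemma coef_cvg_theta : coef_cvg (F := radial) theta_r theta.
Proof. by apply: coef_cvgM; [exact: coef_cvg_prefl|exact: coef_cvg_dilate]. Qed.

Lemma H2_theta : H2 theta.
Proof.
apply: (proj1 (H2_coef_cvg coef_cvg_theta (M := 1) _)).
by near=> r; apply: H2_sqnorm_theta_r; near: r; exact: near_radial.
Unshelve. all: by end_near. Qed.

Lemma H2_theta_poly a : H2 (theta * a%:S2).
Proof. by rewrite mulrC; apply: H2_polyM; exact: H2_theta. Qed.

Lemma ip_prefl_theta a b : ip (prefl m n p * a)%:S2 (theta * b%:S2) = ip (p * a)%:S2 b%:S2.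
Proof.
have [ma [na bda]] := bideg_exists a.
have cst q : coef_cvg (F := radial) (fun=> q%:S2) q%:S2 by move=> i j; exact: ccvg_cst.
have lim_theta : ccvg radial (fun r => ip (prefl m n (pr r) * a)%:S2 (theta_r r * b%:S2))
    (ip (prefl m n p * a)%:S2 (theta * b%:S2)).
  apply: (@ccvg_ip_poly _ _ _ _ (m + ma) (n + na)).
  - by move=> r; apply: bideg_leM bda; exact: bideg_prefl.
  - by apply: bideg_leM bda; exact: bideg_prefl.
  - near=> r; rewrite mulrC; apply/H2_polyM/(proj1 (H2_sqnorm_theta_r _)).
    by near: r; exact: near_radial.
  - exact: H2_theta_poly.
  - by rewrite rmorphM; under eq_fun do rewrite rmorphM; exact: coef_cvgM coef_cvg_prefl (cst a).
  - exact: coef_cvgM coef_cvg_theta (cst b).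
apply: (ccvg_unique lim_theta).
apply: (@ccvg_near _ _ _ _ (fun r => ip (pr r * a)%:S2 b%:S2)).
  near=> r; have c_H2 : H2 (dilate r%:C c).
    by apply: H2_dilate_inverse; near: r; exact: near_radial.
  have cb_H2 : H2 (dilate r%:C c * b%:S2) by rewrite mulrC; exact: H2_polyM.
  rewrite !rmorphM /theta_r -mulrA ip_preflM //; [|exact: bideg_bipoly|exact: H2_poly].
  by rewrite [_ * (_ * b%:S2)]mulrA pdilate_inverse mul1r.
apply: (@ccvg_ip_poly _ _ _ _ (m + ma) (n + na)) => //.
- by move=> r; apply: bideg_leM bda; exact: bideg_bipoly.
- exact: bideg_leM bda.
- by near=> r; exact: H2_poly.
- exact: H2_poly.
rewrite rmorphM; under eq_fun do rewrite rmorphM /= /pr -(dilate_poly _ bd).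
exact: coef_cvgM (coef_cvg_dilate _) (cst a).
Unshelve. all: by end_near. Qed.

(* The defect of isometry vanishes on the ideal generated by p and its reflection, hence on the
   multiples of a polynomial in z2 alone; the roots of the latter are then peeled off using the
   weak decay of the powers of z2. *)
Definition defect f g : C := ip f g - ip (theta * f) (theta * g).
Definition defect_dom f := H2 f /\ H2 (theta * f).
Definition defect_null q := forall a b, defect (q * a)%:S2 b%:S2 = 0.

Lemma defect_dom_poly a : defect_dom a%:S2.
Proof. by split; [exact: H2_poly|exact: H2_theta_poly]. Qed.

Lemma defectC f g : defect_dom f -> defect_dom g -> defect f g = (defect g f)^*.
Proof.
move=> [f_H2 tf_H2] [g_H2 tg_H2].
by rewrite /defect (ipC g_H2 f_H2) (ipC tg_H2 tf_H2) -rmorphB.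
Qed.

Lemma defectDl f g h : defect_dom f -> defect_dom g -> defect_dom h ->
  defect (f + g) h = defect f h + defect g h.
Proof. by move=> [? ?] [? ?] [? ?]; rewrite /defect mulrDr !ipDl //; ring. Qed.

Lemma defectZl x f g : defect_dom f -> defect_dom g ->
  defect (fps2C x * f) g = x * defect f g.
Proof. by move=> [? ?] [? ?]; rewrite /defect mulrCA !ipZl //; ring. Qed.

Lemma defect_monomM k f g : defect_dom f -> defect_dom g ->
  defect (monom 0 k * f) (monom 0 k * g) = defect f g.
Proof.
by move=> [? ?] [? ?]; rewrite /defect ![theta * (monom 0 k * _)]mulrCA !ip_monomM.
Qed.

Lemma defect_decay f g (e : R) : defect_dom f -> defect_dom g -> 0 < e ->
  exists k, sqmod (defect (monom 0 k * f) g) <=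
    (2 * sqnorm f + 2 * sqnorm (theta * f)) * e.
Proof.
move=> [f_H2 tf_H2] [g_H2 tg_H2] e0.
have [k1 decay1] := monom_decay f_H2 g_H2 e0.
have [k2 decay2] := monom_decay tf_H2 tg_H2 e0.
exists (maxn k1 k2); rewrite /defect [theta * (_ * _)]mulrCA.
apply: le_trans (sqmodD_le _ _ ltr01) _; rewrite sqmodN invr1.
have := decay1 _ (leq_maxl k1 k2); have := decay2 _ (leq_maxr k1 k2); lra.
Qed.

Lemma defect_null_p : defect_null p.
Proof.
move=> a b; rewrite /defect -ip_prefl_theta !rmorphM /= -poly_theta.
by rewrite [theta * (_ * _)]mulrCA mulrA subrr.
Qed.

Lemma defect_null_prefl : defect_null (prefl m n p).
Proof.
have dom := defect_dom_poly; move=> a b.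
have [x xE] : exists x : {poly {poly C}}, x%:S2 = monom m n.
  by exists (('X^m)%:P * 'X^n); exact: fps2_poly_monom.
have <- : defect (x * a)%:S2 (p * b)%:S2 = 0.
  by rewrite defectC ?defect_null_p ?conjC0.
rewrite /defect !rmorphM /= xE ![theta * (_ * _)]mulrCA.
by rewrite !ip_preflMl //; by [exact: H2_poly|exact: H2_theta_poly].
Qed.

Lemma defect_null_peel x q : defect_null (('X - x%:P%:P) * q) -> defect_null q.
Proof.
move=> Xq_null; have dom := defect_dom_poly.
have shift1 a b : defect ('X * (q * a))%:S2 b%:S2 = x * defect (q * a)%:S2 b%:S2.
  have /eqP := Xq_null a b.
  rewrite (_ : _ * q * a = 'X * (q * a) + (- x)%:P%:P * (q * a)); last by rewrite !polyCN; ring.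
  rewrite rmorphD /= defectDl // [((_%:P * _)%:S2)]rmorphM /= fps2_polyC defectZl // mulNr.
  by rewrite subr_eq0 => /eqP.
have monom_poly k a : monom 0 k * a%:S2 = ('X^k * a)%:S2 by rewrite rmorphM /= fps2_polyXn.
have shift k a b : defect (monom 0 k * (q * a)%:S2) b%:S2 = x ^+ k * defect (q * a)%:S2 b%:S2.
  rewrite monom_poly; elim: k a => [|k IH] a; first by rewrite !mul1r.
  by rewrite exprSr -mulrA ['X * _]mulrCA IH [q * _]mulrCA shift1 exprSr mulrA.
move=> a b; have [x1|x1] := leP 1 (normc x).
  apply: sqmod_small => e e0; have [k decay] := defect_decay (dom (q * a)) (dom b) e0.
  apply: le_trans decay; rewrite shift sqmodM ler_peMl ?sqmod_ge0 //.
  by rewrite sqmodE normcX !exprn_ege1.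
apply: sqmod_small => e e0; have [k decay] := defect_decay (dom b) (dom (q * a)) e0.
rewrite monom_poly in decay; apply: le_trans decay.
rewrite -(defect_monomM k (dom _) (dom b)) [monom 0 k * b%:S2]monom_poly shift sqmodM.
rewrite [defect ('X^k * b)%:S2 _]defectC // [leRHS]sqmodE normc_conj -sqmodE ler_piMl ?sqmod_ge0 //.
by rewrite sqmodE normcX !exprn_ile1 ?exprn_ge0 ?normc_ge0 // ltW.
Qed.

Lemma defect_eq0 a b : defect a%:S2 b%:S2 = 0.
Proof.
have dom := defect_dom_poly; have [_ _ p_coprime] := p_inner.
have [u [v [r [r0 uvE]]]] := bezout_z2 (no_zeros_D2_neq0 p_nz) p_coprime.
have r_null : defect_null (map_poly polyC r).
  move=> a' b'; rewrite -uvE mulrDl -[u * p * _]mulrA -[v * _ * _]mulrA (mulrCA u) (mulrCA v).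
  by rewrite rmorphD /= defectDl // defect_null_p defect_null_prefl addr0.
have [rs rE] := closed_field_poly_normal r.
have rootsE : map_poly polyC r = (lead_coef r)%:P%:P * \prod_(z <- rs) ('X - z%:P%:P).
  rewrite {1}rE -mul_polyC rmorphM /= map_polyC rmorph_prod; congr (_ * _).
  by apply: eq_bigr => z _; rewrite rmorphB /= map_polyX map_polyC.
have roots_null : defect_null (\prod_(z <- rs) ('X - z%:P%:P)).
  move=> a' b'; have /eqP := r_null a' b'; rewrite rootsE -mulrA rmorphM /= fps2_polyC defectZl //.
  by rewrite mulf_eq0 lead_coef_eq0 (negPf r0) => /eqP.
suff : defect_null 1 by move=> /(_ a b); rewrite mul1r.
elim: (rs) roots_null => [|z s IH]; first by rewrite big_nil.
by rewrite big_cons => /defect_null_peel/IH.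
Qed.

Lemma ip_theta_poly a b : ip (theta * a%:S2) (theta * b%:S2) = ip a%:S2 b%:S2.
Proof. by apply/esym/subr0_eq; exact: defect_eq0. Qed.

Lemma theta_contraction f : H2 f -> H2 (theta * f) /\ sqnorm (theta * f) <= sqnorm f.
Proof.
move=> f_H2; apply: H2_sqnorm_le => N; have T_H2 := H2_theta_poly (trunc N f).
have -> : sqnormN N (theta * f) = sqnormN N (theta * (trunc N f)%:S2).
  by apply: eq_bigr => i _; apply: eq_bigr => j _; rewrite fps2M_truncr // ltnW.
apply: le_trans (sqnormN_le_sqnorm N T_H2) _.
rewrite (sqnorm_ip T_H2 (H2_poly _) (ip_theta_poly _ _)).
exact: sqnorm_trunc_le.
Qed.

Lemma defect_domP f : H2 f -> defect_dom f.
Proof. by move=> f_H2; split=> //; case: (theta_contraction f_H2). Qed.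

Lemma defect_approx f g : H2 f -> H2 g -> (forall N, defect f (trunc N g)%:S2 = 0) ->
  defect f g = 0.
Proof.
move=> f_H2 g_H2 trunc0; apply: (@sqmod_small _ _ (4 * sqnorm f)) => e e0.
have [N close] := trunc_approx g_H2 e0; have T_H2 := H2_poly (trunc N g).
have d_H2 := H2B g_H2 T_H2.
have [tf_H2 tf_le] := theta_contraction f_H2; have [td_H2 td_le] := theta_contraction d_H2.
have [tg_H2 _] := theta_contraction g_H2; have [tT_H2 _] := theta_contraction T_H2.
have -> : defect f g = defect f (g - (trunc N g)%:S2).
  rewrite -[LHS]subr0 -(trunc0 N) /defect mulrBr !ipBr //; ring.
have cs_f : sqmod (ip f (g - (trunc N g)%:S2)) <= sqnorm f * e.
  by apply: le_trans (cauchy_schwarz f_H2 d_H2) _; rewrite ler_wpM2l ?sqnorm_ge0.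
have cs_tf : sqmod (ip (theta * f) (theta * (g - (trunc N g)%:S2))) <= sqnorm f * e.
  apply: le_trans (cauchy_schwarz tf_H2 td_H2) _.
  by rewrite ler_pM ?sqnorm_ge0 // (le_trans td_le).
by apply: le_trans (sqmodD_le _ _ ltr01) _; rewrite sqmodN invr1; lra.
Qed.

Lemma theta_isometry f g : H2 f -> H2 g -> ip (theta * f) (theta * g) = ip f g.
Proof.
move=> f_H2 g_H2; apply/esym/subr0_eq; apply: defect_approx => // N.
have [f_dom T_dom] := (defect_domP f_H2, defect_dom_poly (trunc N g)).
rewrite defectC // [defect _ f](_ : _ = 0) ?conjC0 //.
by apply: defect_approx => // [|M]; [exact: H2_poly|exact: defect_eq0].
Qed.

End InnerIsometry.

(** * Orthonormal bases and wandering subspaces *)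

Section Subspaces.
Variable R : realType.
Local Notation C := (R[i]).
Local Notation fps2 := (fps (fps C)).
Implicit Types (S W : set fps2) (f g h K : fps2).

Definition subspace W := [/\ (forall f, W f -> H2 f), W 0,
  (forall f g, W f -> W g -> W (f + g)) & (forall (a : C) f, W f -> W (fps2C a * f))].

Lemma closed_subspace2_subspace W : closed_subspace2 W -> subspace W.
Proof.
move=> [W_H2 W0 WD WZ _]; split=> // a f /(WZ a); congr W.
by apply: fps2_ext => i j; rewrite fps2CM.
Qed.

Lemma subspace_swap W : subspace W -> subspace (@swap C @^-1` W).
Proof.
move=> [W_H2 W0 WD WZ]; split=> [f /W_H2/H2_swap //|//|f g /WD/[apply] //|a f /(WZ a)] /=.
by congr W; apply: fps2_ext => i j; rewrite fps2CM [RHS]fps2CM.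
Qed.

Lemma subspaceB W f g : subspace W -> W f -> W g -> W (f - g).
Proof.
by move=> [_ _ WD WZ] Wf Wg; apply: WD => //; rewrite -mulN1r -fps2C1 -fps2CN; exact: WZ.
Qed.

Lemma subspace_sum W (I : Type) (s : seq I) (P : pred I) (F : I -> fps2) :
  subspace W -> (forall i, P i -> W (F i)) -> W (\sum_(i <- s | P i) F i).
Proof. by move=> [_ W0 WD _] WF; elim/big_ind: _. Qed.

Definition orthonormal_in W d (e : 'I_d -> fps2) :=
  (forall k, W (e k)) /\ forall k l, ip (e k) (e l) = (k == l)%:R.

Definition expansion d (e : 'I_d -> fps2) f : fps2 := \sum_k fps2C (ip f (e k)) * e k.

Definition orthonormal_basis W d (e : 'I_d -> fps2) :=
  orthonormal_in W e /\ forall f, W f -> f = expansion e f.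

Section Orthonormal.
Variables (W : set fps2) (d : nat) (e : 'I_d -> fps2).
Hypotheses (W_sub : subspace W) (e_on : orthonormal_in W e).

Let e_H2 k : H2 (e k).
Proof. by case: W_sub => W_H2 _ _ _; case: e_on => We _; exact: W_H2. Qed.

Lemma comb_mem (x : 'I_d -> C) : W (\sum_k fps2C (x k) * e k).
Proof.
by apply: subspace_sum => // k _; case: W_sub => _ _ _ WZ; apply: WZ; case: e_on.
Qed.

Lemma ip_comb (x : 'I_d -> C) k : ip (\sum_l fps2C (x l) * e l) (e k) = x k.
Proof.
rewrite ip_suml // => [|l _]; last exact: H2Z.
rewrite (bigD1 k) //= ipZl // (proj2 e_on) eqxx mulr1 big1 ?addr0 // => l /negPf l_neq_k.
by rewrite ipZl // (proj2 e_on) l_neq_k mulr0.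
Qed.

Lemma orthonormal_extend f : W f -> f != expansion e f ->
  exists e' : 'I_d.+1 -> fps2, orthonormal_in W e'.
Proof.
move=> Wf; rewrite -subr_eq0; set g := f - _ => g0; have [W_H2 _ _ WZ] := W_sub.
have Wg : W g by apply: subspaceB => //; exact: comb_mem.
have [f_H2 g_H2 x_H2] : [/\ H2 f, H2 g & H2 (expansion e f)].
  by split; apply: W_H2 => //; exact: comb_mem.
have g_orth k : ip g (e k) = 0 by rewrite ipBl // ip_comb subrr.
have g_gt0 : 0 < sqnorm g.
  by rewrite lt_neqAle sqnorm_ge0 // andbT eq_sym; apply: contraNneq g0 => /sqnorm_eq0->.
pose t := Num.sqrt (sqnorm g).
have t0 : t != 0 by rewrite gt_eqF // sqrtr_gt0.
have tE : sqnorm g = t * t by rewrite -expr2 sqr_sqrtr // ltW.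
pose g1 := fps2C t^-1%:C * g; have g1_H2 : H2 g1 by exact: H2Z.
have g1_orth k : ip g1 (e k) = 0 by rewrite ipZl // g_orth mulr0.
exists (fun k => if unlift ord_max k is Some k' then e k' else g1); split=> [k|k l].
  by case: unliftP => [k' _|_]; [case: e_on|exact: WZ].
case: (unliftP ord_max k) => [k' ->|->]; case: (unliftP ord_max l) => [l' ->|->].
- by rewrite (proj2 e_on) (inj_eq lift_inj).
- by rewrite ipC // g1_orth conjC0 eq_sym (negPf (neq_lift _ _)).
- by rewrite g1_orth (negPf (neq_lift _ _)).
rewrite eqxx ipZl // ipZr // ip_sqnorm // conj_real_complex -!rmorphM tE.
by rewrite (_ : t^-1 * (t^-1 * (t * t)) = 1) //; field.
Qed.

End Orthonormal.

Lemma orthonormal_basis_exists W m : subspace W ->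
  (forall d (e : 'I_d -> fps2), orthonormal_in W e -> (d <= m)%N) ->
  exists d (e : 'I_d -> fps2), (d <= m)%N /\ orthonormal_basis W e.
Proof.
move=> W_sub le_m; pose P d := `[< exists e : 'I_d -> fps2, orthonormal_in W e >].
have P0 : exists d, P d by exists 0%N; apply/asboolP; exists (fun=> 0); split=> [[]|[]].
have Pm d : P d -> (d <= m)%N by move=> /asboolP[e /le_m].
case: (ex_maxnP P0 Pm) => d /asboolP[e e_on] d_max; exists d, e; split; first exact: le_m e_on.
split=> // f Wf; apply/eqP/negPn/negP => /(orthonormal_extend W_sub e_on Wf) e'_on.
by have /d_max : P d.+1 by [apply/asboolP]; rewrite ltnn.
Qed.

Section Basis.
Variables (W : set fps2) (d : nat) (e : 'I_d -> fps2).
Hypotheses (W_sub : subspace W) (e_basis : orthonormal_basis W e).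
Let e_on : orthonormal_in W e. Proof. by case: e_basis. Qed.
Let e_H2 k : H2 (e k). Proof. by case: W_sub e_on => W_H2 _ _ _ [We _]; exact: W_H2. Qed.

Lemma dim_orthonormal_basis : dim_eq W d.
Proof.
have combE (x : 'I_d -> C) :
    (fun i j => \sum_(k < d) x k * e k i j) = \sum_k fps2C (x k) * e k :> fps2.
  by apply: fps2_ext => i j; rewrite fps2_sum; apply: eq_bigr => k _; rewrite fps2CM.
exists e; split=> [k|x|f /(proj2 e_basis) fE]; first by case: e_on.
  rewrite combE => x0 k; have := ip_comb W_sub e_on x k.
  by rewrite [X in ip X _](_ : _ = (0 : fps2)) ?ip0l.
by exists (fun k => ip f (e k)); rewrite combE.
Qed.

Lemma parseval f g : W f -> W g -> ip f g = \sum_k ip f (e k) * (ip g (e k))^*.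
Proof.
move=> Wf Wg; have [f_H2 g_H2] : H2 f /\ H2 g by case: W_sub => W_H2 _ _ _; split; exact: W_H2.
rewrite {1}(proj2 e_basis f Wf) ip_suml // => [|k _]; last exact: H2Z.
by apply: eq_bigr => k _; rewrite ipZl // (ipC g_H2).
Qed.

End Basis.

Definition reproduces W w1 w2 K := W K /\ forall f, W f -> ip f K = ev f w1 w2.

Lemma ev_reproducing_kernel W d (e : 'I_d -> fps2) w1 w2 K z1 z2 :
  subspace W -> orthonormal_basis W e -> reproduces W w1 w2 K -> inD z1 -> inD z2 ->
  ev K z1 z2 = \sum_k ev (e k) z1 z2 * (ev (e k) w1 w2)^*.
Proof.
move=> [W_H2 _ _ _] [[We _] basis] [WK K_repr] z1D z2D.
have e_H2 k := W_H2 _ (We k); have K_H2 := W_H2 _ WK.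
rewrite {1}(basis _ WK) ev_sum // => [|k _]; last exact: H2Z.
by apply: eq_bigr => k _; rewrite evZ // ipC // K_repr // mulrC.
Qed.

End Subspaces.

Section Wandering.
Variable R : realType.
Local Notation C := (R[i]).
Local Notation fps2 := (fps (fps C)).
Implicit Types (f g h K : fps2) (v : {poly C}).

Lemma fps2_polyz2 v :
  (map_poly polyC v)%:S2 = \sum_(j < size v) fps2C v`_j * monom 0 j :> fps2.
Proof.
rewrite -{1}[v]coefK poly_def !rmorph_sum /=; apply: eq_bigr => j _.
by rewrite map_polyZ map_polyXn -mul_polyC rmorphM /= fps2_polyC fps2_polyXn.
Qed.

Lemma polyz2M_coef v f i j :
  ((map_poly polyC v)%:S2 * f) i j = \sum_(b < j.+1) v`_b * f i (j - b)%N.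
Proof.
rewrite fps2M big_ord_recl [X in _ + X]big1 => [|a _]; last first.
  by rewrite big1 // => b _; rewrite fps2_polyE coef_map /= coefC mul0r.
by rewrite addr0; apply: eq_bigr => b _; rewrite fps2_polyE coef_map /= coefC subn0.
Qed.

Lemma polyz2_dependent m n (g : 'I_m.+1 -> fps2) :
  (forall k i j, ((m <= i) || (n < j))%N -> g k i j = 0) ->
  exists v : 'rV[{poly C}]_m.+1, v != 0 /\ \sum_k (map_poly polyC (v 0 k))%:S2 * g k = 0.
Proof.
move=> g_deg; pose M : 'M[{poly C}]_m.+1 := \matrix_(k, i) \poly_(j < n.+1) g k i j.
have M_coef k i j : (M k i)`_j = g k i j.
  by rewrite mxE coef_poly; case: ltnP => // lt_nj; rewrite g_deg ?lt_nj ?orbT.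
have /det0P[v v0 vM] : \det M == 0.
  rewrite (expand_det_col _ ord_max) big1 // => k _.
  rewrite [M k ord_max](_ : _ = 0) ?mul0r //.
  by apply/polyP => j; rewrite M_coef coef0 g_deg ?leqnn.
exists v; split=> //; apply: fps2_ext => i j; rewrite fps2_sum fps20.
under eq_bigr do rewrite polyz2M_coef.
case: (ltnP i m.+1) => [lt_im|lt_mi]; last first.
  by rewrite big1 // => k _; rewrite big1 // => b _; rewrite g_deg ?mulr0 // ltnW.
have vM_i : \sum_k v 0 k * M k (Ordinal lt_im) = 0.
  by have /rowP/(_ (Ordinal lt_im)) := vM; rewrite mxE => ->; rewrite mxE.
have := congr1 (coefp j) vM_i; rewrite /= coef_sum coef0 => vM_ij.
rewrite -[RHS]vM_ij; apply: eq_bigr => k _.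
by rewrite coefM; apply: eq_bigr => b _; rewrite M_coef.
Qed.

Section WanderingSubspace.
Variable S : set fps2.
Hypotheses (S_sub : subspace S) (S_inv : forall f, S f -> S (X2 * f)).

Lemma invariant_monomM k f : S f -> S (monom 0 k * f).
Proof.
by move=> Sf; elim: k => [|k IH]; [rewrite monom0M|rewrite monomS2M; exact: S_inv].
Qed.

Lemma wandering2P f :
  wandering2 S f <-> S f /\ forall g, S g -> ip f (X2 * g) = 0.
Proof.
by split=> -[Sf f_orth]; split=> // g /f_orth; rewrite ipE shift2E.
Qed.

Let S_H2 f : S f -> H2 f. Proof. by case: S_sub => h _ _ _ /h. Qed.
Let X2S_H2 f : S f -> H2 (X2 * f). Proof. by move=> Sf; apply/H2_X2M/S_H2. Qed.

Lemma subspace_wandering2 : subspace (wandering2 S).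
Proof.
have [_ S0 SD SZ] := S_sub; split=> [f [/S_H2 //]||f g|a f]; rewrite !wandering2P.
- by split=> // g Sg; rewrite ip0l //; exact: X2S_H2.
- move=> [Sf f_orth] [Sg g_orth]; split=> [|h Sh]; first exact: SD.
  by rewrite ipDl ?f_orth ?g_orth ?addr0 //; by [exact: S_H2|exact: X2S_H2].
move=> [Sf f_orth]; split=> [|h Sh]; first exact: SZ.
by rewrite ipZl ?f_orth ?mulr0 //; by [exact: S_H2|exact: X2S_H2].
Qed.

Lemma wandering2_shift_orth f g k l : wandering2 S f -> wandering2 S g ->
  ip (monom 0 k * f) (monom 0 l * g) = if k == l then ip f g else 0.
Proof.
have lt_orth f' g' k' d : wandering2 S f' -> S g' ->
    ip (monom 0 k' * f') (monom 0 (k' + d.+1) * g') = 0.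
  rewrite wandering2P => -[Sf f_orth] Sg.
  have Sdg := invariant_monomM d Sg.
  have -> : monom 0 (k' + d.+1) * g' = monom 0 k' * (monom 0 d.+1 * g').
    by rewrite mulrA -monomD.
  rewrite ip_monomM; [|exact: S_H2|by rewrite monomS2M; exact: X2S_H2].
  by rewrite monomS2M f_orth.
move=> Wf Wg; have [[Sf _] [Sg _]] := (Wf, Wg).
case: (ltngtP k l) => [lt_kl|lt_lk|->]; last by rewrite ip_monomM //; exact: S_H2.
  by rewrite -(subnKC (ltnW lt_kl)) -(prednK (n := l - k)) ?subn_gt0 // lt_orth.
have [f_H2 g_H2] := (H2_monomM 0 k (S_H2 Sf), H2_monomM 0 l (S_H2 Sg)).
rewrite ipC // -(subnKC (ltnW lt_lk)) -(prednK (n := k - l)) ?subn_gt0 // lt_orth //.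
exact: conjC0.
Qed.

Lemma wandering2_free d (e : 'I_d -> fps2) (v : 'I_d -> {poly C}) :
  orthonormal_in (wandering2 S) e ->
  \sum_k (map_poly polyC (v k))%:S2 * e k = 0 -> forall k, v k = 0.
Proof.
move=> [We e_on] ve0 k0; apply/polyP => j0; rewrite coef0.
have e_H2 k : H2 (e k) by case: (We k) => /S_H2.
have Xe_H2 := H2_monomM 0 j0 (e_H2 k0).
have coef_ip k : ip ((map_poly polyC (v k))%:S2 * e k) (monom 0 j0 * e k0) =
    if k == k0 then (v k)`_j0 else 0.
  rewrite fps2_polyz2 mulr_suml ip_suml // => [|j _]; last first.
    by rewrite -mulrA; apply/H2Z/H2_monomM.
  under eq_bigr => j _.
    rewrite -mulrA ipZl ?wandering2_shift_orth ?e_on //; last exact: H2_monomM.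
    over.
  case: eqP => [->|_]; last by rewrite big1 // => j _; rewrite if_same mulr0.
  case: (ltnP j0 (size (v k0))) => [lt_j0|le_j0]; last first.
    rewrite nth_default // big1 // => j _.
    by rewrite ifN ?mulr0 // ltn_eqF // (leq_trans (ltn_ord j)).
  rewrite (bigD1 (Ordinal lt_j0)) //= eqxx mulr1 big1 ?addr0 // => j.
  by rewrite -val_eqE /= => /negPf ->; rewrite mulr0.
have := ip0l Xe_H2; rewrite -ve0 ip_suml // => [|k _]; last exact: H2_polyM.
by rewrite (bigD1 k0) //= coef_ip eqxx big1 ?addr0 // => k /negPf kk0; rewrite coef_ip kk0.
Qed.

Lemma wandering2_orthonormal_le d (e : 'I_d -> fps2) q (c : fps2) m n :
  q%:S2 * c = 1 ->
  (forall f, wandering2 S f -> forall i j, ((m <= i) || (n < j))%N -> (q%:S2 * f) i j = 0) ->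
  orthonormal_in (wandering2 S) e -> (d <= m)%N.
Proof.
move=> qc q_deg [We e_on]; rewrite leqNgt; apply/negP => lt_md.
pose e' (k : 'I_m.+1) := e (widen_ord lt_md k).
have e'_on : orthonormal_in (wandering2 S) e'.
  by split=> [k|k l]; [exact: We|rewrite e_on -val_eqE].
have [|v [v0 ve0]] := @polyz2_dependent m n (fun k => q%:S2 * e' k).
  by move=> k; apply: q_deg; exact: We.
case/eqP: v0; apply/rowP => k; rewrite mxE; apply: (wandering2_free e'_on).
rewrite -[LHS]mul1r -qc mulrAC [X in X * _](_ : _ = 0) ?mul0r //.
by rewrite -[RHS]ve0 mulr_sumr; apply: eq_bigr => l _; rewrite mulrCA.
Qed.

Lemma wandering2_kernel w1 w2 K : inD w1 -> inD w2 -> reproduces S w1 w2 K ->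
  reproduces (wandering2 S) w1 w2 (K - fps2C w2^* * (X2 * K)).
Proof.
move=> w1D w2D [SK K_repr]; have [_ _ _ SZ] := S_sub.
have [K_H2 XK_H2] := (S_H2 SK, X2S_H2 SK); have cXK_H2 := H2Z w2^* XK_H2.
split=> [|f]; rewrite wandering2P.
  split=> [|g Sg]; first by apply: subspaceB => //; exact/SZ/S_inv.
  have [g_H2 Xg_H2] := (S_H2 Sg, X2S_H2 Sg).
  rewrite ipBl // ipZl // ip_X2M // (ipC Xg_H2) // (ipC g_H2) // !K_repr //; last exact: S_inv.
  by rewrite ev_X2M // rmorphM subrr.
move=> [Sf f_orth]; have f_H2 := S_H2 Sf.
by rewrite ipBr // ipZr // f_orth // mulr0 subr0 K_repr.
Qed.

Lemma ev_wandering2_kernel w2 K z1 z2 : S K -> inD z1 -> inD z2 ->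
  ev (K - fps2C w2^* * (X2 * K)) z1 z2 = (1 - z2 * w2^* ) * ev K z1 z2.
Proof.
move=> SK z1D z2D; have [K_H2 XK_H2] := (S_H2 SK, X2S_H2 SK).
by rewrite evB ?evZ ?ev_X2M //; [ring|exact: H2Z].
Qed.

End WanderingSubspace.

Lemma wandering1_swap (S : set fps2) f :
  wandering1 S f <-> wandering2 (@swap C @^-1` S) (swap f).
Proof.
split=> -[Sf f_orth]; split=> // g Sg; have := f_orth (swap g) Sg.
  by rewrite -!ipE shift2E shift1E swapX1M -[f in ip f _]swapK ip_swap.
by rewrite -!ipE shift2E shift1E swapX1M -[f in _ -> ip f _ = _]swapK ip_swap.
Qed.

End Wandering.

(** * The model space and the Agler decomposition *)

Section ModelSpace.
Variable R : realType.
Local Notation C := (R[i]).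
Local Notation fps2 := (fps (fps C)).
Implicit Types (f g h K : fps2).
Variables (m n : nat) (p : {poly {poly C}}).
Hypothesis p_inner : rational_inner m n p.
Let bd : bideg_le m n p. Proof. by case: p_inner. Qed.
Let p_nz : no_zeros_D2 p. Proof. by case: p_inner. Qed.

Section InverseChosen.
Variable c : fps2.
Hypothesis pc : p%:S2 * c = 1.
Local Notation theta := (theta m n p c).
Let theta_H2 f : H2 f -> H2 (theta * f). Proof. by case/(theta_contraction p_inner pc). Qed.

Lemma ev_theta f w1 w2 : inD w1 -> inD w2 -> H2 f ->
  ev (theta * f) w1 w2 = Theta m n p w1 w2 * ev f w1 w2.
Proof.
move=> w1D w2D f_H2; have pw0 := p_nz w1D w2D; apply: (mulfI pw0).
rewrite -ev_polyM; [|done|done|exact: theta_H2].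
by rewrite mulrA poly_theta // ev_polyM // /Theta mulrA mulrCA divff ?mulr1.
Qed.

Lemma theta_factor g h : H2 g -> H2 h ->
  (forall z1 z2, inD z1 -> inD z2 -> ev g z1 z2 = Theta m n p z1 z2 * ev h z1 z2) ->
  g = theta * h.
Proof.
move=> g_H2 h_H2 gE; apply: (ev_inj g_H2 (theta_H2 h_H2)) => z1 z2 z1D z2D.
by rewrite gE ?ev_theta.
Qed.

Lemma KThetaP f : KTheta m n p f <-> H2 f /\ forall h, H2 h -> ip f (theta * h) = 0.
Proof.
split=> -[f_H2 f_orth]; split=> //.
  move=> h h_H2; rewrite ipE; apply: f_orth (h_H2) _; first exact: theta_H2.
  by move=> z1 z2 z1D z2D; rewrite -!evE ev_theta.
move=> g h g_H2 h_H2 gE.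
by rewrite -ipE (theta_factor (g := g) (h := h)) ?f_orth // => z1 z2 z1D z2D; rewrite !evE gE.
Qed.

Lemma KTheta_coef_eq0 f i j : KTheta m n p f -> (m <= i)%N -> (n <= j)%N ->
  (p%:S2 * f) i j = 0.
Proof.
rewrite KThetaP => -[f_H2 f_orth] le_mi le_nj; pose X : fps2 := monom (i - m) (j - n).
have X_H2 : H2 X := H2_monom _ _ _.
have : ip f ((prefl m n p)%:S2 * X) = 0.
  by rewrite -(poly_theta _ _ pc) [p%:S2 * _]mulrC -mulrA; apply/f_orth/H2_polyM.
rewrite ipC ?ip_preflMl //; last exact: H2_polyM.
by rewrite -monomD !subnKC // ip_monoml ?conjCK //; exact: H2_polyM.
Qed.

Lemma KTheta_bshift2 f : KTheta m n p f -> KTheta m n p (bshift2 f).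
Proof.
rewrite !KThetaP => -[f_H2 f_orth]; split=> [|h h_H2]; first exact: H2_bshift2.
rewrite -ip_bshift2 //; last exact: theta_H2.
by rewrite mulrCA; apply/f_orth/H2_X2M.
Qed.

Lemma KTheta_kernel w1 w2 : inD w1 -> inD w2 -> reproduces (KTheta m n p) w1 w2
  (szego w1 w2 - fps2C (Theta m n p w1 w2)^* * (theta * szego w1 w2)).
Proof.
move=> w1D w2D; have s_H2 := H2_szego w1D w2D; have ts_H2 := theta_H2 s_H2.
have cts_H2 := H2Z (Theta m n p w1 w2)^* ts_H2.
split=> [|f]; rewrite KThetaP.
  split=> [|h h_H2]; first exact: H2B.
  rewrite ipBl ?ipZl ?(theta_isometry p_inner pc) //; try exact: theta_H2.
  rewrite (ipC (theta_H2 h_H2) s_H2) (ipC h_H2 s_H2) -!ev_ip ev_theta //.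
  by rewrite rmorphM subrr.
by move=> [f_H2 f_orth]; rewrite ipBr // ipZr // f_orth // mulr0 subr0 ev_ip.
Qed.

Lemma ev_KTheta_kernel w1 w2 z1 z2 : inD w1 -> inD w2 -> inD z1 -> inD z2 ->
  (1 - z1 * w1^* ) * (1 - z2 * w2^* ) *
    ev (szego w1 w2 - fps2C (Theta m n p w1 w2)^* * (theta * szego w1 w2)) z1 z2 =
  1 - Theta m n p z1 z2 * (Theta m n p w1 w2)^*.
Proof.
move=> w1D w2D z1D z2D; have s_H2 := H2_szego w1D w2D; have ts_H2 := theta_H2 s_H2.
rewrite evB ?evZ ?ev_theta //; last exact: H2Z.
rewrite -[RHS]mulr1 -[X in _ = _ * X](ev_szego w1D w2D z1D z2D); ring.
Qed.

End InverseChosen.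
End ModelSpace.

Definition shift_decomposition (R : realType) (m n : nat) (p : {poly {poly R[i]}})
    (S1 S2 : set (fps (fps R[i]))) :=
  [/\ subspace S1 /\ subspace S2, (forall f, S1 f -> S1 (X1 * f)),
      (forall f, S2 f -> S2 (X2 * f)) & orth_decomp (KTheta m n p) S1 S2].

Definition numer (R : realType) (m n : nat) (p : {poly {poly R[i]}}) (f : fps (fps R[i])) :
  {poly {poly R[i]}} := bipoly m n (p%:S2 * f).

Section ShiftDecomposition.
Variable R : realType.
Local Notation C := (R[i]).
Local Notation fps2 := (fps (fps C)).
Implicit Types (f g h K : fps2).
Variables (m n : nat) (p : {poly {poly C}}) (S1 S2 : set fps2).
Hypothesis p_inner : rational_inner m n p.
Hypothesis dec : shift_decomposition m n p S1 S2.
Let bd : bideg_le m n p. Proof. by case: p_inner. Qed.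
Let p_nz : no_zeros_D2 p. Proof. by case: p_inner. Qed.
Let S1_sub : subspace S1. Proof. by case: dec => -[]. Qed.
Let S2_sub : subspace S2. Proof. by case: dec => -[]. Qed.
Let S1_inv f : S1 f -> S1 (X1 * f). Proof. by case: dec => _ inv _ _; exact: inv. Qed.
Let S2_inv f : S2 f -> S2 (X2 * f). Proof. by case: dec => _ _ inv _; exact: inv. Qed.
Let S1_H2 f : S1 f -> H2 f. Proof. by case: S1_sub => h _ _ _; exact: h. Qed.
Let S2_H2 f : S2 f -> H2 f. Proof. by case: S2_sub => h _ _ _; exact: h. Qed.
Let S1_K f : S1 f -> KTheta m n p f. Proof. by case: dec => _ _ _ [h _ _ _]; exact: h. Qed.
Let S2_K f : S2 f -> KTheta m n p f. Proof. by case: dec => _ _ _ [_ h _ _]; exact: h. Qed.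
Let S12_orth f g : S1 f -> S2 g -> ip f g = 0.
Proof. by rewrite ipE; case: dec => _ _ _ [_ _ h _]; exact: h. Qed.

Lemma KTheta_decomp f : KTheta m n p f -> exists u v, [/\ S1 u, S2 v & f = u + v].
Proof. by case: dec => _ _ _ [_ _ _ h] /h[u [v [? ? ->]]]; exists u, v. Qed.

Lemma S2_coef_eq0 f i j : S2 f -> (m <= i)%N -> (p%:S2 * f) i j = 0.
Proof.
move=> S2f le_mi; have [c pc] := fps2_poly_inverse p_nz.
have := KTheta_coef_eq0 p_inner pc (S2_K (invariant_monomM S2_inv n S2f)) le_mi (leq_addl j n).
by rewrite mulrCA monomM leq_addl addnK subn0.
Qed.

Lemma S1_coef_eq0 f i j : S1 f -> (n <= j)%N -> (p%:S2 * f) i j = 0.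
Proof.
move=> S1f le_nj; have [c pc] := fps2_poly_inverse p_nz.
have S1_monom : S1 (monom m 0 * f).
  by elim: (m) => [|k IH]; [rewrite monom0M|rewrite monomS1M; exact: S1_inv].
have := KTheta_coef_eq0 p_inner pc (S1_K S1_monom) (leq_addl i m) le_nj.
by rewrite mulrCA monomM leq_addl addnK subn0.
Qed.

Lemma wandering2_bshift2 f : wandering2 S2 f -> S1 (bshift2 f).
Proof.
rewrite wandering2P => -[S2f f_orth]; have [c pc] := fps2_poly_inverse p_nz.
have [u [v [S1u S2v fE]]] := KTheta_decomp (KTheta_bshift2 p_inner pc (S2_K S2f)).
have [u_H2 v_H2 f_H2] : [/\ H2 u, H2 v & H2 f] by split; [exact: S1_H2|exact: S2_H2..].
suff v0 : v = 0 by rewrite fE v0 addr0.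
apply: ip_eq0 => //; have := f_orth _ S2v.
by rewrite ip_bshift2 // fE ipDl // S12_orth // add0r.
Qed.

Lemma polyM_restr2_0_eq0 f i j : (n < j)%N -> (p%:S2 * restr2_0 f) i j = 0.
Proof.
move=> lt_nj; rewrite fps2M big1 // => a _; rewrite big1 // => b _.
have [lt_nb|le_bn] := ltnP n b; first by rewrite [p%:S2 a b](pcoef_bideg bd) ?mul0r ?lt_nb ?orbT.
by rewrite /restr2_0 -(prednK (n := j - b)) ?mulr0 // subn_gt0 (leq_ltn_trans le_bn).
Qed.

Lemma wandering2_coef_eq0 f i j : wandering2 S2 f -> ((m <= i) || (n < j))%N ->
  (p%:S2 * f) i j = 0.
Proof.
move=> Wf /orP[le_mi|lt_nj]; first by apply: S2_coef_eq0 => //; case: Wf.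
rewrite (fps2_split f) mulrDr fps2D polyM_restr2_0_eq0 // add0r mulrCA X2M.
by case: j lt_nj => // j lt_nj; apply: S1_coef_eq0 => //; exact: wandering2_bshift2.
Qed.

Lemma wandering2_basis_exists :
  exists d (e : 'I_d -> fps2), (d <= m)%N /\ orthonormal_basis (wandering2 S2) e.
Proof.
apply: orthonormal_basis_exists; first exact: subspace_wandering2.
move=> d e; have [c pc] := fps2_poly_inverse p_nz.
apply: (wandering2_orthonormal_le S2_sub S2_inv (n := n) pc) => f Wf i j.
exact: wandering2_coef_eq0.
Qed.

Lemma numerE f : wandering2 S2 f -> (numer m n p f)%:S2 = p%:S2 * f.
Proof.
move=> Wf; apply: fps2_ext => i j; rewrite [LHS]pcoef_bipoly; case: ifPn => //.
rewrite negb_and -!ltnNge => out; rewrite wandering2_coef_eq0 //.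
by case/orP: out => [/ltnW->|->]; rewrite ?orbT.
Qed.

Lemma peval_numer f z1 z2 : wandering2 S2 f -> inD z1 -> inD z2 ->
  peval (numer m n p f) z1 z2 = peval p z1 z2 * ev f z1 z2.
Proof.
move=> Wf z1D z2D; rewrite -ev_poly // numerE // ev_polyM //.
by case: Wf => /S2_H2.
Qed.

Lemma reproduces_decomp w1 w2 K : reproduces (KTheta m n p) w1 w2 K ->
  exists u v, [/\ reproduces S1 w1 w2 u, reproduces S2 w1 w2 v & K = u + v].
Proof.
move=> [K_mem K_repr]; have [u [v [S1u S2v KE]]] := KTheta_decomp K_mem.
have [u_H2 v_H2] := (S1_H2 S1u, S2_H2 S2v).
exists u, v; split=> //; split=> // f Sf.
  have f_H2 := S1_H2 Sf; rewrite -K_repr ?KE ?ipDr //; last exact: S1_K.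
  by rewrite (S12_orth Sf S2v) addr0.
have f_H2 := S2_H2 Sf; rewrite -K_repr ?KE ?ipDr //; last exact: S2_K.
by rewrite (ipC u_H2 f_H2) (S12_orth S1u Sf) conjC0 add0r.
Qed.

Lemma swap_invariant f : (@swap C @^-1` S1) f -> (@swap C @^-1` S1) (X2 * f).
Proof. by move=> /S1_inv; rewrite swapX1M. Qed.

Lemma wandering_kernels w1 w2 : inD w1 -> inD w2 -> exists K1 K2,
  [/\ reproduces (wandering2 (@swap C @^-1` S1)) w2 w1 K1,
      reproduces (wandering2 S2) w1 w2 K2 &
      forall z1 z2, inD z1 -> inD z2 -> 1 - Theta m n p z1 z2 * (Theta m n p w1 w2)^* =
        (1 - z1 * w1^* ) * ev K2 z1 z2 + (1 - z2 * w2^* ) * ev K1 z2 z1].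
Proof.
move=> w1D w2D; have [c pc] := fps2_poly_inverse p_nz.
have [u [v [u_repr v_repr kE]]] := reproduces_decomp (KTheta_kernel p_inner pc w1D w2D).
have [[S1u _] [S2v _]] := (u_repr, v_repr); have [u_H2 v_H2] := (S1_H2 S1u, S2_H2 S2v).
have swap_sub := subspace_swap S1_sub.
have su_repr : reproduces (@swap C @^-1` S1) w2 w1 (swap u).
  split=> // f Sf; rewrite -[f]swapK ip_swap ev_swap.
  by case: u_repr => _; apply.
exists (swap u - fps2C w1^* * (X2 * swap u)), (v - fps2C w2^* * (X2 * v)); split.
- exact: (wandering2_kernel swap_sub swap_invariant).
- exact: (wandering2_kernel S2_sub S2_inv).
move=> z1 z2 z1D z2D; rewrite -(ev_KTheta_kernel p_inner pc) // kE evD //.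
rewrite (ev_wandering2_kernel S2_sub) // (ev_wandering2_kernel swap_sub) // ev_swap.
ring.
Qed.

End ShiftDecomposition.

Section ExchangeOfVariables.
Variable R : realType.
Local Notation C := (R[i]).
Local Notation fps2 := (fps (fps C)).
Implicit Types (f g h : fps2) (p : {poly {poly C}}) (S : set fps2).

Lemma peval_swap p z1 z2 : peval (swapXY p) z1 z2 = peval p z2 z1.
Proof. exact: horner2_swapXY. Qed.

Lemma prefl_swap m n p : prefl n m (swapXY p) = swapXY (prefl m n p).
Proof.
apply: pcoef_ext => j i; rewrite [LHS]pcoef_bipoly {2}/pcoef coef_swapXY.
by rewrite [RHS]pcoef_bipoly andbC /pcoef coef_swapXY.
Qed.

Lemma bideg_swap m n p : bideg_le m n p -> bideg_le n m (swapXY p).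
Proof.
move=> bd; rewrite -(bipoly_pcoef bd) (_ : swapXY _ = bipoly n m (fun i j => pcoef p j i)).
  exact: bideg_bipoly.
by apply: pcoef_ext => i j; rewrite {1}/pcoef coef_swapXY pcoef_bipoly andbC -pcoef_bipoly.
Qed.

Lemma Theta_swap m n p z1 z2 : Theta n m (swapXY p) z1 z2 = Theta m n p z2 z1.
Proof. by rewrite /Theta prefl_swap !peval_swap. Qed.

Lemma rational_inner_swap m n p : rational_inner m n p -> rational_inner n m (swapXY p).
Proof.
move=> [bd p_nz p_coprime]; split; first exact: bideg_swap.
  by move=> z1 z2 z1D z2D; rewrite peval_swap p_nz.
by rewrite prefl_swap; exact: no_common_factor_swap.
Qed.

Lemma KTheta_swap m n p f : KTheta m n p f -> KTheta n m (swapXY p) (swap f).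
Proof.
move=> [f_H2 f_orth]; split=> [|g h g_H2 h_H2 gE]; first exact: H2_swap.
rewrite -ipE -[g]swapK ip_swap ipE; apply: f_orth (H2_swap g_H2) (H2_swap h_H2) _.
by move=> z1 z2 z1D z2D; rewrite -!evE (ev_swap g) (ev_swap h) !evE gE ?Theta_swap.
Qed.

Lemma shift_decomposition_swap m n p (S1 S2 : set fps2) : shift_decomposition m n p S1 S2 ->
  shift_decomposition n m (swapXY p) (@swap C @^-1` S2) (@swap C @^-1` S1).
Proof.
move=> dec; have [[S1_sub S2_sub] _ S2_inv [S1_K S2_K S12_orth K_dec]] := dec; split.
- by split; exact: subspace_swap.
- by move=> f Sf; rewrite /preimage /= swapX1M swapK; exact: S2_inv.
- by move=> f Sf; exact: (swap_invariant dec).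
split=> [f /S2_K/KTheta_swap //|f /S1_K/KTheta_swap //|f g S2f S1g|h /KTheta_swap].
  have [S1_H2 _ _ _] := S1_sub; have [S2_H2 _ _ _] := S2_sub.
  rewrite -ipE -ip_swap ipC; [|exact: S1_H2|exact: S2_H2].
  by rewrite ipE S12_orth ?conjC0.
rewrite swapXYK => /K_dec[f [g [S1f S2g hE]]]; exists (swap g), (swap f); split=> //.
by apply: fps2_ext => i j; rewrite -[h i j]/(swap h j i) hE addrC.
Qed.

End ExchangeOfVariables.

Lemma agler_decomposition (R : realType) m n (p : {poly {poly R[i]}}) (S1 S2 : set (fps (fps R[i])))
    d (e : 'I_d -> fps (fps R[i])) :
  rational_inner m n p -> shift_decomposition m n p S1 S2 ->
  orthonormal_basis (wandering2 S2) e ->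
  exists d' (r : 'I_d' -> {poly {poly R[i]}}), forall z1 z2 w1 w2,
    inD z1 -> inD z2 -> inD w1 -> inD w2 ->
    peval p z1 z2 * (peval p w1 w2)^* -
      peval (prefl m n p) z1 z2 * (peval (prefl m n p) w1 w2)^* =
    (1 - z1 * w1^* ) *
      (\sum_k peval (numer m n p (e k)) z1 z2 * (peval (numer m n p (e k)) w1 w2)^* )
    + (1 - z2 * w2^* ) * (\sum_l peval (r l) z1 z2 * (peval (r l) w1 w2)^* ).
Proof.
move=> p_inner dec e_basis; have [_ p_nz _] := p_inner.
have [p_inner' dec'] := (rational_inner_swap p_inner, shift_decomposition_swap dec).
have [d' [e' [_ e'_basis]]] := wandering2_basis_exists p_inner' dec'.
exists d', (fun l => swapXY (numer n m (swapXY p) (e' l))) => z1 z2 w1 w2 z1D z2D w1D w2D.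
have [K1 [K2 [K1_repr K2_repr kerE]]] := wandering_kernels p_inner dec w1D w2D.
have [[[S1_sub S2_sub] _ S2_inv _] [[S1'_sub S2'_sub] _ S2'_inv _]] := (dec, dec').
have We k : wandering2 S2 (e k) by case: e_basis => -[].
have We' l : wandering2 (@swap _ @^-1` S1) (e' l) by case: e'_basis => -[].
have sumE (I : finType) (F G : I -> R[i]) a b :
    \sum_k a * F k * (b * G k)^* = a * b^* * \sum_k F k * (G k)^*.
  by rewrite mulr_sumr; apply: eq_bigr => k _; rewrite rmorphM mulrACA.
under eq_bigr do rewrite !(peval_numer p_inner dec) //.
under [X in _ + _ * X]eq_bigr do rewrite !peval_swap !(peval_numer p_inner' dec') // !peval_swap.
rewrite !sumE.
rewrite -(ev_reproducing_kernel (subspace_wandering2 S2_sub) e_basis K2_repr) //.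
rewrite -(ev_reproducing_kernel (subspace_wandering2 S2'_sub) e'_basis K1_repr) //.
rewrite ![(1 - _) * (_ * _)]mulrCA -mulrDr -kerE // /Theta rmorphM /= fmorphV /=.
by field; rewrite conjC_eq0 !p_nz.
Qed.

(** * The Hardy space of the disk *)

Section HardyDisk.
Variable R : realType.
Local Notation C := (R[i]).
Local Notation fps2 := (fps (fps C)).
Implicit Types (a b h : fps C) (P : {poly C}) (x z w : C).

Definition emb a : fps2 := fun i => fpsC (a i).

Lemma embE a i j : emb a i j = if j is 0 then a i else 0. Proof. by []. Qed.

Fact emb_is_additive : zmod_morphism emb.
Proof. by move=> a b; apply/funext => i; rewrite /emb fpsB rmorphB. Qed.
HB.instance Definition _ := GRing.isZmodMorphism.Build _ _ emb emb_is_additive.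
Fact emb_is_multiplicative : monoid_morphism emb.
Proof.
split=> [|a b]; apply/funext => i.
  by rewrite /emb !fps1; case: i => [|i]; rewrite ?rmorph1 ?rmorph0.
by rewrite [RHS]fpsM /emb fpsM rmorph_sum; apply: eq_bigr => j _; rewrite rmorphM.
Qed.
HB.instance Definition _ := GRing.isMonoidMorphism.Build _ _ emb emb_is_multiplicative.

Lemma emb_inj : injective emb.
Proof. by move=> a b eq_ab; apply/funext => i; have := congr1 (fun F : fps2 => F i 0%N) eq_ab. Qed.
Lemma embC x : emb (fpsC x) = fps2C x.
Proof. by apply/funext => -[|i]; rewrite /emb /fps2C //= rmorph0. Qed.
Lemma emb_poly P : emb P%:S = (P%:P)%:S2.
Proof. by apply: fps2_ext => i [|j]; rewrite embE fps2_polyE coefC ?coef0. Qed.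
Lemma emb_Xn k : emb (fpsX C ^+ k) = monom k 0.
Proof. by rewrite -fps_polyX -rmorphXn emb_poly -fps2_poly_monom expr0 mulr1. Qed.

(* The disk is embedded in the bidisk as the first coordinate axis. *)
Definition uH2 a : Prop := H2 (emb a).
Definition uip a b : C := ip (emb a) (emb b).
Definition uev a z : C := ev (emb a) z 0.

Lemma uH2P a : uH2 a <-> H2_1 a.
Proof.
have sumE N : sqnormN N (emb a) = \sum_(i < N) sqmod (a i).
  case: N => [|N]; rewrite /sqnormN; first by rewrite !big_ord0.
  by apply: eq_bigr => i _; rewrite big_ord_recl big1 ?addr0 // => j _; exact: sqmod0.
split=> -[M le_M]; exists M => N; first by rewrite -sumE; exact: le_M.
by have := le_M N; rewrite -sumE.
Qed.

Lemma uipE a b : uip a b = ip1 a b.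
Proof.
rewrite /uip ipE; congr (clim _); apply/funext => -[|N]; first by rewrite !big_ord0.
apply: eq_bigr => i _; rewrite big_ord_recl /= [X in _ + X]big1 ?addr0 // => j _.
by rewrite mul0r.
Qed.

Lemma uevE a z : uev a z = eval1 a z.
Proof.
rewrite /uev evE; congr (clim _); apply/funext => -[|N]; first by rewrite !big_ord0.
apply: eq_bigr => i _; rewrite big_ord_recl /= mulr1 [X in _ + X]big1 ?addr0 // => j _.
by rewrite !mul0r.
Qed.

Lemma uH2Z x a : uH2 a -> uH2 (fpsC x * a).
Proof. by move=> a_H2; rewrite /uH2 rmorphM /= embC; exact: H2Z. Qed.
Lemma uH2B a b : uH2 a -> uH2 b -> uH2 (a - b).
Proof. by move=> a_H2 b_H2; rewrite /uH2 rmorphB; exact: H2B. Qed.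
Lemma uH2_sum (I : Type) (s : seq I) (Pr : pred I) (F : I -> fps C) :
  (forall i, Pr i -> uH2 (F i)) -> uH2 (\sum_(i <- s | Pr i) F i).
Proof. by move=> F_H2; rewrite /uH2 rmorph_sum; exact: H2_sum. Qed.
Lemma uH2_polyM P a : uH2 a -> uH2 (P%:S * a).
Proof. by move=> a_H2; rewrite /uH2 rmorphM /= emb_poly; exact: H2_polyM. Qed.
Lemma uH2_poly P : uH2 P%:S.
Proof. by rewrite /uH2 emb_poly; exact: H2_poly. Qed.

Lemma uevB a b z : inD z -> uH2 a -> uH2 b -> uev (a - b) z = uev a z - uev b z.
Proof. by move=> zD a_H2 b_H2; rewrite /uev rmorphB evB ?inD0. Qed.
Lemma uevZ x a z : inD z -> uH2 a -> uev (fpsC x * a) z = x * uev a z.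
Proof. by move=> zD a_H2; rewrite /uev rmorphM /= embC evZ ?inD0. Qed.
Lemma uev_sum (I : Type) (s : seq I) (Pr : pred I) (F : I -> fps C) z :
  inD z -> (forall i, Pr i -> uH2 (F i)) ->
  uev (\sum_(i <- s | Pr i) F i) z = \sum_(i <- s | Pr i) uev (F i) z.
Proof. by move=> zD F_H2; rewrite /uev rmorph_sum ev_sum ?inD0. Qed.
Lemma uev_polyM P a z : inD z -> uH2 a -> uev (P%:S * a) z = P.[z] * uev a z.
Proof.
by move=> zD a_H2; rewrite /uev rmorphM /= emb_poly ev_polyM ?inD0 // /peval hornerC.
Qed.
Lemma uev_poly P z : inD z -> uev P%:S z = P.[z].
Proof. by move=> zD; rewrite /uev emb_poly ev_poly ?inD0 // /peval hornerC. Qed.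
Lemma uev_inj a b : uH2 a -> uH2 b -> (forall z, inD z -> uev a z = uev b z) -> a = b.
Proof.
move=> a_H2 b_H2 eq_ev; apply/emb_inj/ev_inj => // z w zD _.
have ev_axis (f : fps C) : ev (emb f) z w = uev f z.
  by rewrite /uev (_ : emb f = restr2_0 (emb f)) ?(ev_restr2_0 _ _ w 0) //; apply: fps2_ext => i [].
by rewrite !ev_axis eq_ev.
Qed.

Lemma uipZl x a b : uH2 a -> uH2 b -> uip (fpsC x * a) b = x * uip a b.
Proof. by move=> a_H2 b_H2; rewrite /uip rmorphM /= embC ipZl. Qed.
Lemma uipZr x a b : uH2 a -> uH2 b -> uip a (fpsC x * b) = x^* * uip a b.
Proof. by move=> a_H2 b_H2; rewrite /uip rmorphM /= embC ipZr. Qed.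
Lemma uipBr a b h : uH2 a -> uH2 b -> uH2 h -> uip h (a - b) = uip h a - uip h b.
Proof. by move=> a_H2 b_H2 h_H2; rewrite /uip rmorphB ipBr. Qed.
Lemma uip_suml (I : Type) (s : seq I) (Pr : pred I) (F : I -> fps C) a :
  (forall i, Pr i -> uH2 (F i)) -> uH2 a ->
  uip (\sum_(i <- s | Pr i) F i) a = \sum_(i <- s | Pr i) uip (F i) a.
Proof. by move=> F_H2 a_H2; rewrite /uip rmorph_sum ip_suml. Qed.
Lemma uip_sumr (I : Type) (s : seq I) (Pr : pred I) (F : I -> fps C) a :
  (forall i, Pr i -> uH2 (F i)) -> uH2 a ->
  uip a (\sum_(i <- s | Pr i) F i) = \sum_(i <- s | Pr i) uip a (F i).
Proof. by move=> F_H2 a_H2; rewrite /uip rmorph_sum ip_sumr. Qed.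

Definition uszego w : fps C := fun i => (w ^+ i)^*.
Lemma emb_uszego w : emb (uszego w) = szego w 0.
Proof.
by apply: fps2_ext => i [|j]; rewrite embE /szego /uszego ?expr0 ?mulr1 // expr0n mulr0 conjC0.
Qed.
Lemma uH2_uszego w : inD w -> uH2 (uszego w).
Proof. by move=> wD; rewrite /uH2 emb_uszego; apply: H2_szego; rewrite ?inD0. Qed.
Lemma uip_uszego a w : uip a (uszego w) = uev a w.
Proof. by rewrite /uip emb_uszego -ev_ip. Qed.
Lemma uev_uszego w z : inD w -> inD z -> (1 - z * w^* ) * uev (uszego w) z = 1.
Proof.
move=> wD zD; have := ev_szego wD (inD0 R) zD (inD0 R).
by rewrite /uev emb_uszego mul0r subr0 mulr1.
Qed.

Lemma uH2_div P a : P != 0 -> (forall z, P.[z] = 0 -> 1 < normc z) -> uH2 (P%:S * a) -> uH2 a.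
Proof.
move=> P0 Pz; have [rs [PE Prs]] := closed_field_roots P.
have c0 : lead_coef P != 0 by rewrite lead_coef_eq0.
have rs1 : {in rs, forall r, 1 < normc r} by move=> r /Prs/Pz.
move: (lead_coef P) c0 PE => c c0 PE; set Q := \prod_(r <- rs) _ in PE.
have D0 : 0 < (\prod_(r <- rs) (normc r - 1)) ^+ 2.
  by rewrite exprn_gt0 // big_seq prodr_gt0 // => r /rs1; rewrite subr_gt0.
rewrite PE -mul_polyC rmorphM /= fps_polyC -mulrA => /(uH2Z c^-1).
rewrite mulrA -rmorphM mulVf // rmorph1 mul1r => /uH2P[M le_M].
apply/uH2P; exists (M / (\prod_(r <- rs) (normc r - 1)) ^+ 2) => N.
by rewrite ler_pdivlMr // mulrC (le_trans (prod_XsubC_lower_bound _ _ rs1)).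
Qed.

End HardyDisk.

(** * Zero-free polynomials and Blaschke products *)

Section ZeroFree.
Variable R : realType.
Local Notation C := (R[i]).
Implicit Types (P : {poly C}) (a z w : C).

Lemma zero_free_lower_bound P m z w : (size P <= m.+1)%N ->
  (forall x, inD x -> P.[x] != 0) -> inD z -> normc w <= 1 ->
  ((1 - normc z) / 2) ^+ m * normc P.[w] <= normc P.[z].
Proof.
move=> szP Pnz zD w1; have [rs [PE Prs]] := closed_field_roots P.
have rs1 a : a \in rs -> 1 <= normc a.
  by move=> /Prs Pa; rewrite leNgt -inDE; apply/negP => /Pnz; rewrite Pa eqxx.
have szrs : (size rs <= m)%N.
  have c0 : lead_coef P != 0.
    by rewrite lead_coef_eq0; apply: contraTneq (Pnz z zD) => ->; rewrite horner0 eqxx.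
  by move: szP; rewrite PE size_scale // size_prod_XsubC ltnS.
set t := (1 - normc z) / 2.
have [z0 z1] : 0 <= normc z /\ normc z < 1 by rewrite normc_ge0 -inDE.
have [t0 t1] : 0 <= t /\ t <= 1 by rewrite /t; split; lra.
have normE x : normc P.[x] = normc (lead_coef P) * \prod_(a <- rs) normc (x - a).
  rewrite {1}PE hornerZ Normc.normcM horner_prod normc_prod; congr (_ * _).
  by apply: eq_bigr => a _; rewrite hornerXsubC.
rewrite !normE mulrCA; apply: ler_wpM2l; first exact: normc_ge0.
apply: le_trans (_ : t ^+ size rs * \prod_(a <- rs) normc (w - a) <= _).
  by rewrite ler_wpM2r ?ler_wiXn2l // prodr_ge0 // => a _; exact: normc_ge0.
rewrite -[t ^+ _]iter_mulr_1 -count_predT -big_const_seq -big_split /= !big_seq.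
apply: ler_prod => a /rs1 a1; rewrite mulr_ge0 ?normc_ge0 //=.
have za := normcB_ge a z; have wa := le_normcD w (- a); rewrite normcN in wa.
rewrite -[normc (z - a)]normcN opprB; apply: le_trans za.
apply: le_trans (_ : t * (1 + normc a) <= _); last by rewrite /t; nra.
by rewrite ler_wpM2l // (le_trans wa) // lerD2r.
Qed.

Lemma hurwitz (T : topologicalType) (F : set_system T) {FF : ProperFilter F}
    (Q : T -> {poly C}) P m w :
  (\forall t \near F, (size (Q t) <= m.+1)%N /\ forall z, inD z -> (Q t).[z] != 0) ->
  (forall z, ccvg F (fun t => (Q t).[z]) P.[z]) -> normc w <= 1 -> P.[w] != 0 ->
  forall z, inD z -> P.[z] != 0.
Proof.
move=> Qnz QP w1 Pw z zD; pose k := ((1 - normc z) / 2) ^+ m.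
have k0 : 0 < k by rewrite exprn_gt0 // divr_gt0 // subr_gt0 -inDE.
have lim_w : k ^+ 2 * sqmod (Q t).[w] @[t --> F] --> k ^+ 2 * sqmod P.[w].
  by apply: cvgM; [exact: cvg_cst|exact: cvg_sqmod].
have lim_z : sqmod (Q t).[z] @[t --> F] --> sqmod P.[z] by exact: cvg_sqmod.
rewrite -sqmod_eq0 gt_eqF //; apply: lt_le_trans (_ : k ^+ 2 * sqmod P.[w] <= _).
  apply: mulr_gt0; first exact: exprn_gt0.
  by rewrite sqmodE exprn_gt0 // normc_gt0.
apply: ler_cvg_to lim_w lim_z _; near=> t.
have [szQ Qtnz] : (size (Q t) <= m.+1)%N /\ forall z, inD z -> (Q t).[z] != 0 by near: t.
rewrite !sqmodE -exprMn ler_sqr ?nnegrE ?mulr_ge0 ?normc_ge0 ?(ltW k0) //.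
exact: zero_free_lower_bound.
Unshelve. all: by end_near. Qed.

End ZeroFree.

Section FiniteBlaschke.
Variable R : realType.
Local Notation C := (R[i]).
Implicit Types (P : {poly C}) (a c z : C) (B : C -> C).

Lemma blaschke_ext B B' d : (forall z, inD z -> B z = B' z) -> blaschke B d -> blaschke B' d.
Proof. by move=> BB' [c [a [c1 aD BE]]]; exists c, a; split=> // z zD; rewrite -BB' ?BE. Qed.

Lemma blaschke_const c : normc c = 1 -> blaschke (fun=> c) 0.
Proof.
move=> c1; exists c, (fun=> 0); split=> [|[] //|z _]; last by rewrite big_ord0 mulr1.
by apply/eqP; rewrite -[_ == 1]/(onT c) onTE c1.
Qed.

Lemma blaschke_factor a : inD a -> blaschke (fun z => (z - a) / (1 - a^* * z)) 1.
Proof.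
by move=> aD; exists 1, (fun=> a); split=> [|//|z _]; rewrite ?normr1 // big_ord1 mul1r.
Qed.

Lemma blaschkeM B B' d d' : blaschke B d -> blaschke B' d' ->
  blaschke (fun z => B z * B' z) (d + d').
Proof.
move=> [c [a [c1 aD BE]]] [c' [a' [c'1 a'D B'E]]].
exists (c * c'), (fun k => match fintype.split k with inl i => a i | inr j => a' j end).
split=> [|k|z zD]; first by rewrite normrM c1 c'1 mulr1.
  by case: (fintype.split k).
rewrite BE // B'E // mulrACA big_split_ord; congr (_ * (_ * _)).
  by apply: eq_bigr => i _; rewrite (unsplitK (inl i)).
by apply: eq_bigr => i _; rewrite (unsplitK (inr i)).
Qed.

Lemma blaschke_outer_factor a : 1 < normc a -> blaschke (fun z => (1 - a^* * z) / (z - a)) 1.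
Proof.
move=> a1; have a0 : a != 0 by rewrite -normc_gt0 (lt_trans _ a1).
have aJ0 : a^* != 0 by rewrite conjC_eq0.
have aVD : inD (a^*)^-1 by rewrite inDE Normc.normcV normc_conj invf_lt1 // (lt_trans _ a1).
have unim : normc (a^* / a) = 1.
  by rewrite Normc.normcM Normc.normcV normc_conj mulfV // normc_eq0.
apply: blaschke_ext (blaschkeM (blaschke_const unim) (blaschke_factor aVD)) => z.
rewrite inDE fmorphV /= conjCK => zD.
have za : z - a != 0.
  by rewrite subr_eq0; apply: contraTneq zD => ->; rewrite -leNgt ltW.
by field; rewrite aJ0 za a0 andbT -oppr_eq0 opprB.
Qed.

Definition uprefl m P : {poly C} := \poly_(i < m.+1) (P`_(m - i))^*.

Lemma upreflZ m c P : uprefl m (c *: P) = c^* *: uprefl m P.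
Proof.
by apply/polyP => i; rewrite coefZ !coef_poly; case: ifP; rewrite ?mulr0 // coefZ rmorphM.
Qed.

Lemma uprefl_XsubC m a P : (size P <= m.+1)%N ->
  uprefl m.+1 (('X - a%:P) * P) = (1 - a^* *: 'X) * uprefl m P.
Proof.
move=> szP; apply/polyP => i.
rewrite [in RHS]mulrBl mul1r -scalerAl coefB coefZ coefXM !coef_poly.
rewrite mulrBl coefB coefXM coefCM; case: i => [|i] /=.
  by rewrite !subn0 (nth_default _ szP) !mulr0 !subr0.
rewrite !ltnS subSS subnS; case: (ltngtP i m) => [lt_im|_|->].
- by rewrite ifN -?lt0n ?subn_gt0 // rmorphB rmorphM.
- by rewrite mulr0 subr0.
by rewrite subnn rmorphB rmorph0 rmorphM.
Qed.

Lemma uprefl_X m P : (size P <= m.+1)%N -> uprefl m.+1 P = 'X * uprefl m P.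
Proof.
move=> szP; apply/polyP => -[|i]; rewrite coefXM !coef_poly //=.
by rewrite subn0 nth_default // conjC0.
Qed.

(* Each zero a contributes the factor (1 - a^* z) / (z - a), the degree defect k a power of z. *)
Lemma blaschke_prod_refl k (rs : seq C) : {in rs, forall a, 1 < normc a} ->
  blaschke (fun z => (uprefl (size rs + k) (\prod_(a <- rs) ('X - a%:P))).[z] /
    (\prod_(a <- rs) ('X - a%:P)).[z]) (size rs + k).
Proof.
elim: rs => [_|a rs IH rs1].
  rewrite big_nil add0n; elim: k => [|k IH].
    apply: blaschke_ext (blaschke_const (Normc.normc1 R)) => z _.
    by rewrite /uprefl poly_def big_ord1 coef1 conjC1 scale1r !hornerC divr1.
  rewrite -addn1; apply: blaschke_ext (blaschkeM IH (blaschke_factor (inD0 R))) => z _.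
  rewrite addn1 uprefl_X ?size_poly1 // hornerM hornerX !hornerC conjC0 mul0r !subr0 !divr1.
  exact: mulrC.
have a1 : 1 < normc a by rewrite rs1 ?mem_head.
have {}rs1 : {in rs, forall x, 1 < normc x}.
  by move=> x x_rs; rewrite rs1 // in_cons x_rs orbT.
rewrite /= addSn -addn1; apply: blaschke_ext (blaschkeM (IH rs1) (blaschke_outer_factor a1)) => z _.
rewrite addn1 !big_cons uprefl_XsubC; last by rewrite size_prod_XsubC ltnS leq_addr.
by rewrite !hornerM hornerXsubC hornerD hornerN hornerZ hornerX hornerC [LHS]mulrC mulf_div.
Qed.

Lemma blaschke_refl P m t : normc t = 1 -> (size P <= m.+1)%N ->
  (forall z, normc z <= 1 -> P.[z] != 0) ->
  blaschke (fun z => (t *: uprefl m P).[z] / P.[z]) m.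
Proof.
move=> t1 szP Pnz; have [rs [PE Prs]] := closed_field_roots P.
have rs1 : {in rs, forall a, 1 < normc a}.
  by move=> a /Prs Pa; rewrite ltNge; apply/negP => /Pnz; rewrite Pa eqxx.
have c0 : lead_coef P != 0.
  rewrite lead_coef_eq0; apply: contraTneq (Pnz 0 _) => [->|]; first by rewrite horner0 eqxx.
  by rewrite Normc.normc0.
have szrs : (size rs <= m)%N by move: szP; rewrite PE size_scale // size_prod_XsubC.
move: (lead_coef P) c0 PE => c c0 ->.
have unim : normc (t * (c^* / c)) = 1.
  by rewrite !Normc.normcM Normc.normcV normc_conj t1 mul1r mulfV // normc_eq0.
rewrite -(subnKC szrs); set k := (m - size rs)%N.
apply: blaschke_ext (blaschkeM (blaschke_const unim) (blaschke_prod_refl k rs1)) => z _.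
by rewrite upreflZ !hornerZ -[LHS]mulrA mulf_div !mulrA.
Qed.

End FiniteBlaschke.

Section BlaschkeModelSpace.
Variable R : realType.
Local Notation C := (R[i]).
Implicit Types (b h : fps C) (z w : C).
Variables (P : {poly C}) (m : nat) (t : C).
Hypotheses (szP : (size P <= m.+1)%N) (Pnz : forall z, normc z <= 1 -> P.[z] != 0) (tT : onT t).
Let Q : {poly C} := t *: uprefl m P.
Let B z : C := Q.[z] / P.[z].
Variable u : fps C.
Hypothesis Pu : P%:S * u = 1.

Let PnzD z : inD z -> P.[z] != 0.
Proof. by rewrite inDE => zD; rewrite Pnz // ltW. Qed.

Let mulPu b : P%:S * (u * b) = b. Proof. by rewrite mulrA Pu mul1r. Qed.

Lemma uH2_inverseM b : uH2 b -> uH2 (u * b).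
Proof.
move=> b_H2; apply: (@uH2_div _ P); last by rewrite mulPu.
  by apply: contraTneq (PnzD (inD0 R)) => ->; rewrite horner0 eqxx.
by move=> z Pz; rewrite ltNge; apply/negP => /Pnz; rewrite Pz eqxx.
Qed.

Lemma emb_uprefl : emb (uprefl m P)%:S = (prefl m 0 P%:P)%:S2.
Proof.
rewrite emb_poly; congr fps2_poly; apply: pcoef_ext => i j; rewrite [RHS]pcoef_bipoly.
rewrite /pcoef coefC leqn0; case: j => [|j] /=; last by rewrite andbF coef0.
by rewrite andbT coefC coef_poly ltnS.
Qed.

Lemma uip_reflMr b h : uH2 b -> uH2 h ->
  uip b (Q%:S * h) = t^* * (ip (monom m 0 * emb h) (emb (P%:S * b)))^*.
Proof.
move=> b_H2 h_H2; have bdP : bideg_le m 0 P%:P.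
  split=> [|j]; first exact: size_polyC_leq1.
  by rewrite coefC; case: eqP => // _; rewrite size_poly0.
have rh_H2 := uH2_polyM (uprefl m P) h_H2.
rewrite /Q -mul_polyC rmorphM /= fps_polyC -mulrA uipZr //; congr (_ * _).
rewrite /uip [emb (_ * h)]rmorphM /= emb_uprefl ipC //; last exact: H2_polyM.
by rewrite ip_preflMl // rmorphM /= emb_poly.
Qed.

Lemma uip_refl_eq0 b h : uH2 b -> (forall i, (m <= i)%N -> (P%:S * b) i = 0) -> uH2 h ->
  uip b (Q%:S * h) = 0.
Proof.
move=> b_H2 b_deg h_H2; rewrite uip_reflMr //.
rewrite [ip _ _]ip_disjoint ?conjC0 ?mulr0 //; [exact: H2_monomM|exact: uH2_polyM|].
move=> i j; rewrite monomM andbT; case: leqP => [le_mi|_]; last by left.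
by right; rewrite embE b_deg //; case: j.
Qed.

Lemma model_spaceP b :
  Kmodel1 B b <-> uH2 b /\ forall i, (m <= i)%N -> (P%:S * b) i = 0.
Proof.
split=> -[b_H2 b_orth]; (split; first exact/uH2P).
  move=> i le_mi; move/uH2P in b_H2; have X_H2 : uH2 (fpsX C ^+ (i - m)).
    by rewrite -fps_polyX -rmorphXn; exact: uH2_poly.
  have : uip b (Q%:S * fpsX C ^+ (i - m)) = 0.
    rewrite uipE; apply: (b_orth _ (P%:S * fpsX C ^+ (i - m))); try exact/uH2P/uH2_polyM.
    move=> z zD; rewrite -!uevE !uev_polyM // mulrA; congr (_ * _).
    by rewrite /B divfK ?PnzD.
  rewrite uip_reflMr // emb_Xn -monomD subnKC // ip_monoml; last exact: uH2_polyM.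
  rewrite conjCK embE => /eqP; rewrite mulf_eq0 conjC_eq0.
  by rewrite (negPf (onT_neq0 tT)) => /eqP.
move=> g h /uH2P g_H2 /uH2P h_H2 gE.
have -> : g = Q%:S * (u * h) :> fps C.
  apply: uev_inj => // [|z zD]; first exact/uH2_polyM/uH2_inverseM.
  apply: (mulfI (PnzD zD)); rewrite -[in RHS]uev_polyM //; last exact/uH2_polyM/uH2_inverseM.
  by rewrite mulrCA mulPu uev_polyM // uevE gE // -uevE mulrA /B [P.[z] * _]mulrC divfK ?PnzD.
by rewrite -uipE uip_refl_eq0 //; exact: uH2_inverseM.
Qed.

Lemma uev_inverseM b z : inD z -> uH2 b -> uev (u * b) z = uev b z / P.[z].
Proof.
move=> zD b_H2; apply: (mulfI (PnzD zD)).
rewrite -uev_polyM ?mulPu //; last exact: uH2_inverseM.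
by rewrite mulrCA divff ?mulr1 ?PnzD.
Qed.

Definition model_kernel w : fps C := uszego w - fpsC (B w)^* * (Q%:S * (u * uszego w)).

Lemma uH2_model_kernel w : inD w -> uH2 (model_kernel w).
Proof.
move=> wD; have s_H2 := uH2_uszego wD.
by apply: uH2B => //; exact/uH2Z/uH2_polyM/uH2_inverseM.
Qed.

Lemma uip_model_kernel b w : Kmodel1 B b -> inD w -> uip b (model_kernel w) = uev b w.
Proof.
rewrite model_spaceP => -[b_H2 b_deg] wD; have s_H2 := uH2_uszego wD.
have us_H2 := uH2_inverseM s_H2; have Qus_H2 := uH2_polyM Q us_H2.
rewrite uipBr ?uipZr //; last exact: uH2Z.
by rewrite uip_uszego uip_refl_eq0 // mulr0 subr0.
Qed.

Lemma uev_model_kernel w z : inD w -> inD z ->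
  (1 - z * w^* ) * uev (model_kernel w) z = 1 - B z * (B w)^*.
Proof.
move=> wD zD; have s_H2 := uH2_uszego wD.
have us_H2 := uH2_inverseM s_H2; have Qus_H2 := uH2_polyM Q us_H2.
rewrite uevB ?uevZ //; last exact: uH2Z.
rewrite uev_polyM // uev_inverseM // -[RHS]mulr1 -[X in _ = _ * X](uev_uszego wD zD) /B; ring.
Qed.

Section Frame.
Variables (d : nat) (g : 'I_d -> fps C).
Hypothesis g_model : forall k, Kmodel1 B (g k).
Hypothesis g_kernel : forall z w, inD z -> inD w ->
  (1 - z * w^* ) * (\sum_k uev (g k) z * (uev (g k) w)^* ) = 1 - B z * (B w)^*.

Let g_H2 k : uH2 (g k). Proof. by have /model_spaceP[] := g_model k. Qed.

Lemma model_kernel_frame w : inD w ->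
  model_kernel w = \sum_k fpsC (uev (g k) w)^* * g k.
Proof.
move=> wD; apply: uev_inj; first exact: uH2_model_kernel.
  by apply: uH2_sum => k _; exact: uH2Z.
move=> z zD; have zw0 : 1 - z * w^* != 0.
  by apply: contra_eq_neq (uev_uszego wD zD) => ->; rewrite mul0r eq_sym oner_neq0.
apply: (mulfI zw0); rewrite uev_model_kernel // -g_kernel // uev_sum // => [|k _]; last exact: uH2Z.
by congr (_ * _); apply: eq_bigr => k _; rewrite uevZ // mulrC.
Qed.

Lemma model_frame b : Kmodel1 B b -> b = \sum_k fpsC (uip b (g k)) * g k.
Proof.
move=> b_model; have /model_spaceP[b_H2 _] := b_model.
apply: uev_inj => // [|w wD]; first by apply: uH2_sum => k _; exact: uH2Z.
rewrite -(uip_model_kernel b_model wD) model_kernel_frame //.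
rewrite uip_sumr // => [|k _]; last exact: uH2Z.
rewrite uev_sum // => [|k _]; last exact: uH2Z.
by apply: eq_bigr => k _; rewrite uipZr // uevZ // conjCK mulrC.
Qed.

Let coef_mx : 'M[C]_(d, m) := \matrix_(k, i) (P%:S * g k) i.

Lemma frame_coef b i : Kmodel1 B b ->
  (P%:S * b) i = \sum_k uip b (g k) * (P%:S * g k) i.
Proof.
move=> /model_frame {1}->; rewrite mulr_sumr fps_sum; apply: eq_bigr => k _.
by rewrite mulrCA fpsCM.
Qed.

Lemma frame_left_inverse : exists X : 'M[C]_(m, d), X *m coef_mx = 1%:M.
Proof.
pose b (i : 'I_m) : fps C := u * fpsX C ^+ i.
have Xn_coef k j : (fpsX C ^+ k) j = (k == j)%:R.
  by rewrite -fps_polyX -rmorphXn /= /fps_poly coefXn eq_sym.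
have b_model i : Kmodel1 B (b i).
  apply/model_spaceP; split=> [|j le_mj].
    by apply: uH2_inverseM; rewrite -fps_polyX -rmorphXn; exact: uH2_poly.
  by rewrite mulPu Xn_coef ltn_eqF // (leq_trans (ltn_ord i)).
exists (\matrix_(i, k) uip (b i) (g k)); apply/matrixP => i j; rewrite !mxE.
rewrite -[RHS](Xn_coef i j) -(mulPu (fpsX C ^+ i)) (frame_coef j (b_model i)).
by apply: eq_bigr => k _; rewrite !mxE.
Qed.

Lemma frame_size : (m <= d)%N.
Proof.
have [X XA] := frame_left_inverse.
by have := mulmx_max_rank X coef_mx; rewrite XA mxrank1.
Qed.

(* The Gram matrix of the frame fixes the coefficient matrix, which is invertible as soon as
   it is square. *)
Lemma frame_orthonormal : d = m -> forall k l, uip (g k) (g l) = (k == l)%:R.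
Proof.
have [X XA] := frame_left_inverse; pose G : 'M[C]_d := \matrix_(k, l) uip (g k) (g l).
have GA : G *m coef_mx = coef_mx.
  apply/matrixP => k i; rewrite !mxE (frame_coef i (g_model k)).
  by apply: eq_bigr => l _; rewrite !mxE.
move=> dm k l; suff G1 : G = 1%:M by have := congr1 (fun M : 'M[C]_d => M k l) G1; rewrite !mxE.
move: (coef_mx) X GA XA; rewrite -dm => A X GA' XA'.
by rewrite -[G]mulmx1 -(mulmx1C XA') mulmxA GA'.
Qed.

End Frame.
End BlaschkeModelSpace.

(** * Slices *)

Section SlicePolynomials.
Variable R : realType.
Local Notation C := (R[i]).
Local Notation radial := ((1 : R)^'- : set_system R).
Implicit Types (p q : {poly {poly C}}) (z tau : C).

Lemma coef_slice m n q tau i : bideg_le m n q ->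
  (q.[tau%:P])`_i = \sum_(j < n.+1) pcoef q i j * tau ^+ j.
Proof.
move=> [szq _]; rewrite (horner_coef_wide _ szq) coef_sum; apply: eq_bigr => j _.
by rewrite -polyC_exp coefMC.
Qed.

Lemma size_slice m n q tau : bideg_le m n q -> (size q.[tau%:P] <= m.+1)%N.
Proof.
move=> bd; apply/leq_sizeP => i lt_mi; rewrite (coef_slice _ _ bd) big1 // => j _.
by rewrite (pcoef_bideg bd) ?lt_mi // mul0r.
Qed.

Lemma slice_prefl m n p tau : bideg_le m n p -> onT tau ->
  (prefl m n p).[tau%:P] = tau ^+ n *: uprefl m p.[tau%:P].
Proof.
move=> bd tauT; apply/polyP => i; rewrite coefZ coef_poly.
case: ltnP => [le_im|lt_mi]; last first.
  by rewrite mulr0 nth_default // (leq_trans (size_slice tau (bideg_prefl m n p))).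
rewrite (coef_slice _ _ (bideg_prefl m n p)) (coef_slice _ _ bd) rmorph_sum mulr_sumr.
rewrite (reindex_inj rev_ord_inj); apply: eq_bigr => j _ /=; have le_jn := leq_ord j.
rewrite subSS pcoef_prefl ?leq_subr // subKn // rmorphM rmorphXn /= mulrCA; congr (_ * _).
by rewrite onT_expB.
Qed.

Lemma ccvg_radial_peval q z tau :
  ccvg radial (fun r => peval q z (r%:C * tau)) (peval q z tau).
Proof.
have [m [n bd]] := bideg_exists q; rewrite (peval_sum _ _ bd).
under eq_fun do rewrite (peval_sum _ _ bd).
apply: ccvg_sum => s _; do 2!(apply: ccvgM; first exact: ccvg_cst).
apply: ccvgX; rewrite -[X in ccvg _ _ X]mul1r.
by apply: ccvgM; [exact: ccvg_radial|exact: ccvg_cst].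
Qed.

Definition singular_slice p tau := exists tau1, onT tau1 /\ peval p tau1 tau = 0.

Lemma slice_zero_free m n p tau : bideg_le m n p -> no_zeros_D2 p -> onT tau ->
  ~ singular_slice p tau -> forall z, normc z <= 1 -> p.[tau%:P].[z] != 0.
Proof.
move=> bd p_nz tauT reg z; rewrite le_eqVlt -onTE => /orP[zT|].
  by apply/eqP => Pz; apply: reg; exists z.
rewrite -inDE => zD; have oneT : onT (1 : C) by rewrite onTE Normc.normc1.
have P1 : p.[tau%:P].[1] != 0 by apply/eqP => P1; apply: reg; exists 1.
apply: (@hurwitz _ _ radial _ (fun r => p.[(r%:C * tau)%:P]) _ m 1) => //.
- near=> r; split=> [|x xD]; first exact: size_slice bd.
  by apply: p_nz => //; apply: inD_radial => //; near: r; exact: near_radial.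
- by move=> x; exact: ccvg_radial_peval.
- by rewrite Normc.normc1.
Unshelve. all: by end_near. Qed.

Lemma circle_avoids_roots (r : {poly C}) : r != 0 -> exists tau, onT tau /\ r.[tau] != 0.
Proof.
move=> r0; apply: contrapT => no_tau.
pose pt (k : nat) : C := Complex (k.+1%:R)^-1 (Num.sqrt (1 - (k.+1%:R)^-1 ^+ 2)).
have ptT k : onT (pt k).
  rewrite onTE /= sqr_sqrtr; first by rewrite addrC subrK sqrtr1.
  by rewrite subr_ge0 expr_le1 // ?invr_ge0 // invf_le1 // ler1n.
have root_pt : all (root r) (mkseq pt (size r)).
  apply/allP => z /mapP[k _ ->]; apply/negPn/negP => rk.
  by apply: no_tau; exists (pt k).
have pt_uniq : uniq (mkseq pt (size r)).
  by apply: mkseq_uniq => i j [] /invr_inj/eqP; rewrite eqr_nat eqSS => /eqP.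
by have := max_poly_roots r0 root_pt pt_uniq; rewrite size_mkseq ltnn.
Qed.

(* On the torus a zero of p is one of its reflection, hence of their Bezout combination in z2. *)
Lemma regular_slice_exists m n p : rational_inner m n p ->
  exists tau, onT tau /\ ~ singular_slice p tau.
Proof.
move=> [bd p_nz p_coprime].
have [u [v [r [r0 uvE]]]] := bezout_z2 (no_zeros_D2_neq0 p_nz) p_coprime.
have [tau [tauT r_tau]] := circle_avoids_roots r0; exists tau; split=> // -[tau1 [tau1T p0]].
have := congr1 (fun q => peval q tau1 tau) uvE.
rewrite pevalD !pevalM peval_prefl_onT // p0 conjC0 !mulr0 addr0.
by rewrite /peval (horner_map polyC) /= hornerC => /esym/eqP; rewrite (negPf r_tau).
Qed.

End SlicePolynomials.

Section RegularSlice.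
Variable R : realType.
Local Notation C := (R[i]).
Local Notation fps2 := (fps (fps C)).
Local Notation radial := ((1 : R)^'- : set_system R).
Implicit Types (f g : fps2) (b : fps C) (z w : C).
Variables (m n : nat) (p : {poly {poly C}}) (S1 S2 : set fps2).
Hypotheses (p_inner : rational_inner m n p) (dec : shift_decomposition m n p S1 S2).
Variable tau : C.
Hypotheses (tauT : onT tau) (tau_reg : ~ singular_slice p tau).
Let bd : bideg_le m n p. Proof. by case: p_inner. Qed.
Let p_nz : no_zeros_D2 p. Proof. by case: p_inner. Qed.
Let P := p.[tau%:P].
Let szP : (size P <= m.+1)%N. Proof. exact: size_slice bd. Qed.
Let Pnz z : normc z <= 1 -> P.[z] != 0. Proof. exact: slice_zero_free bd p_nz tauT tau_reg z. Qed.
Let PnzD z : inD z -> P.[z] != 0. Proof. by rewrite inDE => /ltW/Pnz. Qed.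
Let taunT : onT (tau ^+ n).
Proof. by move: tauT; rewrite !onTE normcX => /eqP ->; rewrite expr1n. Qed.
Local Notation Theta_tau := (fun z => Theta m n p z tau).

Lemma Theta_sliceE z : Theta m n p z tau = (tau ^+ n *: uprefl m P).[z] / P.[z].
Proof. by rewrite /Theta /peval slice_prefl. Qed.

Lemma slice_blaschke : blaschke Theta_tau m.
Proof. by rewrite (funext Theta_sliceE); apply: blaschke_refl => //; apply/eqP; rewrite -onTE. Qed.

Lemma slice_inverse : exists u : fps C, P%:S * u = 1.
Proof.
have P0 : P`_0 != 0 by rewrite -horner_coef0 PnzD ?inD0.
exact: fps_inv_exists (mulfV P0).
Qed.

Variable u : fps C.
Hypothesis Pu : P%:S * u = 1.

Definition restriction f : fps C := u * ((numer m n p f).[tau%:P])%:S.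

Lemma uH2_restriction f : uH2 (restriction f).
Proof. exact: (uH2_inverseM Pnz Pu (uH2_poly _)). Qed.

Lemma uev_restriction f z : inD z ->
  uev (restriction f) z = peval (numer m n p f) z tau / P.[z].
Proof. by move=> zD; rewrite (uev_inverseM Pnz Pu zD (uH2_poly _)) uev_poly. Qed.

Lemma restriction_model f : wandering2 S2 f -> Kmodel1 Theta_tau (restriction f).
Proof.
move=> Wf; rewrite (funext Theta_sliceE); apply/(model_spaceP szP Pnz taunT Pu).
split=> [|i le_mi]; first exact: uH2_restriction.
rewrite /restriction mulrA Pu mul1r /fps_poly (coef_slice _ _ (bideg_bipoly _ _ _)) big1 // => j _.
by rewrite -[pcoef _ i j]/((numer m n p f)%:S2 i j) (numerE p_inner dec Wf)
  (wandering2_coef_eq0 p_inner dec) ?le_mi // mul0r.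
Qed.

Lemma restriction_slice f : wandering2 S2 f -> slice2 tau f (restriction f).
Proof.
move=> Wf; split=> [|z zD]; first exact/uH2P/uH2_restriction.
change (ccvg radial (fun r => eval2 f z (r%:C * tau)) (eval1 (restriction f) z)).
rewrite -uevE uev_restriction //.
apply: (@ccvg_near _ _ _ _
  (fun r => peval (numer m n p f) z (r%:C * tau) / peval p z (r%:C * tau))).
  near=> r; have rD : inD (r%:C * tau) by apply: inD_radial => //; near: r; exact: near_radial.
  by rewrite (peval_numer p_inner dec) // mulrAC divff ?mul1r ?evE // p_nz.
by apply: ccvgM; [|apply: ccvgV; first exact: PnzD]; exact: ccvg_radial_peval.
Unshelve. all: by end_near. Qed.

Lemma slice2_unique f b b' : slice2 tau f b -> slice2 tau f b' -> b = b'.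
Proof.
move=> [/uH2P b_H2 b_lim] [/uH2P b'_H2 b'_lim]; apply: uev_inj => // z zD; rewrite !uevE.
exact: (ccvg_unique (b_lim z zD) (b'_lim z zD)).
Qed.

Lemma restriction_comb d (x : 'I_d -> C) (e : 'I_d -> fps2) :
  restriction (\sum_k fps2C (x k) * e k) = \sum_k fpsC (x k) * restriction (e k).
Proof.
have numer_comb : numer m n p (\sum_k fps2C (x k) * e k) =
    \sum_k (x k)%:P%:P * numer m n p (e k).
  apply: pcoef_ext => i j; rewrite pcoef_bipoly mulr_sumr fps2_sum /pcoef !coef_sum.
  under [RHS]eq_bigr do rewrite !coefCM -/(pcoef _ i j) pcoef_bipoly.
  case: ifP => _; last by rewrite big1 // => k _; rewrite mulr0.
  by apply: eq_bigr => k _; rewrite mulrCA fps2CM.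
rewrite /restriction numer_comb horner_sum rmorph_sum mulr_sumr; apply: eq_bigr => k _.
by rewrite hornerM hornerC rmorphM /= fps_polyC mulrCA.
Qed.

Section Basis.
Variables (d : nat) (e : 'I_d -> fps2).
Hypothesis e_basis : orthonormal_basis (wandering2 S2) e.
Let We k : wandering2 S2 (e k). Proof. by case: e_basis => -[]. Qed.

(* The Agler identity at z2 = w2 = r tau as r -> 1: the factor 1 - r^2 kills the second sum. *)
Lemma agler_slice z w : inD z -> inD w ->
  P.[z] * (P.[w])^* - (prefl m n p).[tau%:P].[z] * ((prefl m n p).[tau%:P].[w])^* =
  (1 - z * w^* ) *
  \sum_k peval (numer m n p (e k)) z tau * (peval (numer m n p (e k)) w tau)^*.
Proof.
move=> zD wD; have [d' [q aglerE]] := agler_decomposition p_inner dec e_basis.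
have lim_prod (g : {poly {poly C}}) : ccvg radial
    (fun r => peval g z (r%:C * tau) * (peval g w (r%:C * tau))^* )
    (peval g z tau * (peval g w tau)^* ).
  by apply: ccvgM; [|apply: ccvg_conj]; exact: ccvg_radial_peval.
have lim_tau : ccvg radial (fun r => 1 - r%:C * tau * (r%:C * tau)^* ) 0.
  rewrite -(subrr 1) -{3}(onT_mulr_conj tauT); apply: ccvgB; first exact: ccvg_cst.
  have lim_rtau : ccvg radial (fun r => r%:C * tau) tau.
    by rewrite -[X in ccvg _ _ X]mul1r; apply: ccvgM; [exact: ccvg_radial|exact: ccvg_cst].
  by apply: ccvgM => //; exact: ccvg_conj.
apply: (ccvg_unique (ccvgB (lim_prod p) (lim_prod (prefl m n p)))).
rewrite -[X in ccvg _ _ X]addr0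
  -[X in ccvg _ _ (_ + X)](mul0r (\sum_l peval (q l) z tau * (peval (q l) w tau)^* )).
apply: (@ccvg_near _ _ _ _ (fun r => (1 - z * w^* ) *
    (\sum_k peval (numer m n p (e k)) z (r%:C * tau) *
      (peval (numer m n p (e k)) w (r%:C * tau))^* )
  + (1 - r%:C * tau * (r%:C * tau)^* ) *
    (\sum_l peval (q l) z (r%:C * tau) * (peval (q l) w (r%:C * tau))^* ))).
  near=> r; have rD : inD (r%:C * tau) by apply: inD_radial => //; near: r; exact: near_radial.
  by rewrite aglerE.
apply: ccvgD; apply: ccvgM; [exact: ccvg_cst| |exact: lim_tau|];
  by apply: ccvg_sum => k _; exact: lim_prod.
Unshelve. all: by end_near. Qed.

Lemma restriction_kernel z w : inD z -> inD w ->
  (1 - z * w^* ) * (\sum_k uev (restriction (e k)) z * (uev (restriction (e k)) w)^* ) =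
  1 - Theta_tau z * (Theta_tau w)^*.
Proof.
move=> zD wD; have [Pz Pw] := (PnzD zD, PnzD wD).
transitivity ((1 - z * w^* ) * (\sum_k peval (numer m n p (e k)) z tau *
    (peval (numer m n p (e k)) w tau)^* ) / (P.[z] * (P.[w])^* )).
  rewrite -mulrA mulr_suml; congr (_ * _); apply: eq_bigr => k _.
  by rewrite !uev_restriction // rmorphM /= fmorphV invfM mulrACA.
rewrite -agler_slice // /Theta rmorphM fmorphV /= /peval -/P; field.
by rewrite conjC_eq0 Pz Pw.
Qed.

Let model k : Kmodel1 (fun z => (tau ^+ n *: uprefl m P).[z] / P.[z]) (restriction (e k)).
Proof. by rewrite -(funext Theta_sliceE); exact: restriction_model. Qed.
Let kernel z w : inD z -> inD w ->
  (1 - z * w^* ) * (\sum_k uev (restriction (e k)) z * (uev (restriction (e k)) w)^* ) =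
  1 - (tau ^+ n *: uprefl m P).[z] / P.[z] * ((tau ^+ n *: uprefl m P).[w] / P.[w])^*.
Proof. by move=> zD wD; rewrite restriction_kernel // !Theta_sliceE. Qed.

Lemma wandering2_basis_ge : (m <= d)%N.
Proof. exact: (frame_size szP Pnz taunT Pu model kernel). Qed.

Lemma slice_unitary : d = m ->
  unitary_map (wandering2 S2) (Kmodel1 Theta_tau) (slice2 tau).
Proof.
move=> dm; have gram := frame_orthonormal szP Pnz taunT Pu model kernel dm.
have r_H2 k := uH2_restriction (e k).
have W_sub : subspace (wandering2 S2).
  by case: dec => -[_ S2_sub] _ S2_inv _; exact: subspace_wandering2.
have restrE f : wandering2 S2 f ->
    restriction f = \sum_k fpsC (ip f (e k)) * restriction (e k).
  by move=> Wf; rewrite {1}(proj2 e_basis f Wf) restriction_comb.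
split.
- move=> f Wf; exists (restriction f); split; first exact: restriction_model.
  exact: restriction_slice.
- by move=> f b b' _; exact: slice2_unique.
- move=> f g bf bg Wf Wg /slice2_unique -/(_ _ (restriction_slice Wf)) ->.
  move=> /slice2_unique -/(_ _ (restriction_slice Wg)) ->.
  rewrite -uipE -ipE (parseval W_sub e_basis) //.
  rewrite (restrE f Wf) uip_suml //; [|by move=> k _; exact: uH2Z|exact: uH2_restriction].
  apply: eq_bigr => k _; rewrite uipZl //; last exact: uH2_restriction.
  rewrite (restrE g Wg) uip_sumr // => [|l _]; last exact: uH2Z.
  rewrite (bigD1 k) //= uipZr // gram eqxx mulr1 big1 ?addr0 // => l /negPf lk.
  by rewrite uipZr // gram eq_sym lk mulr0.
move=> b b_model; pose f : fps2 := \sum_k fps2C (uip b (restriction (e k))) * e k.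
have Wf : wandering2 S2 f by apply: comb_mem => //; case: e_basis.
exists f; split=> //; suff -> : b = restriction f by exact: restriction_slice.
rewrite restriction_comb; apply: (model_frame szP Pnz taunT Pu model kernel).
by rewrite -(funext Theta_sliceE).
Qed.

End Basis.
End RegularSlice.

Section SliceTheorem.
Variable R : realType.
Local Notation C := (R[i]).
Local Notation fps2 := (fps (fps C)).
Implicit Types (p : {poly {poly C}}) (S : set fps2).

Lemma wandering2_slice_unitary m n p S1 S2 :
  rational_inner m n p -> shift_decomposition m n p S1 S2 ->
  (forall tau : C, onT tau -> ~ singular_slice p tau ->
     blaschke (fun z => Theta m n p z tau) m /\
     unitary_map (wandering2 S2) (Kmodel1 (fun z => Theta m n p z tau)) (slice2 tau)) /\
  dim_eq (wandering2 S2) m.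
Proof.
move=> p_inner dec; have [d [e [le_dm e_basis]]] := wandering2_basis_exists p_inner dec.
have dm : d = m.
  have [tau [tauT tau_reg]] := regular_slice_exists p_inner.
  have [u Pu] := slice_inverse p_inner tauT tau_reg.
  by apply/eqP; rewrite eqn_leq le_dm (wandering2_basis_ge p_inner dec tauT tau_reg Pu e_basis).
split=> [tau tauT tau_reg|].
  have [u Pu] := slice_inverse p_inner tauT tau_reg; split; first exact: slice_blaschke.
  exact: (slice_unitary p_inner dec tauT tau_reg Pu e_basis dm).
rewrite -dm; apply: (dim_orthonormal_basis _ e_basis).
by case: dec => -[_ S2_sub] _ S2_inv _; exact: subspace_wandering2.
Qed.

Lemma slice1_swap (tau : C) (f : fps2) b : slice1 tau f b <-> slice2 tau (swap f) b.
Proof.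
have eval_swap z : (fun r : R => eval2 f (r%:C * tau) z) = (fun r => eval2 (swap f) z (r%:C * tau)).
  by apply/funext => r; rewrite -!evE ev_swap.
have radlim_swap z := congr1 (fun F => radlim F (eval1 b z)) (eval_swap z).
split=> -[b_H2 b_lim]; (split; first exact: b_H2) => z zD.
  by rewrite -(radlim_swap z); exact: b_lim.
by rewrite (radlim_swap z); exact: b_lim.
Qed.

Lemma unitary_map_swap S K (tau : C) :
  unitary_map (wandering2 (@swap C @^-1` S)) K (slice2 tau) ->
  unitary_map (wandering1 S) K (slice1 tau).
Proof.
move=> [total unique isometric onto]; split.
- move=> f /wandering1_swap/total[b [Kb fb]]; exists b; split; first exact: Kb.
  by apply/slice1_swap; exact: fb.
- move=> f b b' /wandering1_swap Wf /slice1_swap fb /slice1_swap fb'; exact: unique fb fb'.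
- move=> f g bf bg /wandering1_swap Wf /wandering1_swap Wg /slice1_swap fb /slice1_swap gb.
  by rewrite (isometric _ _ _ _ Wf Wg fb gb) -!ipE ip_swap.
move=> b /onto[f [Wf fb]]; exists (swap f); split; first exact/wandering1_swap.
exact/slice1_swap.
Qed.

Lemma dim_eq_swap S d : dim_eq (wandering2 (@swap C @^-1` S)) d -> dim_eq (wandering1 S) d.
Proof.
move=> [e [We e_free e_span]]; exists (fun k => swap (e k)); split.
- by move=> k; apply/wandering1_swap; rewrite swapK; exact: We.
- move=> x xe0; apply: e_free; apply/funext => i; apply/funext => j.
  exact: (congr1 (fun f : fps2 => f j i) xe0).
move=> f /wandering1_swap/e_span[x fE]; exists x; apply/funext => i; apply/funext => j.
exact: (congr1 (fun f : fps2 => f j i) fE).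
Qed.

End SliceTheorem.

Theorem theorem2p2 (R : realType) (m n : nat) (p : {poly {poly R[i]}})
    (S1 S2 : set (coef2 R)) :
  bideg_le m n p ->
  no_zeros_D2 p ->
  no_common_factor p (prefl m n p) ->
  closed_subspace2 S1 -> closed_subspace2 S2 ->
  (forall f, S1 f -> S1 (shift1 f)) ->
  (forall f, S2 f -> S2 (shift2 f)) ->
  orth_decomp (KTheta m n p) S1 S2 ->
  [/\ (forall tau : R[i], onT tau -> ~ (exists tau1, onT tau1 /\ peval p tau1 tau = 0) ->
         blaschke (fun z => Theta m n p z tau) m /\
         unitary_map (wandering2 S2) (Kmodel1 (fun z => Theta m n p z tau)) (slice2 tau)),
      dim_eq (wandering2 S2) m,
      (forall tau : R[i], onT tau -> ~ (exists tau2, onT tau2 /\ peval p tau tau2 = 0) ->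
         blaschke (fun z => Theta m n p tau z) n /\
         unitary_map (wandering1 S1) (Kmodel1 (fun z => Theta m n p tau z)) (slice1 tau)) &
      dim_eq (wandering1 S1) n].
Proof.
move=> bd p_nz p_coprime /closed_subspace2_subspace S1_sub /closed_subspace2_subspace S2_sub.
move=> S1_inv S2_inv orth_dec.
have p_inner : rational_inner m n p by [].
have dec : shift_decomposition m n p S1 S2.
  by split=> // f; rewrite -?shift1E -?shift2E; [exact: S1_inv|exact: S2_inv].
have [slices2 dim2] := wandering2_slice_unitary p_inner dec.
have [slices1 dim1] :=
  wandering2_slice_unitary (rational_inner_swap p_inner) (shift_decomposition_swap dec).
split=> // [tau tauT tau_reg|]; last exact: dim_eq_swap.
have [|B U] := slices1 tau tauT.
  by move=> [tau2 [tau2T p0]]; apply: tau_reg; exists tau2; rewrite -peval_swap.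
have <- : (fun z => Theta n m (swapXY p) z tau) = (fun z => Theta m n p tau z).
  by apply/funext => z; exact: Theta_swap.
by split; [exact: B|exact: unitary_map_swap].
Qed.
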